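(* Consider the queueing network with interference graph $G$ operated under Scheduling Algorithm 1 (both described in the context). For every arrival rate vector $\boldsymbol{\lambda}\in\boldsymbol{\Lambda}^o$ the algorithm is rate stable, i.e. with probability $1$, $$\lim_{t\to\infty}\frac{1}{t}D_i(t)=\lambda_i\qquad\text{for all }1\le i\le n,$$ equivalently $\lim_{t\to\infty}Q_i(t)/t=0$ for all $1\le i\le n$ with probability $1$.
   Context: **Network.** $G=(V,E)$ is a finite graph with $V=\{1,\dots,n\}$ (the queues/nodes); $\mathcal N(i)=\{j:(i,j)\in E\}$. $\mathcal I(G)=\{\boldsymbol\rho\in\{0,1\}^n:\rho_i+\rho_j\le 1\ \forall (i,j)\in E\}$ is the set of independent sets. $\boldsymbol\sigma(t)\in\mathcal I(G)$, $t\in\mathbb R_+$, is the schedule: $\sigma_i(t)=1$ iff node $i$ is transmitting. Queues $\mathbf Q(t)\in\mathbb R_+^n$ start with $\mathbf Q(0)=\mathbf 0$ and satisfy, for $0\le s<t$, $$Q_i(t)=Q_i(s)-\int_s^t\sigma_i(u)\mathbf 1_{\{Q_i(u)>0\}}\,du+A_i(s,t),$$ where $A_i(s,t)$ is the work arriving to queue $i$ during $(s,t]$. The cumulative departures are $D_i(t)=\int_0^t\sigma_i(u)\mathbf 1_{\{Q_i(u)>0\}}\,du$. **Arrivals.** Write $A_i(t)=A_i(0,t)$. The increments $A_i(k,k+1)$, $k\in\mathbb Z_+$, are independent (over $k$, and over different queues $i$), and for each $i$ identically distributed in $k$, with $A_i(1)\in[0,K]$ and $\Pr(A_i(1)=0)>0$.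 The cumulative arrival process is Lipschitz with constant $K$: $0\le A_i(s,t)\le K(t-s)$. $\lambda_i=\mathbb E[A_i(1)]$, $\boldsymbol\lambda=[\lambda_i]$, and $\min_i\lambda_i>0$. **Capacity.** $\mathcal C\subset[0,1]^n$ is the convex hull of $\mathcal I(G)$ and $\boldsymbol\Lambda^o=\{\boldsymbol\lambda\in\mathbb R_+^n:\boldsymbol\lambda<\gamma\text{ componentwise for some }\gamma\in\mathcal C\}$. **CSMA dynamics.** Each node $i$ has a parameter $r_i(t)\in\mathbb R$, and $R_i(t)=\exp(r_i(t))$. A waiting node $i$ ($\sigma_i=0$) has a waiting clock that rings at rate $R_i(t)$ (given the history up to $t$, it rings in $(t,t+\delta)$ with probability $R_i(t)\delta+o(\delta)$). When it rings, node $i$ starts transmitting ($\sigma_i$ becomes $1$) if no neighbor in $\mathcal N(i)$ is transmitting, and otherwise starts a new waiting period. A transmission lasts an exponential time of mean $1$, after which $\sigma_i$ becomes $0$. All clocks are independent of each other and of the arrivals. A node may hold the channel when its queue is empty. **Scheduling Algorithm 1.** Update times $0=L(0)<L(1)<\cdots$ with $T(j)=L(j+1)-L(j)=\exp(\sqrt j)$ for $j\ge1$, and step sizes $\alpha(j)=1/j$ for $j\ge1$ ($T(0)=L(1)$ and $\alpha(0)$ being fixed positive constants). $r_i(t)$ is constant, equal to $r_i(j)$, for $t\in[L(j),L(j+1))$; $r_i(0)=0$; and $$r_i(j+1)=r_i(j)+\alpha(j)\big(\widehat\lambda_i(j)-\widehat s_i(j)\big),$$ $$\widehat\lambda_i(j)=\frac{A_i(L(j),L(j+1))}{T(j)},\qquad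 \widehat s_i(j)=\frac1{T(j)}\int_{L(j)}^{L(j+1)}\sigma_i(t)\,dt.$$ *)

(* Defs.v *)
From HB Require Import structures.
From mathcomp Require Import all_boot all_order all_algebra.
From mathcomp Require Import all_classical all_reals all_analysis.

Set Implicit Arguments.
Unset Strict Implicit.
Unset Printing Implicit Defensive.

Import Order.TTheory GRing.Theory Num.Theory.
Import numFieldNormedType.Exports.

Local Open Scope classical_set_scope.
Local Open Scope ring_scope.

(* The first block is deterministic: [s i t], [a i t], [q i t], [r i t] are the
   schedule, the cumulative arrivals on ]0, t], the backlog and the CSMA
   parameter of node i at time t along one sample path.  Only times t >= 0 are
   meaningful. *)

Definition independent_set (n : nat) (e : rel 'I_n) (rho : {ffun 'I_n -> bool}) :=
  forall i j : 'I_n, e i j -> (rho i + rho j <= 1)%N.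

(* Convex hull of the finite set of independent sets, as the set of its convex
   combinations. *)
Definition capacity_hull (R : realType) (n : nat) (e : rel 'I_n)
    : set ('I_n -> R) :=
  [set gam | exists p : {ffun 'I_n -> bool} -> R,
    [/\ forall rho, 0 <= p rho,
        forall rho, p rho != 0 -> independent_set e rho,
        \sum_rho p rho = 1 &
        forall i, gam i = \sum_rho p rho * (rho i)%:R]].

Definition capacity_region (R : realType) (n : nat) (e : rel 'I_n)
    : set ('I_n -> R) :=
  [set lam | (forall i, 0 <= lam i) /\
    exists2 gam, capacity_hull e gam & forall i, lam i < gam i].

Definition service (R : realType) (n : nat) (s : 'I_n -> R -> bool)
    (q : 'I_n -> R -> R) (i : 'I_n) (u t : R) : R :=
  \int[lebesgue_measure]_(v in `[u, t]) ((s i v)%:R * (0 < q i v)%R%:R).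

Definition departures (R : realType) (n : nat) (s : 'I_n -> R -> bool)
    (q : 'I_n -> R -> R) (i : 'I_n) (t : R) : R :=
  service s q i 0 t.

Definition queue_path (R : realType) (n : nat) (a : 'I_n -> R -> R)
    (s : 'I_n -> R -> bool) (q : 'I_n -> R -> R) : Prop :=
  [/\ forall i, q i 0 = 0,
      forall i (t : R), 0 <= t -> 0 <= q i t &
      forall i (u t : R), 0 <= u -> u < t ->
        q i t = q i u - service s q i u t + (a i t - a i u)].

Definition step_size (R : realType) (alpha0 : R) (j : nat) : R :=
  if j is 0%N then alpha0 else j%:R^-1.

Definition update_period (R : realType) (T0 : R) (j : nat) : R :=
  if j is 0%N then T0 else expR (Num.sqrt j%:R).

Definition update_time (R : realType) (T0 : R) (j : nat) : R :=
  \sum_(k < j) update_period T0 k.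

(* [r i (update_time T0 j)] is r_i(j). *)
Definition algorithm1_path (R : realType) (n : nat) (T0 alpha0 : R)
    (a : 'I_n -> R -> R) (s : 'I_n -> R -> bool) (r : 'I_n -> R -> R) : Prop :=
  let L := update_time T0 in
  let T := update_period T0 in
  let lam_hat i j := (a i (L j.+1) - a i (L j)) / T j in
  let s_hat i j :=
    (T j)^-1 * \int[lebesgue_measure]_(t in `[L j, L j.+1]) (s i t)%:R in
  forall i, [/\ r i 0 = 0,
    forall j t, L j <= t < L j.+1 -> r i t = r i (L j) &
    forall j, r i (L j.+1) =
      r i (L j) + step_size alpha0 j * (lam_hat i j - s_hat i j)].

(* [tau 0 = 0 < tau 1 < ...] are the epochs at which node i ends a waiting period
   or a transmission; the k-th period occupies [tau k, tau k.+1[ and is a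
   transmission iff [s i (tau k)].  [x true i k] and [x false i k] are standard
   exponential variables attached to the k-th period of node i, used when it is a
   transmission, resp. a waiting period.  A waiting clock of (time-varying) rate
   exp(r_i) rings when the rate accumulated since the start of the period reaches
   the exponential level, so that, given the past, it rings in ]t, t + h[ with
   probability exp(r_i(t)) h + o(h).  A ring that finds a neighbor transmitting
   ends the waiting period with [s i] still false: a new waiting period starts. *)
Definition csma_path (R : realType) (n : nat) (e : rel 'I_n)
    (x : bool -> 'I_n -> nat -> R) (r : 'I_n -> R -> R)
    (s : 'I_n -> R -> bool) : Prop :=
  (forall t : R, 0 <= t -> independent_set e [ffun i => s i t]) /\
  forall i, exists tau : nat -> R,
    [/\ tau 0%N = 0 /\ (forall k, tau k < tau k.+1),
        (forall t, exists k, t < tau k),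
        (forall k t, tau k <= t < tau k.+1 -> s i t = s i (tau k)),
        (forall k, s i (tau k) = true ->
           tau k.+1 - tau k = x true i k /\ s i (tau k.+1) = false) &
        (forall k, s i (tau k) = false ->
           \int[lebesgue_measure]_(u in `[tau k, tau k.+1]) expR (r i u)
             = x false i k /\
           (s i (tau k.+1) = true <->
            \forall u \near (tau k.+1)^'-, forall j, e i j -> s j u = false))].

Section Stochastic.
Context d (Omega : measurableType d) (R : realType) (P : probability Omega R).

Definition mutually_independent (I : eqType) (F : I -> set (set Omega)) : Prop :=
  forall (l : seq I) (E : I -> set Omega), uniq l ->
    (forall i, i \in l -> F i (E i)) ->
    P (\bigcap_(i in [set` l]) E i) = (\prod_(i <- l) P (E i))%E.

Definition slot_arrival (n : nat) (A : 'I_n -> R -> {RV P >-> R})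
    (i : 'I_n) (k : nat) : Omega -> R :=
  fun w => A i k.+1%:R w - A i k%:R w.

Record arrival_process (n : nat) (K : R) (A : 'I_n -> R -> {RV P >-> R})
    : Prop := {
  arrival_lipschitz : {ae P, forall w, forall i, A i 0 w = 0 /\
    forall s t : R, 0 <= s -> s < t -> 0 <= A i t w - A i s w <= K * (t - s)} ;
  arrival_bounded : forall i, {ae P, forall w, 0 <= A i 1 w <= K} ;
  arrival_independent : mutually_independent
    (fun ik : 'I_n * nat => g_sigma_algebra_preimage (slot_arrival A ik.1 ik.2)) ;
  arrival_identical : forall i k (B : set R), measurable B ->
    P (slot_arrival A i k @^-1` B) = P (slot_arrival A i 0 @^-1` B) ;
  arrival_atom : forall i, (0 < P [set w | A i 1%R w = 0%R])%E }.

(* The sigma-algebra of everything that the clocks are independent of: the whole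
   arrival process and the (arbitrary, possibly random) initial schedule. *)
Definition environment (n : nat) (A : 'I_n -> R -> {RV P >-> R})
    (s0 : 'I_n -> {RV P >-> bool}) : set (set Omega) :=
  <<s \bigcup_(it in [set it : 'I_n * R | 0 <= it.2])
        g_sigma_algebra_preimage (A it.1 it.2)
      `|` \bigcup_i g_sigma_algebra_preimage (s0 i) >>.

Record csma_clocks (n : nat) (X : bool -> 'I_n -> nat -> {RV P >-> R})
    (G : set (set Omega)) : Prop := {
  clock_exponential : forall b i k (B : set R), measurable B ->
    distribution P (X b i k) B = exponential_prob 1 B ;
  clock_independent : mutually_independent
    (fun c : option (bool * 'I_n * nat) =>
       if c is Some bik then g_sigma_algebra_preimage (X bik.1.1 bik.1.2 bik.2)
       else G) }.

(* The network with arrivals A, clocks X, schedule sigma, CSMA parameters r and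
   backlogs Q, operated under the scheduling algorithm. *)
Record csma_network (n : nat) (e : rel 'I_n) (K T0 alpha0 : R)
    (A : 'I_n -> R -> {RV P >-> R}) (X : bool -> 'I_n -> nat -> {RV P >-> R})
    (sigma : 'I_n -> R -> {RV P >-> bool}) (r Q : 'I_n -> R -> {RV P >-> R})
    : Prop := {
  network_arrivals : arrival_process K A ;
  network_clocks : csma_clocks X (environment A (fun i => sigma i 0)) ;
  network_csma : {ae P, forall w, csma_path e (fun b i k => X b i k w)
    (fun i t => r i t w) (fun i t => sigma i t w)} ;
  network_algorithm : {ae P, forall w, algorithm1_path T0 alpha0
    (fun i t => A i t w) (fun i t => sigma i t w) (fun i t => r i t w)} ;
  network_queues : {ae P, forall w, queue_path
    (fun i t => A i t w) (fun i t => sigma i t w) (fun i t => Q i t w)} }.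

End Stochastic.

(* Main.v *)
(** The vector r of CSMA parameters performs a stochastic ascent of the concave
    function F(r) = <lam, r> - ln Z(r), whose gradient is lam - s(r), where s(r) is
    the mean service under the Gibbs measure of partition function Z(r).  For lam in
    the capacity region F is bounded above, so with errors that are square summable
    against the steps 1/j the sum of |lam - s(r(j))|^2 / j converges; as s is Lipschitz
    and r moves by O(1/j), s(r(j)) tends to lam.

    The errors are those of the empirical service and of the empirical arrival rate.
    Within window j, the number of times that node i ends a period in configuration g,
    minus the time spent there multiplied by the rate, is a martingale whose second
    moment is at most the rate cap times T(j).  Since |r(j)| = O(ln j) while T(j)
    grows faster than every power of j, almost surely the empirical distribution of
    configurations nearly satisfies the balance equations, and a Dirichlet form
    estimate makes it O(1/j)-close to the Gibbs measure.  Along a fixed script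
    (the order of the events) the network is a deterministic function of the clocks, so
    the martingale property reduces to the vanishing of an integral over one
    exponential clock, the others being fixed.

    Finally s(r(j)) -> lam and T(j) = o(L(j)) give S(t)/t -> lam and A(t)/t -> lam, and
    Q(t) = (A - S)(t) - (A - S)(u), where u is the last zero of Q before t. *)

Require Import Defs.
From HB Require Import structures.
From mathcomp Require Import all_boot all_order all_algebra.
From mathcomp Require Import all_classical all_reals all_analysis.
From mathcomp Require Import measurable_realfun.
From mathcomp Require Import ring lra zify.

Set Implicit Arguments.
Unset Strict Implicit.
Unset Printing Implicit Defensive.

Import Order.TTheory GRing.Theory Num.Theory.
Import numFieldNormedType.Exports.

Local Open Scope classical_set_scope.
Local Open Scope ring_scope.

(** * Resampling one clock *)

(** No filtration, stopping time or jump process theory is set up. For a script [w] of fixed length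
    every quantity is an explicit function of the clocks, and almost surely exactly one script of
    each length is [active], so that an expectation along the random path becomes a finite sum over
    scripts. After [w], the current clock of a node has entered only through the condition that it
    exceeds the amount already consumed. With all other clocks frozen it is thus a memoryless clock
    racing against a deadline, and Fubini's theorem does the work of conditional expectation.

    The number of events in a window is random and unbounded; the script length is therefore sent to
    infinity by Fatou's lemma. The cap [rho] on the rates keeps all variables bounded along a fixed
    script; it is taken as the exponential of a deterministic bound on the parameters, so that the
    actual path never meets it. The initial schedule is random too: the bounds are proved on each of
    the finitely many events that fix it. Every error is a power of J against a negative power of
    T(J), which is why crude constants are affordable. *)

Section Resampling.
Context d d' (Omega : measurableType d) (T' : measurableType d') (R : realType).
Variables (P : probability Omega R).

Lemma probability_bounded_integrable (f : Omega -> R) (M : R) :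
  measurable_fun setT f -> (forall w, `|f w| <= M) ->
  P.-integrable setT (EFin \o f).
Proof.
move=> mf fM; apply: measurable_bounded_integrable => //.
  exact: le_lt_trans (probability_le1 P measurableT) (ltry _).
by exists M; split=> [|x Mx y _]; [exact: num_real|exact: le_trans (fM y) (ltW Mx)].
Qed.

Variables (X : {RV P >-> R}) (Y : Omega -> T').
Hypothesis mY : measurable_fun setT Y.
Hypothesis indep : forall E B, measurable E -> measurable B ->
  P (Y @^-1` E `&` X @^-1` B) = (P (Y @^-1` E) * P (X @^-1` B))%E.

(** By independence the joint law of [Y] and [X] is the product law, so Fubini's theorem integrates
    [X] alone, with [y] frozen. In the applications [Y] carries everything but one clock. *)
Lemma resample_integral0 (F : T' * R -> R) (M : R) :
  measurable_fun setT F -> (forall z, `|F z| <= M) ->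
  (forall y, \int[distribution P X]_x (F (y, x))%:E = 0)%E ->
  (\int[P]_w (F (Y w, X w))%:E = 0)%E.
Proof.
move=> mF FM F0.
pose Y' : {mfun Omega >-> T'} := HB.pack Y (isMeasurableFun.Build _ _ _ _ _ mY).
have mZ : measurable_fun setT (fun w => (Y w, X w)) by exact: measurable_fun_pair.
pose Z' : {mfun Omega >-> (T' * R)%type} := HB.pack (fun w => (Y w, X w))
  (isMeasurableFun.Build _ _ _ _ _ mZ).
have intF : P.-integrable setT ((EFin \o F) \o Z').
  apply: (@probability_bounded_integrable (F \o Z') M) => [|w]; last exact: FM.
  exact: measurableT_comp.
have mEF : measurable_fun [set: (T' * R)%type] (EFin \o F) by exact/measurable_EFinP.
rewrite -[LHS]/(\int[P]_w ((EFin \o F) \o Z') w)%E.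
rewrite -[LHS](integral_distribution (P := P) (X := Z') mEF intF).
have -> : (\int[distribution P Z']_y (EFin \o F) y =
    \int[distribution P Y' \x distribution P X]_y (EFin \o F) y)%E.
  apply: eq_measure_integral => E mE _; apply/esym; apply: product_measure_unique => //.
rewrite -integral12_prod_meas1.
  by rewrite /fubini_F; under eq_integral do rewrite /= F0; rewrite integral0.
have Fsub : forall E, measurable E -> (distribution P Y' \x distribution P X)%E E =
   distribution P Z' E.
  by move=> E mE; apply: product_measure_unique.
apply/integrableP; split => //.
apply: (@le_lt_trans _ _ (\int[distribution P Y' \x distribution P X]_z (cst `|M|%:E) z)%E).
  apply: ge0_le_integral => //=.
    by apply/measurable_EFinP; exact: measurableT_comp.
  by move=> z _; rewrite lee_fin (le_trans (FM z))// ler_norm.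
rewrite integral_cst//; apply: lte_mul_pinfty => //.
exact: le_lt_trans (probability_le1 _ measurableT) (ltry _).
Qed.

Lemma resample_null (S : set (T' * R)) :
  measurable S -> (forall y, distribution P X [set x | S (y, x)] = 0%E) ->
  P [set w | S (Y w, X w)] = 0%E.
Proof.
move=> mS S0.
have mZ : measurable_fun setT (fun w => (Y w, X w)) by exact: measurable_fun_pair.
have mSw : measurable [set w | S (Y w, X w)].
  by have := mZ measurableT _ mS; rewrite setTI.
have := @resample_integral0 (\1_S) 1 (measurable_indic mS) _ _.
rewrite -[X in (\int[P]_w X w)%E]/(fun w => (\1_S (Y w, X w))%:E).
have -> : (fun w => (\1_S (Y w, X w))%:E) = EFin \o (\1_[set w | S (Y w, X w)] : _ -> R).
  by apply/funext => w /=; rewrite !indicE; congr (_%:R%:E); apply/idP/idP; rewrite !inE.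
rewrite integral_indic// setIT; apply.
  by move=> z; rewrite indicE; case: (_ \in _); rewrite ?normr1 ?normr0.
move=> y.
have mSy : measurable [set x | S (y, x)] by have := measurable_xsection y mS; rewrite /xsection; congr measurable; apply/funext => x/=; rewrite propeqE inE.
transitivity (\int[distribution P X]_x (\1_[set x | S (y, x)] x)%:E)%E.
  by apply: eq_integral => x _; rewrite !indicE; congr (_%:R%:E); apply/idP/idP; rewrite !inE.
rewrite integral_indic// setIT; exact: S0.
Qed.

End Resampling.

(** * The exponential law and the race of one clock against a deadline *)

Section Exponential.
Context (R : realType).
Notation expo := (@exponential_prob R 1).
Notation mu := (@lebesgue_measure R).

(** The law is known only set by set; the density is recovered as a Radon-Nikodym derivative, which
    agrees almost everywhere with the exponential density because both have the same integral over
    every measurable set. *)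
Lemma integral_exponential_prob (nu : probability (measurableTypeR R) R)
    (f : R -> R) (M : R) :
  (forall B, measurable B -> nu B = expo B) ->
  measurable_fun setT f -> (forall x, `|f x| <= M) ->
  (\int[nu]_x (f x)%:E = \int[mu]_x (f x * exponential_pdf 1 x)%:E)%E.
Proof.
move=> nuE mf fM.
have mpdf := @measurable_exponential_pdf R 1.
have ipdf := @integrable_exponential_pdf R 1 ltr01.
have num : nu `<< mu.
  apply/null_content_dominatesP => A mA A0.
  rewrite nuE// /exponential_prob; apply: null_set_integral => //.
  exact/measurable_funTS/measurable_EFinP.
pose g := Radon_Nikodym (charge_of_finite_measure nu) mu.
have gE : ae_eq mu setT g (EFin \o exponential_pdf 1).
  apply: integral_ae_eq => //.
    by apply: Radon_Nikodym_integrable.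
    exact/measurable_EFinP.
  move=> E _ mE; rewrite -Radon_Nikodym_integral//; exact: nuE.
rewrite -(Radon_Nikodym_change_of_variables num measurableT); last first.
  exact: (@probability_bounded_integrable _ _ _ nu f M).
apply: ae_eq_integral => //.
- apply: emeasurable_funM; first exact/measurable_EFinP.
  apply: measurable_int; exact: Radon_Nikodym_integrable.
- by apply/measurable_EFinP; apply: measurable_funM.
- under [X in ae_eq _ _ _ X]eq_fun do rewrite EFinM.
  by apply: filterS gE => x gx _; have := gx I; rewrite /g => ->.
Qed.

Lemma exponential_prob_set1 (a : R) : expo [set a] = 0%E.
Proof.
rewrite /exponential_prob; apply: null_set_integral => //.
- by apply/measurable_funTS/measurable_EFinP; exact: measurable_exponential_pdf.
- exact: lebesgue_measure_set1.
Qed.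

Lemma exponential_prob_nonpos : expo [set x | x <= 0] = 0%E.
Proof.
have -> : [set x : R | x <= 0] = `]-oo, 0[ `|` [set 0].
  apply/funext => x; rewrite propeqE/= in_itv/= le_eqVlt; split.
    by move=> /orP[/eqP->|->]; [right|left].
  by move=> [->|->]; rewrite ?eqxx ?orbT.
apply/eqP; rewrite -measure_le0.
apply: (@le_trans _ _ (expo `]-oo, 0%R[ + expo [set 0%R])%E); first exact: measureU2.
rewrite exponential_prob_set1 adde0 /exponential_prob.
rewrite integral0_eq// => x /=; rewrite in_itv/= => x0.
by rewrite lt0_exponential_pdf.
Qed.

(* The change of the square defect of a compensated counting process when its
   clock, of residual life y, is raced against a deadline U. *)
Definition race_defect (a b U y : R) : R :=
  if y < U then a + 2 * b * y - a * y - b * y ^+ 2 else - a * U - b * U ^+ 2.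

Lemma race_defect_bound (a b U B y : R) : 0 <= U <= B -> 0 <= y ->
  `|race_defect a b U y| <= `|a| + 2 * `|b| * B + `|a| * B + `|b| * B ^+ 2.
Proof.
move=> /andP[U0 UB] y0; rewrite /race_defect.
have B0 : 0 <= B by lra.
have := normr_ge0 a; have := normr_ge0 b => nb na.
have bd (c z : R) (n : nat) : 0 <= z <= B -> `|c * z ^+ n| <= `|c| * B ^+ n.
  move=> /andP[z0 zB]; rewrite normrM normrX (ger0_norm z0) ler_wpM2l//.
  by rewrite lerXn2r ?nnegrE.
case: ifP => yU.
  have yB : 0 <= y <= B by lra.
  have := bd b y 1%N yB; have := bd a y 1%N yB; have := bd b y 2%N yB.
  rewrite !expr1 !ler_norml => /andP[h1 h2] /andP[h3 h4] /andP[h5 h6].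
  have := ler_norm a; have := ler_norm (- a); rewrite normrN => h7 h8.
  apply/andP; split; lra.
have UB' : 0 <= U <= B by lra.
have := bd a U 1%N UB'; have := bd b U 2%N UB'.
rewrite !expr1 !ler_norml => /andP[h1 h2] /andP[h3 h4].
have h9 : 0 <= 2 * `|b| * B by rewrite !mulr_ge0.
apply/andP; split; lra.
Qed.

Lemma measurable_race_defect d (T : measurableType d) (a b U y : T -> R) :
  measurable_fun setT a -> measurable_fun setT b -> measurable_fun setT U ->
  measurable_fun setT y ->
  measurable_fun setT (fun t => race_defect (a t) (b t) (U t) (y t)).
Proof.
move=> ma mb mU my; rewrite /race_defect; apply: measurable_fun_if => //.
- exact: measurable_fun_ltr.
- apply: measurable_funTS; apply: measurable_funB; last first.
    by apply: measurable_funM => //; exact: measurable_funX.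
  apply: measurable_funB; last exact: measurable_funM.
  by apply: measurable_funD => //; apply: measurable_funM => //; exact: measurable_funM.
- apply: measurable_funTS; apply: measurable_funB.
    by apply: measurable_funM => //; exact: measurableT_comp.
  by apply: measurable_funM => //; exact: measurable_funX.
Qed.

(** Put phi(z) = a z + b z^2. The defect is phi'(y) - phi(y) if y < U and - phi(U) otherwise. As
    phi(z) exp(-z) is an antiderivative of (phi' - phi) exp(-z), the part before the deadline
    contributes phi(U) exp(-U), up to the factor exp(-h), and the surviving mass contributes its
    opposite. The shift by [h] is the memoryless property: [h] is the level already consumed. *)
Lemma integral_race_defect_borel (nu : probability (measurableTypeR R) R) (a b h U : R) :
  (forall B, measurable B -> nu B = expo B) -> 0 <= h -> 0 < U ->
  (\int[nu]_x (if h < x then race_defect a b U (x - h) else 0)%:E = 0)%E.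
Proof.
move=> nuE h0 U0.
pose f x := if h < x then race_defect a b U (x - h) else 0.
have mf : measurable_fun setT f.
  apply: measurable_fun_if => //; first exact: measurable_fun_ltr.
  by apply: measurable_funTS; apply: measurable_race_defect => //; exact: measurable_funB.
pose c : R := - a * U - b * U ^+ 2.
rewrite -[LHS]/(\int[nu]_x (f x)%:E)%E.
rewrite (@integral_exponential_prob nu f (`|a| + 2 * `|b| * U + `|a| * U + `|b| * U ^+ 2))//; last first.
  move=> x; rewrite /f; case: ifP => hx; last first.
    by rewrite normr0 !addr_ge0// !mulr_ge0// ?exprn_ge0// ltW.
  by apply: race_defect_bound; rewrite ?lexx ?ltW// subr_gt0.
pose g x := f x * exponential_pdf 1 x.
have mg : measurable_fun setT (EFin \o g).
  by apply/measurable_EFinP; apply: measurable_funM => //; exact: measurable_exponential_pdf.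
have gE x : h < x -> g x = race_defect a b U (x - h) * expR (- x).
  by move=> hx; rewrite /g /f hx exponential_pdfE ?mul1r ?mulN1r//; lra.
rewrite -[LHS]/(\int[mu]_x (EFin \o g) x)%E.
have -> : [set: R] = `]-oo, h] `|` (`]h, h + U[ `|` `[h + U, +oo[).
  by apply/seteqP; split => x //= _; rewrite !in_itv/= !andbT; lra.
rewrite integral_setU//=; first last.
- by apply/disj_setPS => x [] /=; rewrite !in_itv/= !andbT => ? ?; lra.
- exact: measurable_funTS.
- by apply: measurableU.
rewrite integral_setU//=; first last.
- by apply/disj_setPS => x [] /=; rewrite !in_itv/= !andbT => ? ?; lra.
- exact: measurable_funTS.
rewrite [X in (X + _)%E]integral0_eq ?add0e; last first.
  by move=> x /=; rewrite in_itv/= => xh; rewrite /g /f ltNge xh/= mul0r.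
pose k x : R := (a + 2 * b * (x - h) - a * (x - h) - b * (x - h) ^+ 2) * expR (- x).
pose G x : R := (a * (x - h) + b * (x - h) ^+ 2) * expR (- x).
have dG (x : R) : is_derive x (1 : R) G (k x).
  rewrite /G; apply: is_derive_eq; rewrite /k /GRing.scale/=; ring.
have contk : continuous k.
  move=> x; rewrite /k; apply: cvgM; last first.
    by apply: continuous_comp; [exact: opp_continuous|exact: continuous_expR].
  have cB : (y - h) @[y --> x] --> x - h by apply: cvgB => //; exact: cvg_cst.
  apply: cvgB; last by apply: cvgM; [exact: cvg_cst|apply: cvgM].
  apply: cvgB; last by apply: cvgM; [exact: cvg_cst|].
  by apply: cvgD; [exact: cvg_cst|apply: cvgM; [exact: cvg_cst|]].
have contG : continuous G.
  by move=> x; apply/differentiable_continuous/derivable1_diffP.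
have hU : h < h + U by lra.
have -> : (\int[mu]_(x in `]h, (h + U)%R[) (g x)%:E = (G (h + U)%R)%:E - (G h)%:E)%E.
  rewrite -(@continuous_FTC2 _ k G h (h + U)) //.
  - rewrite -integral_itv_bndo_bndc; last first.
      by apply/measurable_funTS/measurable_EFinP; exact: continuous_measurable_fun.
    rewrite -integral_itv_obnd_cbnd; last first.
      by apply/measurable_funTS/measurable_EFinP; exact: continuous_measurable_fun.
    apply: eq_integral => x; rewrite inE/= in_itv/= => /andP[hx xU].
    by rewrite gE// /race_defect ltrBlDl xU.
  - exact: continuous_subspaceT.
  - split; first by move=> x _; exact: ex_derive.
    + by apply: cvg_at_right_filter; exact: contG.
    + by apply: cvg_at_left_filter; exact: contG.
  - by move=> x _; rewrite derive1E; apply: derive_val.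
have -> : (\int[mu]_(x in `[(h + U)%R, +oo[) (g x)%:E = (c * expR (- (h + U)))%R%:E)%E.
  transitivity (\int[mu]_(x in `[(h + U)%R, +oo[) (c%:E * (expR (- x)%R)%:E))%E.
    apply: eq_integral => x; rewrite inE/= in_itv/= andbT => hx.
    rewrite gE; last by lra.
    by rewrite /race_defect ifF ?EFinM//; apply/negbTE; rewrite -leNgt; lra.
  have mE : measurable_fun `[h + U, +oo[ (fun x => (expR (- x))%:E).
    apply/measurable_funTS/measurable_EFinP; apply: measurableT_comp => //.
  have E1 : (\int[mu]_(x in `[(h + U)%R, +oo[) (expR (- x)%R)%:E = (expR (- (h + U))%R)%:E)%E.
    rewrite (@ge0_continuous_FTC2y _ (fun x => expR (- x)) (fun x => - expR (- x)) (h + U) 0).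
    - by rewrite EFinN oppeK add0e.
    - by move=> x _; exact: expR_ge0.
    - apply: continuous_subspaceT => x.
      by apply: continuous_comp; [exact: opp_continuous|exact: continuous_expR].
    - by rewrite -oppr0; apply: cvgN; exact: cvgr_expR.
    - by move=> x _; exact: ex_derive.
    - apply: cvg_at_right_filter; apply: cvgN.
      by apply: continuous_comp; [exact: opp_continuous|exact: continuous_expR].
    - move=> x _; rewrite derive1E; apply: derive_val.
      by apply: is_derive_eq; rewrite /GRing.scale/=; ring.
  rewrite integralZl//; last first.
    apply/integrableP; split => //.
    under eq_integral do rewrite gee0_abs ?lee_fin ?expR_ge0//.
    by rewrite E1 ltry.
  by rewrite E1 EFinM.
rewrite -EFinB -EFinD /G /c; congr (_%:E).
rewrite subrr (addrC h) addrK; ring.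
Qed.

(* [R] and [measurableTypeR R] carry distinct structures, hence the transport. *)
Lemma integral_race_defect (nu : probability R R) (a b h U : R) :
  (forall B, measurable B -> nu B = expo B) -> 0 <= h -> 0 < U ->
  (\int[nu]_x (if h < x then race_defect a b U (x - h) else 0)%:E = 0)%E.
Proof.
move=> nuE h0 U0.
have mid : measurable_fun [set: R] (id : R -> measurableTypeR R) by [].
pose i : {mfun R >-> measurableTypeR R} :=
  HB.pack (id : R -> measurableTypeR R) (isMeasurableFun.Build _ _ _ _ _ mid).
rewrite -[RHS](@integral_race_defect_borel (distribution nu i) a b h U)//.
pose f (x : R) := if h < x then race_defect a b U (x - h) else 0.
have mf : measurable_fun [set: R] f.
  apply: measurable_fun_if => //; first exact: measurable_fun_ltr.
  by apply: measurable_funTS; apply: measurable_race_defect => //; exact: measurable_funB.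
apply/esym; apply: (@integral_distribution _ _ _ _ _ nu i (EFin \o f)).
  exact/measurable_EFinP.
apply: (@probability_bounded_integrable _ _ _ nu _ (`|a| + 2 * `|b| * U + `|a| * U + `|b| * U ^+ 2)) => // x.
rewrite /f; case: ifP => hx; last first.
  by rewrite normr0 !addr_ge0// !mulr_ge0// ?exprn_ge0// ltW.
by apply: race_defect_bound; rewrite ?lexx ?ltW// subr_gt0.
Qed.

End Exponential.

(** * Independence of one field from all the others together *)

Section Independence.
Context d (Omega : measurableType d) (R : realType) (P : probability Omega R).
Context (I : choiceType) (F : I -> set (set Omega)).
Hypothesis F_measurable : forall i, F i `<=` measurable.
Hypothesis F_setT : forall i, F i setT.
Hypothesis F_setI : forall i, setI_closed (F i).
Hypothesis F_indep : mutually_independent P F.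

(** A pi-system that generates the sigma-algebra of the fields other than [F i0]. *)
Let cylinder (i0 : I) : set (set Omega) :=
  [set E | exists l (EE : I -> set Omega),
    [/\ uniq l, i0 \notin l, forall i, F i (EE i) & E = \bigcap_(i in [set` l]) EE i]].

(** Mutual independence speaks of finitely many events only. The finite measures P(. [&] A) and P(A)
    P(.) agree on the cylinders that avoid [i0], hence on the generated sigma-algebra. *)
Lemma mutually_independent_rest (i0 : I) (A E : set Omega) :
  F i0 A -> <<s \bigcup_(i in [set i | i != i0]) F i >> E ->
  P (E `&` A) = (P E * P A)%E.
Proof.
move=> FA sE.
have mA : measurable A by exact: F_measurable FA.
have cylI : setI_closed (cylinder i0).
  move=> _ _ [l1 [E1 [u1 n1 F1 ->]]] [l2 [E2 [u2 n2 F2 ->]]].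
  (* The two index lists may overlap; on a common index the two events are intersected, and [setT]
     stands in for an absent index. *)
  exists (undup (l1 ++ l2)), (fun i => (if i \in l1 then E1 i else setT) `&`
    (if i \in l2 then E2 i else setT)); split.
  - exact: undup_uniq.
  - by rewrite mem_undup mem_cat negb_or n1 n2.
  - by move=> i; apply: F_setI; case: ifP.
  - apply/seteqP; split => w.
      move=> [h1 h2] i /= _; split; case: ifP => // il; [exact: h1|exact: h2].
    move=> h; split => i /= il.
      by have := h i; rewrite /= mem_undup mem_cat il => /(_ isT)[].
    by have := h i; rewrite /= mem_undup mem_cat il orbT => /(_ isT)[].
have cyl_measurable : cylinder i0 `<=` measurable.
  move=> _ [l [EE [ul _ FE ->]]].
  rewrite bigcap_seq; apply: bigsetI_measurable => i _.
  exact: F_measurable (FE i).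
have pA : (0 <= fine (P A)) by exact: fine_ge0.
have PAfin : P A \is a fin_num by exact: fin_num_measure.
pose m1 := mrestr P mA.
pose m2 := mscale (NngNum pA) P.
have m1E B : m1 B = P (B `&` A) by [].
have m2E B : m2 B = (P A * P B)%E by rewrite -[in RHS](fineK PAfin).
have cylT : cylinder i0 setT.
  exists [::], (fun=> setT); split => //.
  by rewrite set_nil bigcap_set0.
have := @g_sigma_algebra_measure_unique _ _ _ (cylinder i0) cyl_measurable
  (fun=> setT) (fun=> cylT) _ m1 m2 cylI.
have -> : \bigcup_(_ in [set: nat]) [set: Omega] = setT.
  by apply/seteqP; split => // w _; exists 0%N.
move=> /(_ erefl) uniqm.
have : m1 E = m2 E.
  apply: uniqm.
  - move=> _ [l [EE [ul nl FE ->]]].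
    apply: (eq_trans (m1E _)); apply: esym; apply: (eq_trans (m2E _)); apply: esym.
    pose EE' i := if i == i0 then A else EE i.
    have eqE : forall i, i \in l -> EE' i = EE i.
      by move=> i il; rewrite /EE'; case: eqP => // ii0; rewrite -ii0 il in nl.
    have := @F_indep l EE ul (fun i _ => FE i) => ->.
    have := @F_indep (i0 :: l) EE'; rewrite /= nl ul => /(_ isT) => h.
    have EE'0 : EE' i0 = A by rewrite /EE' eqxx.
    have -> : (P A * \prod_(i <- l) P (EE i) = \prod_(i <- i0 :: l) P (EE' i))%E.
      rewrite big_cons EE'0; congr (_ * _)%E.
      by apply: eq_big_seq => i il; rewrite eqE.
    rewrite -h; last by move=> i _; rewrite /EE'; case: eqP => [->|].
    congr (P _); apply/seteqP; split => w.
      move=> [h1 h2] i /=; rewrite inE => /orP[/eqP->|il]; first by rewrite /EE' eqxx.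
      by rewrite eqE//; exact: h1.
    move=> h1; split; last by have := h1 i0; rewrite /= mem_head /EE' eqxx; exact.
    by move=> i /= il; have := h1 i; rewrite /= inE il orbT eqE//; exact.
  - by move=> k; apply: (@le_lt_trans _ _ (P A)); [rewrite -[leLHS]/(m1 setT) m1E setTI|rewrite -ge0_fin_numE].
  - move: E sE; apply: sub_sigma_algebra2 => B [i /= ii0 FB].
    exists [:: i], (fun j => if j == i then B else setT); split => //.
    + by rewrite inE eq_sym.
    + by move=> j; case: eqP => [->|].
    + by apply/seteqP; split => w => [Bw j /=|/(_ i)/=]; rewrite inE => //; [move=> /eqP->; rewrite eqxx|rewrite eqxx; exact].
by rewrite -m1E muleC -m2E.
Qed.

End Independence.

Section SigmaPreimage.
Context d (Omega : measurableType d) d' (T : measurableType d').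

Lemma g_sigma_algebra_preimageE (f : Omega -> T) (A : set Omega) :
  g_sigma_algebra_preimage f A <-> exists2 B, measurable B & A = f @^-1` B.
Proof.
split; first by move=> [B mB <-]; exists B => //; rewrite setTI.
by move=> [B mB ->]; exists B => //; rewrite setTI.
Qed.

Lemma g_sigma_algebra_preimage_measurable (f : Omega -> T) :
  measurable_fun setT f -> g_sigma_algebra_preimage f `<=` measurable.
Proof. by move=> mf A [B mB <-]; exact: mf. Qed.

Lemma g_sigma_algebra_preimage_setT (f : Omega -> T) :
  g_sigma_algebra_preimage f setT.
Proof. by apply/g_sigma_algebra_preimageE; exists setT. Qed.

Lemma g_sigma_algebra_preimage_setI (f : Omega -> T) :
  setI_closed (g_sigma_algebra_preimage f).
Proof.
move=> A B /g_sigma_algebra_preimageE[A' mA ->] /g_sigma_algebra_preimageE[B' mB ->].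
by apply/g_sigma_algebra_preimageE; exists (A' `&` B') => //; exact: measurableI.
Qed.

End SigmaPreimage.

(** * Simulating the network along a script *)

Section UpdateTimes.
Context (R : realType) (T0 : R).
Hypothesis T0_gt0 : 0 < T0.

Lemma update_period_gt0 j : 0 < update_period T0 j.
Proof. by case: j => // j; exact: expR_gt0. Qed.

Lemma update_time0 : update_time T0 0 = 0.
Proof. by rewrite /update_time big_ord0. Qed.

Lemma update_timeS j : update_time T0 j.+1 = update_time T0 j + update_period T0 j.
Proof. by rewrite /update_time big_ord_recr. Qed.

Lemma update_time_ltS j : update_time T0 j < update_time T0 j.+1.
Proof. by rewrite update_timeS ltrDl update_period_gt0. Qed.

Lemma update_time_le : {homo update_time T0 : i j / (i <= j)%N >-> i <= j}.
Proof.
by apply: homo_leq => [//|? ? ?|j]; [exact: le_trans|exact/ltW/update_time_ltS].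
Qed.

Lemma update_time_ge0 j : 0 <= update_time T0 j.
Proof. by rewrite -update_time0; exact: update_time_le. Qed.

End UpdateTimes.

Section Toggle.
Context (n : nat) (e : rel 'I_n).
Implicit Type g : {ffun 'I_n -> bool}.

Definition may_toggle g i := g i || [forall j, e i j ==> ~~ g j].

(** A blocked ring leaves [g] unchanged but still ends a period. It is a self-loop, counted both as
    inflow and as outflow of [g], and so cancels in the balance equations. *)
Definition toggle g i : {ffun 'I_n -> bool} :=
  if may_toggle g i then [ffun j => if j == i then ~~ g i else g j] else g.

End Toggle.

(* A script lists, latest first, which event happened next: the end of the current
   period of node i, or an update of the parameters (None).  Along a script the
   schedule is deterministic and the clocks enter only through the times of the
   events.  [c] gives the clocks, [a i j] the empirical arrival rate of window j. *)
Section Scripts.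
Context (R : realType) (n : nat) (e : rel 'I_n) (T0 alpha0 : R).
Context (s0 : {ffun 'I_n -> bool}).

Local Notation config := {ffun 'I_n -> bool}.
Local Notation script := (seq (option 'I_n)).
Local Notation L := (update_time T0).
Local Notation T := (update_period T0).

Fixpoint sched (w : script) : config :=
  if w is v :: w' then if v is Some i then toggle e (sched w') i else sched w' else s0.

Definition ends (w : script) (i : 'I_n) : nat := count_mem (Some i) w.

Definition window (w : script) : nat := count_mem None w.

(** [sim_used] is the consumed part of the current exponential level of a node: elapsed time during
    a transmission, accumulated hazard during a waiting period. [sim_occ J g] is the time spent in
    configuration [g] within window [J]. *)
Record sim_state := SimState {
  sim_now : R;
  sim_used : 'I_n -> R;
  sim_par : 'I_n -> R;
  sim_occ : nat -> config -> R }.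

Section Simulation.
Context (c : bool -> 'I_n -> nat -> R) (a : 'I_n -> nat -> R).

Definition current w i : R := c (sched w i) i (ends w i).

Definition state_speed (w : script) (st : sim_state) (i : 'I_n) : R :=
  if sched w i then 1 else expR (sim_par st i).

Definition state_delay (w : script) (st : sim_state) (v : option 'I_n) : R :=
  if v is Some i then (current w i - sim_used st i) / state_speed w st i
  else L (window w).+1 - sim_now st.

(** The components are computed together because they feed each other: delays depend on the
    parameters, and at an update these depend on the occupation times, from which the empirical
    service is read off. Nothing forces the delays to be positive; a script that contradicts the
    clocks is simulated all the same and is discarded by [active]. *)
Fixpoint sim (w : script) : sim_state :=
  if w is v :: w' then
    let st := sim w' in
    let delta := state_delay w' st v in
    let J := window w' in
    let occ := fun j g => sim_occ st j g +
      (if (j == J) && (g == sched w') then delta else 0) in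
    SimState (sim_now st + delta)
      (fun j => if v == Some j then 0 else sim_used st j + state_speed w' st j * delta)
      (if v is Some _ then sim_par st else fun i => sim_par st i +
         step_size alpha0 J *
           (a i J - (T J)^-1 * \sum_(g : config) (g i)%:R * occ J g))
      occ
  else SimState 0 (fun=> 0) (fun=> 0) (fun _ _ => 0).

Definition now w := sim_now (sim w).
Definition used w := sim_used (sim w).
Definition par w := sim_par (sim w).
Definition occupation w := sim_occ (sim w).
Definition speed w i := state_speed w (sim w) i.
Definition delay w v := state_delay w (sim w) v.

Lemma now_nil : now [::] = 0. Proof. by []. Qed.
Lemma used_nil i : used [::] i = 0. Proof. by []. Qed.
Lemma par_nil i : par [::] i = 0. Proof. by []. Qed.
Lemma occupation_nil j g : occupation [::] j g = 0. Proof. by []. Qed.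

Lemma currentE w i : current w i = c (sched w i) i (ends w i). Proof. by []. Qed.

Lemma speedE w i : speed w i = if sched w i then 1 else expR (par w i).
Proof. by []. Qed.

Lemma delay_some w i : delay w (Some i) = (current w i - used w i) / speed w i.
Proof. by []. Qed.

Lemma delay_none w : delay w None = L (window w).+1 - now w.
Proof. by []. Qed.

Lemma now_cons v w : now (v :: w) = now w + delay w v. Proof. by []. Qed.

Lemma used_cons v w j :
  used (v :: w) j = if v == Some j then 0 else used w j + speed w j * delay w v.
Proof. by []. Qed.

Lemma par_some i w : par (Some i :: w) = par w. Proof. by []. Qed.

Lemma par_none i w : par (None :: w) i = par w i + step_size alpha0 (window w) *
  (a i (window w) - (T (window w))^-1 *
     \sum_(g : config) (g i)%:R * occupation (None :: w) (window w) g).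
Proof. by []. Qed.

Lemma occupation_cons v w j g : occupation (v :: w) j g = occupation w j g +
  (if (j == window w) && (g == sched w) then delay w v else 0).
Proof. by []. Qed.

Lemma speed_gt0 w i : 0 < speed w i.
Proof. by rewrite /speed /state_speed; case: ifP => // _; exact: expR_gt0. Qed.

Definition before w := now w < L (window w).+1.

(** Each clock is tested once, at the end of its period: as [used] grows during a period, it cannot
    have run out earlier. The clocks tested here have all been consumed by [w], so that the current
    ones are not involved; [active] adds the test of these. *)
Fixpoint hist w : bool :=
  if w is v :: w' then
    [&& hist w', before w' & if v is Some i then used w' i < current w' i else true]
  else true.

Definition active w := [&& hist w, before w & [forall i, used w i < current w i]].

Definition wins w v := [forall u, (u != v) ==> (delay w v < delay w u)].

Definition fresh w v := if v is Some i then 0 < current (v :: w) i else true.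

Lemma window_some i w : window (Some i :: w) = window w. Proof. by []. Qed.
Lemma window_none w : window (None :: w) = (window w).+1. Proof. by []. Qed.

Lemma ends_cons v w i : ends (v :: w) i = ((v == Some i) + ends w i)%N.
Proof. by []. Qed.

Lemma sched_cons_other v w j : v != Some j -> sched (v :: w) j = sched w j.
Proof.
case: v => [i|]//= ij; rewrite /toggle; case: ifP => // _; rewrite ffunE ifF//.
by apply/negbTE; apply: contraNneq ij => ->.
Qed.

Lemma current_cons_other v w j : v != Some j -> current (v :: w) j = current w j.
Proof. by move=> vj; rewrite /current sched_cons_other// ends_cons (negbTE vj). Qed.

Lemma delay_gt0_active w v : active w -> 0 < delay w v.
Proof.
move=> /and3P[_ bw /forallP aw]; case: v => [i|].
  by rewrite delay_some divr_gt0// ?speed_gt0// subr_gt0.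
by rewrite delay_none subr_gt0.
Qed.

Lemma lt_ring w i (x : R) : (x < delay w (Some i)) = (used w i + speed w i * x < current w i).
Proof. by rewrite delay_some ltr_pdivlMr ?speed_gt0// mulrC ltrBrDl. Qed.

(** A node other than [v] is unexhausted after the delay of [v] exactly when its own delay is
    longer, and likewise for the end of the window. Hence the tests at the ends of periods amount to
    the choice, at every step, of the event with the strictly smallest delay. *)
Lemma active_cons w v : 0 < T0 ->
  active (v :: w) = [&& active w, wins w v & fresh w v].
Proof.
move=> T00; apply/idP/idP.
  move=> /and3P[/= /and3P[hw bw uw] b' /forallP a'].
  have aw : active w.
    have d0 : 0 < delay w v.
      case: v uw {b' a'} => [i|] uw; last by rewrite delay_none subr_gt0.
      by rewrite delay_some divr_gt0// ?speed_gt0// subr_gt0.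
    rewrite /active hw bw; apply/forallP => i.
    have [vi|vi] := eqVneq v (Some i); first by move: uw; rewrite vi.
    have := a' i; rewrite used_cons (negbTE vi) current_cons_other//.
    by apply: le_lt_trans; rewrite lerDl mulr_ge0// ltW// speed_gt0.
  rewrite aw /=; apply/andP; split.
    apply/forallP => -[j|]; apply/implyP => jv.
      have := a' j; rewrite used_cons eq_sym (negbTE jv) current_cons_other 1?eq_sym//.
      by rewrite lt_ring.
    case: v jv b' {uw a'} => // i _.
    by rewrite /before now_cons window_some delay_none ltrBrDl.
  case: v {uw b'} a' => // i /(_ i).
  by rewrite used_cons eqxx.
move=> /and3P[aw /forallP ww fw]; have /and3P[hw bw /forallP uw] := aw.
apply/and3P; split.
- by rewrite /= hw bw; case: v {ww fw} => [i|]/=; rewrite ?uw.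
- rewrite /before now_cons; case: v ww fw => [i|] ww fw.
    by have := ww None; rewrite implyTb (delay_none w) ltrBrDl window_some.
  by rewrite delay_none addrC subrK window_none update_time_ltS.
- apply/forallP => j; rewrite used_cons.
  have [vj|vj] := eqVneq v (Some j); first by move: fw; rewrite /fresh vj.
  have := ww (Some j); rewrite eq_sym vj /= lt_ring.
  by rewrite current_cons_other.
Qed.

Lemma active_tail v w : 0 < T0 -> active (v :: w) -> active w.
Proof. by move=> T00; rewrite active_cons// => /and3P[]. Qed.

Lemma wins_uniq w u v : wins w u -> wins w v -> u = v.
Proof.
move=> /forallP wu /forallP wv; apply/eqP/negPn/negP => uv.
have := wu v; rewrite eq_sym uv /= => h1; have := wv u; rewrite uv /= => h2.
by have := lt_trans h1 h2; rewrite ltxx.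
Qed.

Lemma wins_exists w : (forall u v, u != v -> delay w u != delay w v) ->
  exists v, wins w v.
Proof.
move=> nt; pose v := [arg min_(v < None | true) delay w v]%O.
exists v; rewrite /v; case: arg_minP => // v0 _ h.
apply/forallP => u; apply/implyP => uv; rewrite lt_neqAle h// andbT.
by rewrite nt// eq_sym.
Qed.

(** Two winners would each be strictly faster than the other. The events on which the scripts of a
    given length are active are therefore disjoint, and sums over scripts do not grow with the
    length. *)
Lemma sum_active_cons w : 0 < T0 ->
  \sum_(v : option 'I_n) (active (v :: w))%:R <= (active w)%:R :> R.
Proof.
move=> T00; case aw : (active w); last first.
  by rewrite big1// => v _; rewrite active_cons// aw.
have [[v wv]|nw] := pselect (exists v, wins w v).
  rewrite (bigD1 v)//= big1 ?addr0.
    by case: (active _).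
  move=> u uv; rewrite active_cons//.
  case wu : (wins w u); last by rewrite andbF.
  by rewrite (wins_uniq wu wv) eqxx in uv.
rewrite big1// => v _; rewrite active_cons//.
by case wv : (wins w v); [case: nw; exists v|rewrite andbF].
Qed.

Fixpoint words (m : nat) : seq script :=
  if m is m'.+1 then [seq v :: w | w <- words m', v <- index_enum (option 'I_n)]
  else [:: [::]].

Lemma big_words m (V : nmodType) (f : script -> V) :
  \sum_(w <- words m.+1) f w = \sum_(w <- words m) \sum_v f (v :: w).
Proof. by rewrite /= big_allpairs_dep. Qed.

Lemma mem_words w : w \in words (size w).
Proof.
elim: w => [|v w IH] /=; first by rewrite inE.
by apply/allpairsP; exists (w, v); split => //; exact: mem_index_enum.
Qed.

Lemma sum_active_words m : 0 < T0 -> \sum_(w <- words m) (active w)%:R <= 1 :> R.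
Proof.
move=> T00; elim: m => [|m IH].
  by rewrite big_seq1; case: (active _).
rewrite big_words; apply: le_trans IH; apply: ler_sum => w _.
exact: sum_active_cons.
Qed.

Lemma active_now w : 0 < T0 -> active w -> L (window w) <= now w.
Proof.
move=> T00; elim: w => [|v w IH]; first by rewrite /window/= update_time0.
move=> avw; have aw := active_tail T00 avw.
rewrite now_cons; case: v avw => [i|] avw.
  by rewrite (le_trans (IH aw))// lerDl ltW// delay_gt0_active.
by rewrite delay_none addrC subrK.
Qed.

Lemma active_used_ge0 w i : 0 < T0 -> active w -> 0 <= used w i.
Proof.
move=> T00; elim: w => [//|v w IH] avw; have aw := active_tail T00 avw.
rewrite used_cons; case: ifP => // _.
by rewrite addr_ge0 ?IH// mulr_ge0// ltW ?speed_gt0// delay_gt0_active.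
Qed.

Section Martingale.
Context (g0 : config) (i0 : 'I_n) (J : nat) (rho : R).

Definition gate w := [&& sched w == g0, window w == J & speed w i0 <= rho].

(* The ends of periods of node [i0] out of configuration [g0] during window [J], minus
   their hazard; the cap [rho] on the rate makes the compensator [comp] bounded. *)
Fixpoint mart w : R :=
  if w is v :: w' then mart w' +
    (if gate w' then (v == Some i0)%:R - speed w' i0 * delay w' v else 0) else 0.

Fixpoint comp w : R :=
  if w is v :: w' then comp w' + (if gate w' then speed w' i0 * delay w' v else 0)
  else 0.

Definition square_defect w := mart w ^+ 2 - comp w.

(** The hazard that node [i0] accumulates until the first competing event, in the units of its own
    clock. The current clock of [i0] does not enter. *)
Definition deadline w : R :=
  speed w i0 * \big[Num.min/delay w None]_(j | j != i0) delay w (Some j).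

Lemma comp_ge0 w : 0 < T0 -> active w -> 0 <= comp w.
Proof.
move=> T00; elim: w => [//|v w IH] avw; have aw := active_tail T00 avw.
rewrite /= addr_ge0 ?IH//; case: ifP => // _.
by rewrite mulr_ge0// ltW ?speed_gt0// delay_gt0_active.
Qed.

(** The induction needs the position relative to window [J]: the compensator is 0 before it, at most
    [rho] times the time elapsed within it, and frozen after it. *)
Lemma comp_le w : 0 < T0 -> 0 <= rho -> active w -> comp w <= rho * T J.
Proof.
move=> T00 rho0 aw; suff [h1 [h2 h3]] : ((window w < J)%N -> comp w = 0) /\
    ((window w = J)%N -> comp w <= rho * (now w - L J)) /\ ((J < window w)%N -> comp w <= rho * T J).
  have [wJ|wJ|wJ] := ltngtP (window w) J; last 2 first.
  - exact: h3.
  - apply: le_trans (h2 wJ) _; rewrite ler_wpM2l// lerBlDl -update_timeS -wJ.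
    by case/and3P: aw => _ /ltW.
  - by rewrite h1// mulr_ge0// ltW// update_period_gt0.
elim: w aw => [|v w IH] avw.
  rewrite /=; split => //; split => [h|]//.
  by rewrite -h /now/= /window/= update_time0 subrr mulr0.
have aw := active_tail T00 avw; have {IH}[h1 [h2 h3]] := IH aw.
have d0 := delay_gt0_active v aw.
have ub : gate w -> speed w i0 * delay w v <= rho * delay w v.
  by move=> /and3P[_ _ h]; rewrite ler_wpM2r// ltW.
rewrite /=; case gw : (gate w); last first.
  rewrite addr0; case: v avw d0 ub => [i|] avw d0 ub; rewrite ?window_some ?window_none.
    split => //; split => // wJ; apply: le_trans (h2 wJ) _.
    by rewrite ler_wpM2l// now_cons lerD2r lerDl ltW.
  split; first by move=> wJ; apply: h1; exact: ltnW.
  split; first by move=> wJ; rewrite h1 ?mulr_ge0 -?wJ// now_cons delay_none subrKC subrr.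
  rewrite ltnS leq_eqVlt => /orP[/eqP wJ|]; last exact: h3.
  apply: le_trans (h2 (esym wJ)) _; rewrite ler_wpM2l// lerBlDl -update_timeS wJ.
  by case/and3P: aw => _ /ltW.
have wJ : window w = J by case/and3P: gw => _ /eqP.
have {}ub := ub gw; have {}h2 := h2 wJ.
have key : comp w + speed w i0 * delay w v <= rho * (now (v :: w) - L J).
  by rewrite now_cons addrAC mulrDr lerD.
case: v avw d0 ub key => [i|] avw d0 ub key; rewrite ?window_some ?window_none wJ.
  by split => [|]; [rewrite ltnn|split => //; rewrite ltnn].
split; first by rewrite ltnNge leqnSn.
split; first by move=> /esym/n_Sn.
move=> _; apply: le_trans key _; rewrite ler_wpM2l// now_cons delay_none subrKC wJ update_timeS.
by rewrite addrAC subrr add0r.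
Qed.

(** This bound grows with the length of the script and serves integrability only; the estimate that
    survives the limit is that of the second moment. *)
Lemma mart_bound w : 0 < T0 -> 0 <= rho -> active w ->
  `|mart w| <= (size w)%:R + rho * T J.
Proof.
move=> T00 rho0 aw; apply: (@le_trans _ _ ((size w)%:R + comp w)); last first.
  by rewrite lerD2l comp_le.
elim: w aw => [|v w IH] avw; first by rewrite /= normr0 addr0.
have aw := active_tail T00 avw; have {}IH := IH aw.
have d0 := delay_gt0_active v aw; have s0' := speed_gt0 w i0.
have sd0 : 0 < speed w i0 * delay w v by rewrite mulr_gt0.
rewrite /=; case: ifP => _; last first.
  by rewrite !addr0 (le_trans IH)// lerD2r ler_nat.
move: IH; rewrite -natr1 !ler_norml => /andP[h1 h2].
by case: (v == Some i0); rewrite ?mulr1n ?mulr0n; apply/andP; split; lra.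
Qed.

Lemma deadline_gt0 w : active w -> 0 < deadline w.
Proof.
move=> aw; rewrite mulr_gt0 ?speed_gt0//.
by elim/big_ind: _ => [|x y x0 y0|j _]; rewrite ?lt_min ?delay_gt0_active// x0.
Qed.

Lemma deadline_le w : 0 < T0 -> 0 <= rho -> active w -> gate w ->
  deadline w <= rho * T J.
Proof.
move=> T00 rho0 aw /and3P[_ /eqP wJ sr].
apply: (@le_trans _ _ (speed w i0 * delay w None)).
  by apply: ler_wpM2l; [rewrite ltW ?speed_gt0|exact: bigmin_le_id].
have d0 := delay_gt0_active None aw.
apply: (@le_trans _ _ (rho * delay w None)); first by rewrite ler_wpM2r// ltW.
apply: ler_wpM2l => //; rewrite delay_none wJ update_timeS.
by have := active_now T00 aw; rewrite wJ => ?; lra.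
Qed.

(** With M the current value and y the residual level of [i0], the change is (M + 1 - y)^2 - M^2 - y
    if [i0] wins, that is if y < U, and (M - U)^2 - M^2 - U otherwise. Both are the race defect with
    a = 2 M + 1 and b = -1. *)
Lemma square_defect_step w v : active w -> gate w -> wins w v ->
  square_defect (v :: w) - square_defect w =
  race_defect (2 * mart w + 1) (-1) (deadline w) (current w i0 - used w i0).
Proof.
move=> aw gw /forallP wv.
have y_E : current w i0 - used w i0 = speed w i0 * delay w (Some i0).
  by rewrite delay_some mulrC divfK// gt_eqF// speed_gt0.
rewrite /square_defect /= gw /race_defect y_E.
have [vi|vi] := eqVneq v (Some i0).
  rewrite ifT; last first.
    rewrite /deadline ltr_pM2l ?speed_gt0//.
    apply: lt_bigmin; first by have := wv None; rewrite vi.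
    move=> j ji; have := wv (Some j).
    by rewrite vi (inj_eq Some_inj) ji.
  rewrite vi /=; ring.
have dE : deadline w = speed w i0 * delay w v.
  rewrite /deadline; congr (_ * _); apply/le_anti/andP; split.
    case: v vi {wv} => [j|] vi; last exact: bigmin_le_id.
    by apply: bigmin_le_cond; rewrite -(inj_eq Some_inj).
  apply/bigmin_geP; split.
    by have := wv None; case: eqVneq => [->|_]// /ltW.
  move=> j _; have := wv (Some j); case: eqVneq => [->|_]//= /ltW //.
rewrite ifF; last first.
  apply/negbTE; rewrite -leNgt dE ler_pM2l ?speed_gt0//.
  by have := wv (Some i0); rewrite eq_sym vi /= => /ltW.
rewrite dE /=; ring.
Qed.

End Martingale.

End Simulation.

End Scripts.

(** * Measurability of the simulation *)

Lemma measurable_forall d (S : measurableType d) (I : finType) (p : I -> S -> bool) :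
  (forall i, measurable_fun setT (p i)) ->
  measurable_fun setT (fun s => [forall i, p i s]).
Proof.
move=> mp; apply: (measurable_fun_bool true); rewrite setTI.
rewrite (_ : _ @^-1` _ = \big[setI/setT]_(i <- index_enum I) (p i @^-1` [set true])).
  apply: bigsetI_measurable => i _.
  by rewrite -[X in measurable X]setTI; exact: mp.
rewrite -bigcap_seq; apply/seteqP; split => s /=.
  by move=> /forallP h i _; exact: h.
by move=> h; apply/forallP => i; exact: h (mem_index_enum i).
Qed.

Lemma measurable_bigmin d (S : measurableType d) (R : realType) (I : Type)
    (r : seq I) (P : pred I) (x : S -> R) (f : I -> S -> R) :
  measurable_fun setT x -> (forall i, P i -> measurable_fun setT (f i)) ->
  measurable_fun setT (fun s => \big[Num.min/x s]_(i <- r | P i) f i s).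
Proof.
move=> mx mf; elim: r => [|i r IH].
  by under eq_fun do rewrite big_nil.
under eq_fun do rewrite big_cons.
case Pi : (P i) => //.
by apply: measurable_minr => //; exact: mf.
Qed.

Section ScriptMeasurability.
Context (R : realType) (n : nat) (e : rel 'I_n) (T0 alpha0 : R).
Context (s0 : {ffun 'I_n -> bool}).
Context d (S : measurableType d) (c : S -> bool -> 'I_n -> nat -> R)
  (a : S -> 'I_n -> nat -> R).
Hypothesis ma : forall i j, measurable_fun setT (fun s => a s i j).

Local Notation script := (seq (option 'I_n)).
Local Notation sched := (sched e s0).
Local Notation now_at s w := (now e T0 alpha0 s0 (c s) (a s) w).
Local Notation used_at s w i := (used e T0 alpha0 s0 (c s) (a s) w i).
Local Notation par_at s w i := (par e T0 alpha0 s0 (c s) (a s) w i).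
Local Notation occupation_at s w j g := (occupation e T0 alpha0 s0 (c s) (a s) w j g).
Local Notation speed_at s w i := (speed e T0 alpha0 s0 (c s) (a s) w i).
Local Notation delay_at s w v := (delay e T0 alpha0 s0 (c s) (a s) w v).
Local Notation current_at s w i := (current e s0 (c s) w i).
Local Notation hist_at s w := (hist e T0 alpha0 s0 (c s) (a s) w).
Local Notation before_at s w := (before e T0 alpha0 s0 (c s) (a s) w).
Local Notation active_at s w := (active e T0 alpha0 s0 (c s) (a s) w).

(** Only the clocks consumed by [w] have to be measurable. This is what allows the simulation to be
    measured by a sigma-algebra that lacks the current clock of one node. *)
Definition past_measurable (w : script) := forall b i k, (k < ends w i)%N ->
  measurable_fun setT (fun s => c s b i k).

Lemma past_measurable_tail v w : past_measurable (v :: w) -> past_measurable w.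
Proof. by move=> h b i k kw; apply: h; rewrite ends_cons ltn_addl. Qed.

Lemma measurable_speed_of w i : measurable_fun setT (fun s => par_at s w i) ->
  measurable_fun setT (fun s => speed_at s w i).
Proof.
move=> mp; rewrite /speed /state_speed; case: (sched w i) => //.
by apply: measurableT_comp => //; exact: measurable_expR.
Qed.

Lemma measurable_delay_of w v : measurable_fun setT (fun s => now_at s w) ->
  (forall i, measurable_fun setT (fun s => used_at s w i)) ->
  (forall i, measurable_fun setT (fun s => par_at s w i)) ->
  (forall i, v = Some i -> measurable_fun setT (fun s => current_at s w i)) ->
  measurable_fun setT (fun s => delay_at s w v).
Proof.
move=> mn mu mp mc; case: v mc => [i|] mc; last first.
  by apply: measurable_funB => //.
have -> : (fun s => delay_at s w (Some i)) = (fun s => (current_at s w i - used_at s w i) *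
    (if sched w i then 1 else expR (- par_at s w i))).
  apply/funext => s; rewrite delay_some; congr (_ * _).
  by rewrite /speed /state_speed; case: ifP => _; rewrite ?invr1 ?expRN.
apply: measurable_funM; first by apply: measurable_funB; [exact: mc|exact: mu].
case: (sched w i) => //.
by apply: measurableT_comp; [exact: measurable_expR|exact: measurableT_comp].
Qed.

Lemma measurable_sim w : past_measurable w ->
  [/\ measurable_fun setT (fun s => now_at s w),
      (forall i, measurable_fun setT (fun s => used_at s w i)),
      (forall i, measurable_fun setT (fun s => par_at s w i)) &
      (forall j g, measurable_fun setT (fun s => occupation_at s w j g))].
Proof.
elim: w => [|v w IH] pm; first by split => *; exact: measurable_cst.
have [mn mu mp mo] := IH (past_measurable_tail pm).
have md : measurable_fun setT (fun s => delay_at s w v).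
  apply: measurable_delay_of => // i vi; apply: pm.
  by rewrite ends_cons vi eqxx.
have mo' j g : measurable_fun setT (fun s => occupation_at s (v :: w) j g).
  under eq_fun do rewrite occupation_cons.
  by apply: measurable_funD => //; case: (_ && _).
split => //.
- by apply: measurable_funD.
- move=> i; under eq_fun do rewrite used_cons.
  case: (v == Some i); first exact: measurable_cst.
  apply: measurable_funD => //.
  by apply: measurable_funM => //; exact: measurable_speed_of.
- move=> i; case: v {pm} md mo' => [j|] md mo'; first exact: (mp i).
  under eq_fun do rewrite par_none.
  apply: measurable_funD => //; apply: measurable_funM => //.
  apply: measurable_funB => //; apply: measurable_funM => //.
  apply: measurable_sum => g.
  by apply: measurable_funM => //; exact: mo'.
Qed.

Lemma measurable_now w : past_measurable w -> measurable_fun setT (fun s => now_at s w).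
Proof. by case/measurable_sim. Qed.
Lemma measurable_used w i : past_measurable w -> measurable_fun setT (fun s => used_at s w i).
Proof. by case/measurable_sim. Qed.
Lemma measurable_par w i : past_measurable w -> measurable_fun setT (fun s => par_at s w i).
Proof. by case/measurable_sim. Qed.

Lemma measurable_speed w i : past_measurable w -> measurable_fun setT (fun s => speed_at s w i).
Proof. by move=> pm; apply: measurable_speed_of; exact: measurable_par. Qed.

Lemma measurable_delay w v : past_measurable w ->
  (forall i, v = Some i -> measurable_fun setT (fun s => current_at s w i)) ->
  measurable_fun setT (fun s => delay_at s w v).
Proof. by case/measurable_sim => *; exact: measurable_delay_of. Qed.

Lemma past_measurable_current v w i : past_measurable (v :: w) -> v = Some i ->
  measurable_fun setT (fun s => current_at s w i).
Proof. by move=> pm vi; apply: pm; rewrite ends_cons vi eqxx. Qed.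

Lemma measurable_before w : past_measurable w -> measurable_fun setT (fun s => before_at s w).
Proof. by move=> pm; apply: measurable_fun_ltr => //; exact: measurable_now. Qed.

Lemma measurable_hist w : past_measurable w -> measurable_fun setT (fun s => hist_at s w).
Proof.
elim: w => [|v w IH] pm; first exact: measurable_cst.
have pw := past_measurable_tail pm.
rewrite /=; apply: measurable_and; first exact: IH.
apply: measurable_and; first exact: measurable_before.
case: v pm => [i|] pm; last exact: measurable_cst.
apply: measurable_fun_ltr; first exact: measurable_used.
exact: past_measurable_current pm erefl.
Qed.

Section GatedMeasurability.
Context (g0 : {ffun 'I_n -> bool}) (i0 : 'I_n) (J : nat) (rho : R).

Local Notation gate_at s w := (gate e T0 alpha0 s0 (c s) (a s) g0 i0 J rho w).
Local Notation mart_at s w := (mart e T0 alpha0 s0 (c s) (a s) g0 i0 J rho w).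
Local Notation comp_at s w := (comp e T0 alpha0 s0 (c s) (a s) g0 i0 J rho w).

Lemma measurable_gate w : past_measurable w -> measurable_fun setT (fun s => gate_at s w).
Proof.
move=> pm; do 2 ! [apply: measurable_and => //].
by apply: measurable_fun_ler => //; exact: measurable_speed.
Qed.

Lemma measurable_mart w : past_measurable w -> measurable_fun setT (fun s => mart_at s w).
Proof.
elim: w => [|v w IH] pm; first exact: measurable_cst.
have pw := past_measurable_tail pm.
apply: measurable_funD; first exact: IH.
apply: measurable_fun_if => //; first exact: measurable_gate.
apply: measurable_funTS; apply: measurable_funB => //.
apply: measurable_funM; first exact: measurable_speed.
by apply: measurable_delay => // i; exact: past_measurable_current.
Qed.

Lemma measurable_comp w : past_measurable w -> measurable_fun setT (fun s => comp_at s w).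
Proof.
elim: w => [|v w IH] pm; first exact: measurable_cst.
have pw := past_measurable_tail pm.
apply: measurable_funD; first exact: IH.
apply: measurable_fun_if => //; first exact: measurable_gate.
apply: measurable_funTS.
apply: measurable_funM; first exact: measurable_speed.
by apply: measurable_delay => // i; exact: past_measurable_current.
Qed.

Lemma measurable_deadline w : past_measurable w ->
  (forall i, i != i0 -> measurable_fun setT (fun s => current_at s w i)) ->
  measurable_fun setT (fun s => deadline e T0 alpha0 s0 (c s) (a s) i0 w).
Proof.
move=> pm mc; apply: measurable_funM; first exact: measurable_speed.
apply: measurable_bigmin; first exact: measurable_delay.
by move=> i ii; apply: measurable_delay => // _ [<-]; exact: mc.
Qed.

End GatedMeasurability.

Lemma measurable_active w : (forall b i k, measurable_fun setT (fun s => c s b i k)) ->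
  measurable_fun setT (fun s => active_at s w).
Proof.
move=> mc; have pm : past_measurable w by [].
apply: measurable_and; first exact: measurable_hist.
apply: measurable_and; first exact: measurable_before.
apply: measurable_forall => i; apply: measurable_fun_ltr; first exact: measurable_used.
exact: mc.
Qed.

End ScriptMeasurability.

(** * Second moment of the compensated counts *)

Lemma ae_forall_count d (T : measurableType d) (R : realType)
    (mu : {measure set T -> \bar R}) (I : countType) (p : I -> T -> Prop) :
  (forall i, {ae mu, forall w, p i w}) -> {ae mu, forall w, forall i, p i w}.
Proof.
move=> h.
have := @ae_foralln _ _ _ mu (fun k w => if unpickle k is Some i then p i w else True).
move=> /(_ _)-/(_ _)/wrap[k|]; last first.
  by apply: filterS => w hw i; have := hw (pickle i); rewrite pickleK.
case: (unpickle k) => [i|]; first exact: h.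
exact: aeW.
Qed.

Section ResampledScripts.
Context d (Omega : measurableType d) (R : realType) (P : probability Omega R).
Context (n : nat) (e : rel 'I_n) (T0 alpha0 : R).
Hypothesis T0_gt0 : 0 < T0.
Context (X : bool -> 'I_n -> nat -> {RV P >-> R}) (G : set (set Omega)).
Hypothesis G_measurable : G `<=` measurable.
Hypothesis G_setT : G setT.
Hypothesis G_setI : setI_closed G.
Hypothesis clocks : csma_clocks X G.
Context (a : Omega -> 'I_n -> nat -> R).
Hypothesis a_env : forall i j (B : set R), measurable B -> G ((fun w => a w i j) @^-1` B).
Context (s0 : {ffun 'I_n -> bool}) (S0 : set Omega).
Hypothesis S0_env : G S0.

Local Notation script := (seq (option 'I_n)).
Local Notation clock_index := (bool * 'I_n * nat)%type.
Local Notation clk w := (fun b i k => X b i k w).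
Local Notation sched := (sched e s0).
Local Notation used_at s w i := (used e T0 alpha0 s0 (clk s) (a s) w i).
Local Notation speed_at s w i := (speed e T0 alpha0 s0 (clk s) (a s) w i).
Local Notation delay_at s w v := (delay e T0 alpha0 s0 (clk s) (a s) w v).
Local Notation current_at s w i := (current e s0 (clk s) w i).
Local Notation hist_at s w := (hist e T0 alpha0 s0 (clk s) (a s) w).
Local Notation before_at s w := (before e T0 alpha0 s0 (clk s) (a s) w).
Local Notation active_at s w := (active e T0 alpha0 s0 (clk s) (a s) w).

Let field (q : option clock_index) : set (set Omega) :=
  if q is Some bik then g_sigma_algebra_preimage (X bik.1.1 bik.1.2 bik.2) else G.

Definition other_clocks (q : clock_index) : set (set Omega) :=
  \bigcup_(c in [set c | c != Some q]) field c.

Let field_measurable c : field c `<=` measurable.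
Proof. by case: c => [q|] //; exact: g_sigma_algebra_preimage_measurable. Qed.

Lemma other_clocks_measurable q : <<s other_clocks q >> `<=` measurable.
Proof.
apply: smallest_sub; first exact: sigma_algebra_measurable.
by move=> E [c _]; exact: field_measurable.
Qed.

Lemma other_clocks_indep (q : clock_index) (E : set Omega) (B : set R) :
  <<s other_clocks q >> E -> measurable B ->
  P (E `&` X q.1.1 q.1.2 q.2 @^-1` B) = (P E * P (X q.1.1 q.1.2 q.2 @^-1` B))%E.
Proof.
move=> sE mB; apply: (@mutually_independent_rest _ _ _ P _ field _ _ _ _ (Some q)) => //.
- by case=> [?|] //; exact: g_sigma_algebra_preimage_setT.
- by case=> [?|] //; exact: g_sigma_algebra_preimage_setI.
- exact: clock_independent clocks.
- by apply/g_sigma_algebra_preimageE; exists B.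
Qed.

Lemma measurable_other_clock q b i k : (b, i, k) != q ->
  measurable_fun [set: g_sigma_algebraType (other_clocks q)] (X b i k : Omega -> R).
Proof.
move=> bq _ B mB; rewrite setTI; apply: sub_gen_smallest.
exists (Some (b, i, k)); first by apply: contraNneq bq => -[->].
by apply/g_sigma_algebra_preimageE; exists B.
Qed.

Lemma measurable_env_arrival q i j :
  measurable_fun [set: g_sigma_algebraType (other_clocks q)] (fun w => a w i j).
Proof.
move=> _ B mB; rewrite setTI; apply: sub_gen_smallest.
by exists None => //; exact: a_env.
Qed.

Lemma measurable_env_start q :
  measurable_fun [set: g_sigma_algebraType (other_clocks q)] (fun w : Omega => `[< S0 w >]).
Proof.
apply: (measurable_fun_bool true); rewrite setTI.
apply: sub_gen_smallest; exists None => //.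
rewrite (_ : _ @^-1` _ = S0)//; apply/seteqP; split => w /=; first by move/asboolP.
by move=> ?; apply/asboolP.
Qed.

(** The sample point itself, seen through the coarser sigma-algebra, is the variable [Y] of the
    resampling lemmas: it records everything except the clock [q]. *)
Lemma measurable_id_other q :
  measurable_fun setT (id : Omega -> g_sigma_algebraType (other_clocks q)).
Proof. by move=> _ E mE; rewrite setTI; have := other_clocks_measurable mE. Qed.

Lemma measurable_of_other q (f : Omega -> R) :
  measurable_fun [set: g_sigma_algebraType (other_clocks q)] f ->
  measurable_fun [set: Omega] f.
Proof.
move=> mf _ B mB; have := mf measurableT B mB; rewrite !setTI => h.
exact: other_clocks_measurable h.
Qed.

Lemma clock_distribution b i k (B : set R) : measurable B ->
  distribution P (X b i k) B = exponential_prob 1 B.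
Proof. exact: (clock_exponential clocks). Qed.

Lemma resample_clock q (F : g_sigma_algebraType (other_clocks q) * R -> R) (M : R) :
  measurable_fun setT F -> (forall z, `|F z| <= M) ->
  (forall y, \int[distribution P (X q.1.1 q.1.2 q.2)]_x (F (y, x))%:E = 0)%E ->
  (\int[P]_w (F (w, X q.1.1 q.1.2 q.2 w))%:E = 0)%E.
Proof.
move=> mF FM F0.
have := @resample_integral0 _ _ _ _ _ P (X q.1.1 q.1.2 q.2) _ (@measurable_id_other q) _ F M mF FM F0.
by apply => E B mE mB; exact: other_clocks_indep.
Qed.

(** With the other clocks frozen, [f] is a constant, and the exponential law has no atom. *)
Lemma clock_neq_measurable q (f : g_sigma_algebraType (other_clocks q) -> R) :
  measurable_fun setT f -> {ae P, forall w, X q.1.1 q.1.2 q.2 w != f w}.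
Proof.
move=> mf.
have mfP : measurable_fun [set: Omega] f.
  exact: measurable_of_other mf.
exists [set w | X q.1.1 q.1.2 q.2 w == f w]; split.
- have /(_ measurableT [set true]) := @measurable_fun_eqr _ _ _ setT _ _ (@measurable_funPT _ _ _ _ (X q.1.1 q.1.2 q.2)) mfP.
  by rewrite setTI; apply.
- have := @resample_null _ _ _ _ _ P (X q.1.1 q.1.2 q.2) _ (@measurable_id_other q) _
    [set z | z.2 == f z.1]; apply.
  + by move=> E B mE mB; exact: other_clocks_indep.
  + have /(_ measurableT [set true]) := @measurable_fun_eqr _ _ _ setT
      (@snd (g_sigma_algebraType (other_clocks q)) R) (f \o fst) measurable_snd
      (measurableT_comp mf measurable_fst).
    by rewrite setTI; apply.
  + move=> y; rewrite (_ : [set x | _] = [set f y]).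
      by rewrite clock_distribution// exponential_prob_set1.
    by apply/seteqP; split => x /= /eqP.
- by move=> w /= /negP/negPn.
Qed.

Lemma clocks_gt0_ae : {ae P, forall w, forall q : clock_index, 0 < X q.1.1 q.1.2 q.2 w}.
Proof.
apply: ae_forall_count => -[[b i] k] /=.
exists (X b i k @^-1` [set x | x <= 0]); split.
- rewrite -[X in measurable X]setTI; apply: measurable_funPT => //.
  by rewrite (_ : [set x | _] = `]-oo, 0]%classic) //; apply/seteqP; split => x /=; rewrite in_itv.
- rewrite -[LHS]/(distribution P (X b i k) [set x | x <= 0]) clock_distribution.
    exact: exponential_prob_nonpos.
  by rewrite (_ : [set x | _] = `]-oo, 0]%classic) //; apply/seteqP; split => x /=; rewrite in_itv.
- by move=> w /=; rewrite leNgt => /negP.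
Qed.

(** The current clock of [i0] has index [ends w i0], whereas [w] has consumed smaller indices
    only. *)
Let past_other (w : script) i0 :
  @past_measurable R n _ (g_sigma_algebraType (other_clocks (sched w i0, i0, ends w i0)))
    (fun s => clk s) w.
Proof.
move=> b i k kw; apply: measurable_other_clock.
by apply: contraTneq kw => -[_ -> ->]; rewrite ltnn.
Qed.

Let current_other (w : script) i0 i : i != i0 ->
  measurable_fun [set: g_sigma_algebraType (other_clocks (sched w i0, i0, ends w i0))]
    (fun s => current_at s w i).
Proof.
by move=> ii; apply: measurable_other_clock; apply: contraNneq ii => -[_ ->].
Qed.

(** At least one of two tied events is the end of a period of some node i. The tie then makes the
    current clock of i equal to its consumed part plus its speed times the delay of the other event,
    a function of the other clocks. There are countably many scripts. *)
Lemma no_ties_ae : {ae P, forall w, forall (s : script) (u v : option 'I_n), u != v ->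
  delay_at w s u != delay_at w s v}.
Proof.
have key (s : script) i v : v != Some i ->
    {ae P, forall w, delay_at w s (Some i) != delay_at w s v}.
  move=> vi; set q := (sched s i, i, ends s i).
  pose f w := used_at w s i + speed_at w s i * delay_at w s v.
  have mf : measurable_fun [set: g_sigma_algebraType (other_clocks q)] f.
    have ma := @measurable_env_arrival q; have po := @past_other s i.
    apply: measurable_funD; first exact: (@measurable_used R n e T0 alpha0 s0 _ (g_sigma_algebraType (other_clocks q)) (fun s => clk s) a ma).
    apply: measurable_funM; first exact: (@measurable_speed R n e T0 alpha0 s0 _ (g_sigma_algebraType (other_clocks q)) (fun s => clk s) a ma).
    apply: (@measurable_delay R n e T0 alpha0 s0 _ (g_sigma_algebraType (other_clocks q)) (fun s => clk s) a ma) => // j vj.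
    by apply: current_other; move: vi; rewrite vj (inj_eq Some_inj).
  apply: filterS (clock_neq_measurable mf) => w h; apply/eqP => dE; move/eqP: h; apply.
  rewrite /f -dE delay_some mulrC divfK ?gt_eqF ?speed_gt0//.
  by rewrite subrKC.
apply: ae_forall_count => s; apply: ae_forall_count => u; apply: ae_forall_count => v.
case: (eqVneq u v) => [->|uv]; first by apply: aeW => w; rewrite eqxx.
case: u uv => [i|] uv.
  by apply: filterS (key s i v _) => //; rewrite eq_sym.
case: v uv => // i uv.
by apply: filterS (key s i None _) => // w h _; rewrite eq_sym.
Qed.

Section ExpectedSquare.
Context (g0 : {ffun 'I_n -> bool}) (i0 : 'I_n) (J : nat) (rho : R).
Hypothesis rho_ge0 : 0 <= rho.

Local Notation T := (update_period T0).
Local Notation gate_at s w := (gate e T0 alpha0 s0 (clk s) (a s) g0 i0 J rho w).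
Local Notation mart_at s w := (mart e T0 alpha0 s0 (clk s) (a s) g0 i0 J rho w).
Local Notation comp_at s w := (comp e T0 alpha0 s0 (clk s) (a s) g0 i0 J rho w).
Local Notation deadline_at s w := (deadline e T0 alpha0 s0 (clk s) (a s) i0 w).
Local Notation sqd_at s w := (square_defect e T0 alpha0 s0 (clk s) (a s) g0 i0 J rho w).

(** The expected gain of the square defect in one event after [w], on the event where [w] is the
    true past. *)
Let race s w : R := if [&& `[< S0 s >], active_at s w & gate_at s w] then
  race_defect (2 * mart_at s w + 1) (-1) (deadline_at s w) (current_at s w i0 - used_at s w i0)
  else 0.

(** Activity of [w] splits into a condition on the other clocks and the inequality that the current
    clock of [i0] exceeds its consumed part. Integrating that clock alone gives a race defect, whose
    mean is 0. *)
Lemma integral_race w : (\int[P]_s (race s w)%:E = 0)%E.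
Proof.
set q := (sched w i0, i0, ends w i0).
have ma := @measurable_env_arrival q.
have po := @past_other w i0.
pose B0 : R := (size w)%:R + rho * T J.
pose B1 : R := rho * T J.
(* The last four bounds follow from activity. They are put into the guard because [F] must be
   bounded at all pairs (y, x), also those where the clock of [i0] held by the point y makes [w]
   inactive. *)
pose guard (y : g_sigma_algebraType (other_clocks q)) : bool :=
  [&& `[< S0 y >], hist_at y w, before_at y w,
      [forall j, (j != i0) ==> (used_at y w j < current_at y w j)], gate_at y w &
      [&& 0 < deadline_at y w, deadline_at y w <= B1, 0 <= used_at y w i0 &
      `|mart_at y w| <= B0]].
pose F (z : g_sigma_algebraType (other_clocks q) * R) : R :=
  if guard z.1 && (used_at z.1 w i0 < z.2) then
    race_defect (2 * mart_at z.1 w + 1) (-1) (deadline_at z.1 w) (z.2 - used_at z.1 w i0)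
  else 0.
have mused i : measurable_fun [set: g_sigma_algebraType (other_clocks q)] (fun s => used_at s w i).
  exact: (@measurable_used R n e T0 alpha0 s0 _ (g_sigma_algebraType (other_clocks q)) (fun s => clk s) a ma).
have mmart : measurable_fun [set: g_sigma_algebraType (other_clocks q)] (fun s => mart_at s w).
  exact: (@measurable_mart R n e T0 alpha0 s0 _ (g_sigma_algebraType (other_clocks q)) (fun s => clk s) a ma).
have mdead : measurable_fun [set: g_sigma_algebraType (other_clocks q)] (fun s => deadline_at s w).
  by apply: (@measurable_deadline R n e T0 alpha0 s0 _ (g_sigma_algebraType (other_clocks q)) (fun s => clk s) a ma) => // i ii; exact: current_other.
have mguard : measurable_fun setT guard.
  apply: measurable_and; first exact: measurable_env_start.
  apply: measurable_and; first exact: (@measurable_hist R n e T0 alpha0 s0 _ (g_sigma_algebraType (other_clocks q)) (fun s => clk s) a ma).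
  apply: measurable_and; first exact: (@measurable_before R n e T0 alpha0 s0 _ (g_sigma_algebraType (other_clocks q)) (fun s => clk s) a ma).
  apply: measurable_and.
    apply: measurable_forall => j; case: (eqVneq j i0) => ji /=; first exact: measurable_cst.
    by apply: measurable_fun_ltr => //; exact: current_other.
  apply: measurable_and; first exact: (@measurable_gate R n e T0 alpha0 s0 _ (g_sigma_algebraType (other_clocks q)) (fun s => clk s) a ma).
  apply: measurable_and; first exact: measurable_fun_ltr.
  apply: measurable_and; first exact: measurable_fun_ler.
  apply: measurable_and; first exact: measurable_fun_ler.
  by apply: measurable_fun_ler => //; exact: measurableT_comp.
have mF : measurable_fun setT F.
  apply: measurable_fun_if => //.
    apply: measurable_and; first exact: (measurableT_comp mguard measurable_fst).
    by apply: measurable_fun_ltr => //; exact: (measurableT_comp (mused i0) measurable_fst).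
  apply: measurable_funTS; apply: measurable_race_defect.
  - apply: measurable_funD => //; apply: measurable_funM => //.
    exact: (measurableT_comp mmart measurable_fst).
  - exact: measurable_cst.
  - exact: (measurableT_comp mdead measurable_fst).
  - by apply: measurable_funB => //; exact: (measurableT_comp (mused i0) measurable_fst).
have B10 : 0 <= B1 by rewrite mulr_ge0// ltW// update_period_gt0.
pose M : R := (2 * B0 + 1) + 2 * 1 * B1 + (2 * B0 + 1) * B1 + 1 * B1 ^+ 2.
have B00 : 0 <= B0 by rewrite addr_ge0.
have FM z : `|F z| <= M.
  rewrite /F; case: ifP => [/andP[gz uz]|_]; last first.
    have h1 := mulr_ge0 B00 B10; have h2 := exprn_ge0 2 B10.
    by rewrite normr0 /M; lra.
  move: gz => /and5P[_ _ _ _ /and5P[_ d0 d1 u0 m0]].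
  have dd : 0 <= deadline_at z.1 w <= B1 by rewrite ltW ?d1.
  have xx : 0 <= z.2 - used_at z.1 w i0 by rewrite subr_ge0 ltW.
  apply: le_trans (race_defect_bound _ _ dd xx) _.
  have h : `|2 * mart_at z.1 w + 1| <= 2 * B0 + 1.
    apply: le_trans (ler_normD _ _) _; rewrite normr1 lerD2r normrM ger0_norm//.
    by rewrite ler_wpM2l.
  by rewrite /M normrN1 lerD2r lerD ?ler_wpM2r// lerD2r.
have := @resample_clock q F M mF FM.
have -> : (fun s => (race s w)%:E) = (fun s => (F (s, X q.1.1 q.1.2 q.2 s))%:E).
  apply/funext => s; congr (_%:E); rewrite /race /F /=.
  have -> : guard s && (used_at s w i0 < X (sched w i0) i0 (ends w i0) s) =
      [&& `[< S0 s >], active_at s w & gate_at s w]; last by [].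
  rewrite /guard; apply/idP/idP.
    move=> /andP[/and5P[-> h1 h2 h3 /and5P[-> _ _ _ _]] h4] /=; rewrite andbT.
    rewrite /active h1 h2; apply/forallP => j.
    by case: (eqVneq j i0) => [->//|ji]; have /forallP/(_ j) := h3; rewrite ji.
  move=> /and3P[-> aw gw]; rewrite gw deadline_gt0// (deadline_le T0_gt0 rho_ge0 aw gw) active_used_ge0//.
  rewrite mart_bound//; have /and3P[-> -> /forallP h] := aw.
  have -> : [forall j, (j != i0) ==> (used_at s w j < current_at s w j)].
    by apply/forallP => j; apply/implyP => _; exact: h.
  exact: h.
apply => y.
case gy : (guard y); last first.
  by rewrite integral0_eq// => x _; rewrite /F /= gy.
rewrite /F /= gy /=.
move: (gy) => /and5P[_ _ _ _ /and5P[_ d0 d1 u0 m0]].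
have nuE B : measurable B -> distribution P (X (sched w i0) i0 (ends w i0)) B = exponential_prob 1 B.
  exact: clock_distribution.
pose nu : probability R R := distribution P (X (sched w i0) i0 (ends w i0)).
exact: (@integral_race_defect R nu _ _ _ _ nuE u0 d0).
Qed.

Let chi w s : R := (`[< S0 s >] && active_at s w)%:R.

Let mclk b i k : measurable_fun [set: Omega] (fun s => clk s b i k).
Proof. exact: measurable_funPT. Qed.

Let mar i j : measurable_fun [set: Omega] (fun s => a s i j).
Proof. by move=> _ B mB; rewrite setTI; exact/G_measurable/a_env. Qed.

Let mS0 : measurable_fun [set: Omega] (fun s => `[< S0 s >]).
Proof.
apply: (measurable_fun_bool true); rewrite setTI.
rewrite (_ : _ @^-1` _ = S0); first exact: G_measurable.
by apply/seteqP; split => w /=; [move/asboolP|move=> ?; apply/asboolP].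
Qed.

Let mchi w : measurable_fun [set: Omega] (chi w).
Proof.
have -> : chi w = (fun s => if `[< S0 s >] && active_at s w then 1 else 0).
  by apply/funext => s; rewrite /chi; case: (_ && _).
apply: measurable_fun_if => //.
by apply: measurable_and => //; exact: (@measurable_active R n e T0 alpha0 s0 _ Omega (fun s => clk s) a mar).
Qed.

Let mmart w : measurable_fun [set: Omega] (fun s => mart_at s w).
Proof. exact: (@measurable_mart R n e T0 alpha0 s0 _ Omega (fun s => clk s) a mar). Qed.

Let mcomp w : measurable_fun [set: Omega] (fun s => comp_at s w).
Proof. exact: (@measurable_comp R n e T0 alpha0 s0 _ Omega (fun s => clk s) a mar). Qed.

Let B0 (w : script) : R := (size w)%:R + rho * T J.

Let B1_ge0 : 0 <= rho * T J.
Proof. by rewrite mulr_ge0// ltW// update_period_gt0. Qed.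

Let chi_le s w (x y : R) : 0 <= y -> (active_at s w -> `|x| <= y) -> `|chi w s * x| <= y.
Proof.
move=> y0 h; rewrite /chi; case: (boolP (active_at s w)) => aw.
  by rewrite andbT; case: asboolP => _; rewrite ?mul1r ?mul0r ?normr0// h.
by rewrite andbF mul0r normr0.
Qed.

Lemma integrable_chi_mart w : P.-integrable setT (EFin \o (fun s => chi w s * mart_at s w ^+ 2)).
Proof.
apply: (@probability_bounded_integrable _ _ _ _ _ (B0 w ^+ 2)).
  by apply: measurable_funM => //; exact: measurable_funX.
move=> s; apply: chi_le; first exact: sqr_ge0.
by move=> aw; rewrite normrX lerXn2r ?nnegrE ?mart_bound// addr_ge0.
Qed.

Lemma integrable_chi_comp w : P.-integrable setT (EFin \o (fun s => chi w s * comp_at s w)).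
Proof.
apply: (@probability_bounded_integrable _ _ _ _ _ (rho * T J)).
  exact: measurable_funM.
move=> s; apply: chi_le => // aw.
by rewrite ger0_norm ?comp_ge0// comp_le.
Qed.

Let integrable_chi_sqd w : P.-integrable setT (EFin \o (fun s => chi w s * sqd_at s w)).
Proof.
have -> : EFin \o (fun s => chi w s * sqd_at s w) =
   ((EFin \o (fun s => chi w s * mart_at s w ^+ 2)%R) \-
    (EFin \o (fun s => chi w s * comp_at s w)%R))%E.
  by apply/funext => s /=; rewrite /square_defect mulrBr EFinB.
by apply: integrableB => //; [exact: integrable_chi_mart|exact: integrable_chi_comp].
Qed.

Let mrace w : measurable_fun [set: Omega] (race ^~ w).
Proof.
apply: measurable_fun_if => //.
  apply: measurable_and => //; apply: measurable_and.
    exact: (@measurable_active R n e T0 alpha0 s0 _ Omega (fun s => clk s) a mar).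
  exact: (@measurable_gate R n e T0 alpha0 s0 _ Omega (fun s => clk s) a mar).
apply: measurable_funTS; apply: measurable_race_defect.
- by apply: measurable_funD => //; exact: measurable_funM.
- exact: measurable_cst.
- exact: (@measurable_deadline R n e T0 alpha0 s0 _ Omega (fun s => clk s) a mar).
- apply: measurable_funB; first exact: mclk.
  exact: (@measurable_used R n e T0 alpha0 s0 _ Omega (fun s => clk s) a mar).
Qed.

(** Almost surely an active script has exactly one active successor: without ties a winner exists,
    and positive clocks make it fresh. The sum over successors reduces to that term. *)
Let step_ae m : {ae P, forall s,
  \sum_(w <- words n m.+1) chi w s * sqd_at s w =
  \sum_(w <- words n m) (chi w s * sqd_at s w + race s w)}.
Proof.
apply: filterS2 no_ties_ae clocks_gt0_ae => s nt pos.
rewrite big_words; apply: eq_bigr => w _.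
rewrite /race andbA; case: (boolP (`[< S0 s >] && active_at s w)) => [/andP[Ss aw]|naw]; last first.
  rewrite /= addr0 big1 => [|v _].
    by rewrite /chi (negbTE naw) mul0r.
  rewrite /chi; case: asboolP naw => //= _; last by rewrite mul0r.
  by case av : (active_at s (v :: w)); rewrite ?mul0r// (active_tail T0_gt0 av).
have [v wv] := wins_exists (nt w).
have fv : fresh e s0 (clk s) w v by case: (v) => // i; exact: (pos (_, _, _)).
have avw : active_at s (v :: w) by rewrite active_cons// aw wv.
rewrite (bigD1 v)//= big1 ?addr0; last first.
  move=> u uv; rewrite /chi active_cons//.
  case wu : (wins _ _ _ _ _ _ w u); last by rewrite !andbF mul0r.
  by rewrite (wins_uniq wu wv) eqxx in uv.
rewrite /chi Ss avw aw /= !mul1r.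
case: ifP => gw; first by rewrite -(square_defect_step aw gw wv) subrKC.
by rewrite /square_defect /= gw !addr0.
Qed.

Lemma integrable_race w : P.-integrable setT (EFin \o (race ^~ w)).
Proof.
pose M : R := (2 * B0 w + 1) + 2 * 1 * (rho * T J) + (2 * B0 w + 1) * (rho * T J) + 1 * (rho * T J) ^+ 2.
have B00 : 0 <= B0 w by rewrite addr_ge0.
apply: (@probability_bounded_integrable _ _ _ _ _ M) => // s.
rewrite /race; case: ifP => [/and3P[_ aw gw]|_]; last first.
  have h1 := mulr_ge0 B00 B1_ge0; have h2 := exprn_ge0 2 B1_ge0.
  rewrite normr0 /M; move: h1 h2 B00 B1_ge0; move: (B0 w) (rho * T J) => x y *; lra.
have dd : 0 <= deadline_at s w <= rho * T J by rewrite ltW ?deadline_gt0//= (deadline_le T0_gt0 rho_ge0 aw gw).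
have xx : 0 <= current_at s w i0 - used_at s w i0.
  by case/and3P: aw => _ _ /forallP h; rewrite subr_ge0 ltW.
apply: le_trans (race_defect_bound _ _ dd xx) _.
have h : `|2 * mart_at s w + 1| <= 2 * B0 w + 1.
  apply: le_trans (ler_normD _ _) _; rewrite normr1 lerD2r normrM ger0_norm//.
  by rewrite ler_wpM2l// mart_bound.
by rewrite /M normrN1 lerD2r lerD ?ler_wpM2r// lerD2r.
Qed.

(** The square of the martingale minus its compensator keeps mean 0: passing from length m to m + 1
    adds the race terms, each of mean 0, and the empty script starts at 0. *)
Lemma integral_sum_sqd m :
  (\int[P]_s (\sum_(w <- words n m) chi w s * sqd_at s w)%:E = 0)%E.
Proof.
elim: m => [|m IH].
  by rewrite integral0_eq// => s _; rewrite big_seq1 /square_defect /= expr0n subr0 mulr0.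
rewrite (ae_eq_integral (fun s => (\sum_(w <- words n m) (chi w s * sqd_at s w + race s w))%:E))//.
- under eq_integral do rewrite big_split EFinD.
  rewrite (integralD measurableT).
  + rewrite IH add0e; under eq_integral do rewrite -sumEFin.
    rewrite integral_sum// => [|w]; last exact: integrable_race.
    by rewrite big1// => w _; exact: integral_race.
  + under [X in _.-integrable _ X]eq_fun do rewrite -sumEFin.
    by apply: integrable_sum => // w _; exact: integrable_chi_sqd.
  + under [X in _.-integrable _ X]eq_fun do rewrite -sumEFin.
    by apply: integrable_sum => // w _; exact: integrable_race.
- apply/measurable_EFinP; apply: measurable_sum => w.
  by apply: measurable_funM => //; apply: measurable_funB => //; exact: measurable_funX.
- apply/measurable_EFinP; apply: measurable_sum => w; apply: measurable_funD => //.
  by apply: measurable_funM => //; apply: measurable_funB => //; exact: measurable_funX.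
- by apply: filterS (step_ae m) => s h _; rewrite h.
Qed.

(* The compensator of the squared martingale is [comp], at most [rho * T J]. *)
Lemma expected_mart_square_le m :
  (\int[P]_s (\sum_(w <- words n m) (`[< S0 s >] && active_at s w)%:R * mart_at s w ^+ 2)%:E
     <= (rho * T J)%:E)%E.
Proof.
have -> : (\int[P]_s (\sum_(w <- words n m) (`[< S0 s >] && active_at s w)%:R * mart_at s w ^+ 2)%:E =
   \int[P]_s (\sum_(w <- words n m) chi w s * comp_at s w)%:E)%E.
  transitivity (\int[P]_s ((\sum_(w <- words n m) chi w s * sqd_at s w)%:E +
     (\sum_(w <- words n m) chi w s * comp_at s w)%:E))%E.
    apply: eq_integral => s _; rewrite -EFinD -big_split /=; congr (_%:E).
    by apply: eq_bigr => w _; rewrite /square_defect -/(chi w s) -mulrDr subrK.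
  rewrite integralD//.
  - by rewrite integral_sum_sqd add0e.
  - under [X in _.-integrable _ X]eq_fun do rewrite -sumEFin.
    by apply: integrable_sum => // w _; exact: integrable_chi_sqd.
  - under [X in _.-integrable _ X]eq_fun do rewrite -sumEFin.
    by apply: integrable_sum => // w _; exact: integrable_chi_comp.
apply: (@le_trans _ _ (\int[P]_s (cst (rho * T J)%:E) s)%E); last first.
  rewrite integral_cst//= -[leRHS]mule1; apply: lee_wpmul2l; rewrite ?lee_fin//.
  exact: probability_le1.
apply: ge0_le_integral => //.
- move=> s _; rewrite lee_fin sumr_ge0// => w _; rewrite /chi.
  by case: (boolP (active_at s w)) => aw; rewrite ?andbF ?mul0r// mulr_ge0// comp_ge0.
- by apply/measurable_EFinP; apply: measurable_sum => w; exact: measurable_funM.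
move=> s _; rewrite /= lee_fin.
apply: (@le_trans _ _ (\sum_(w <- words n m) (active_at s w)%:R * (rho * T J))); last first.
  by rewrite -mulr_suml -[leRHS]mul1r ler_wpM2r// sum_active_words.
apply: ler_sum => w _; rewrite /chi.
case: (boolP (active_at s w)) => aw; rewrite ?andbF ?mul0r// andbT mul1r.
by case: asboolP => _; rewrite ?mul1r ?mul0r// comp_le.
Qed.

End ExpectedSquare.

End ResampledScripts.

(** * Integrals over intervals, with their side conditions *)

Section IntegralOver.
Context (R : realType).
Notation mu := (@lebesgue_measure R).
Implicit Types (f : R -> R) (a b c v M : R).

(** The integral is a total function, so its value alone carries no information on integrability.
    Measurability and boundedness travel with it because concatenation of intervals needs them. *)
Definition has_integral f a b v :=
  [/\ a <= b, measurable_fun `[a, b] f,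
      exists M, forall x, a <= x <= b -> `|f x| <= M &
      \int[mu]_(x in `[a, b]) f x = v].

Lemma has_integral_integrable f a b v : has_integral f a b v ->
  mu.-integrable `[a, b] (EFin \o f).
Proof.
move=> [ab mf [M fM] _]; apply: measurable_bounded_integrable => //.
  by rewrite /= lebesgue_measure_itv/=; case: ifP => _; rewrite -?EFinD ltry.
exists M; split; [exact: num_real|move=> y My x/=; rewrite in_itv/= => xab].
exact: le_trans (fM x xab) (ltW My).
Qed.

Lemma has_integral_unique f a b v v' : has_integral f a b v -> has_integral f a b v' -> v = v'.
Proof. by move=> [_ _ _ <-] [_ _ _ <-]. Qed.

(** The right end is left free: schedules and rates are right-continuous and may jump there. *)
Lemma has_integral_cst f a b c : a <= b -> (forall x, a <= x < b -> f x = c) ->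
  has_integral f a b (c * (b - a)).
Proof.
move=> ab fc.
pose g x := if x == b then f b else c.
have fg : {in `[a, b]%classic, f =1 g}.
  move=> x; rewrite inE/= in_itv/= => /andP[ax xb]; rewrite /g.
  by case: eqVneq => [->//|xnb]; rewrite fc// ax lt_neqAle xnb.
have mg : measurable_fun setT g.
  by apply: measurable_fun_if => //; exact: measurable_fun_eqr.
split => //.
- by apply: (eq_measurable_fun g); [move=> x xab; rewrite fg|exact: measurable_funTS].
- exists (`|c| + `|f b|) => x xab; rewrite fg ?inE/= ?in_itv//= /g.
  by case: ifP => _; rewrite ?lerDl ?lerDr.
- rewrite -Rintegral_itv_bndo_bndc; last first.
    have intab : mu.-integrable `[a, b] (EFin \o f).
      apply: measurable_bounded_integrable => //.
        by rewrite /= lebesgue_measure_itv/=; case: ifP => _; rewrite -?EFinD ltry.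
        by apply: (eq_measurable_fun g); [move=> x xab; rewrite fg|exact: measurable_funTS].
      exists (`|c| + `|f b|); split; [exact: num_real|move=> y My x xab].
      apply: le_trans (ltW My); rewrite fg ?inE// /g.
      by case: ifP => _; rewrite ?lerDl ?lerDr.
    apply: (integrableS _ _ _ intab) => // x/=.
    by rewrite !in_itv/= => /andP[-> /ltW].
  rewrite (@eq_Rintegral _ _ _ _ _ (cst c)); last first.
    by move=> x; rewrite inE/= in_itv/= => /fc.
  rewrite Rintegral_cst//= lebesgue_measure_itv/= lte_fin.
  move: ab; rewrite le_eqVlt => /orP[/eqP->|->]; last by rewrite -EFinB.
  by rewrite ltxx subrr.
Qed.

Lemma has_integral_point f a : has_integral f a a 0.
Proof.
have := @has_integral_cst f a a 0 (lexx a); rewrite mul0r; apply => x.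
by move=> /andP[h1 h2]; have := le_lt_trans h1 h2; rewrite ltxx.
Qed.

Lemma has_integral_cat f a b c v v' : has_integral f a b v -> has_integral f b c v' ->
  has_integral f a c (v + v').
Proof.
move=> H1 H2; have [ab mf1 [M1 fM1] E1] := H1; have [bc mf2 [M2 fM2] E2] := H2.
have H : has_integral f a c (\int[mu]_(x in `[a, c]) f x).
  split => //; first exact: le_trans bc.
    have -> : `[a, c]%classic = `[a, b] `|` `[b, c].
      by apply/seteqP; split => x /=; rewrite !in_itv/=; lra.
    by apply/measurable_funU.
  exists (`|M1| + `|M2|) => x /andP[ax xc].
  have [xb|xb] := leP x b.
    by rewrite (le_trans (fM1 x _)) ?ax// (le_trans (ler_norm _))// lerDl.
  by rewrite (le_trans (fM2 x _)) ?(ltW xb)// (le_trans (ler_norm _))// lerDr.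
have [ac mf hM _] := H; split => //.
have := @Rintegral_itvB R f (BLeft a) (BRight c) b (has_integral_integrable H).
rewrite !bnd_simp => /(_ ab bc) => eqn.
have E3 : \int[mu]_(x in `]b, c]) f x = \int[mu]_(x in `[b, c]) f x.
  apply: Rintegral_itv_obnd_cbnd.
  apply: (integrableS _ _ _ (has_integral_integrable H2)) => // x/=.
  by rewrite !in_itv/= => /andP[/ltW-> ->].
by rewrite -E1 -E2 -E3 -eqn addrC subrK.
Qed.

Lemma has_integral_sub f a b v a' b' : has_integral f a b v ->
  a <= a' -> a' <= b' -> b' <= b -> exists v', has_integral f a' b' v'.
Proof.
move=> [ab mf [M fM] _] aa ab' bb; exists (\int[mu]_(x in `[a', b']) f x); split => //.
  apply: measurable_funS mf => // x /=; rewrite !in_itv/= => /andP[h1 h2].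
  by rewrite (le_trans aa h1) (le_trans h2 bb).
by exists M => x /andP[h1 h2]; apply: fM; rewrite (le_trans aa h1) (le_trans h2 bb).
Qed.

Lemma has_integral_ge0 f a b v : has_integral f a b v ->
  (forall x, a <= x <= b -> 0 <= f x) -> 0 <= v.
Proof.
by move=> [_ _ _ <-] f0; apply: Rintegral_ge0 => x /=; rewrite in_itv/=; exact: f0.
Qed.

End IntegralOver.

Section PiecewiseRates.
Context (R : realType) (T0 : R).
Hypothesis T0_gt0 : 0 < T0.
Local Notation L := (update_time T0).

Lemma update_time_ge j : j%:R <= L j.+1.
Proof.
elim: j => [|j IH]; first exact: update_time_ge0.
rewrite update_timeS -natr1 lerD//= -[leLHS]expR0 ler_expR; exact: sqrtr_ge0.
Qed.

Lemma update_time_window (t : R) : 0 <= t -> exists j, L j <= t < L j.+1.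
Proof.
move=> t0; have ex : exists j, t < L j.
  have [k tk] : exists k : nat, t < k%:R.
    by exists (Num.truncn t).+1; rewrite truncnS_gt.
  by exists k.+1; apply: lt_le_trans tk (update_time_ge k).
have [[|j]] := ex_minnP ex => tj jmin; first by rewrite update_time0 ltNge t0 in tj.
exists j; rewrite tj andbT leNgt; apply/negP => /jmin.
by rewrite ltnn.
Qed.

Context (f : R -> R).
Hypothesis f_gt0 : forall t, 0 < f t.
Hypothesis f_step : forall j t, L j <= t < L j.+1 -> f t = f (L j).

Lemma piecewise_has_integral a b : 0 <= a -> a <= b -> exists v, has_integral f a b v.
Proof.
move=> a0 ab; have [J /andP[_ bJ]] := update_time_window (le_trans a0 ab).
have [v Hv] : exists v, has_integral f 0 (L J.+1) v.
  elim: (J.+1) => [|j [v Hv]]; first by exists 0; rewrite update_time0; exact: has_integral_point.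
  exists (v + f (L j) * (L j.+1 - L j)); apply: has_integral_cat Hv _.
  by apply: has_integral_cst; [exact/ltW/update_time_ltS|exact: f_step].
exact: has_integral_sub Hv a0 ab (ltW bJ).
Qed.

Lemma piecewise_integral_gt0 a b v : 0 <= a -> a < b -> has_integral f a b v -> 0 < v.
Proof.
move=> a0 ab Hv; have [J /andP[Ja aJ]] := update_time_window a0.
pose c := Num.min b (L J.+1).
have ac : a < c by rewrite lt_min ab.
have cb : c <= b by rewrite ge_min lexx.
have H1 : has_integral f a c (f (L J) * (c - a)).
  apply: has_integral_cst; first exact: ltW.
  move=> x /andP[ax xc]; apply: f_step; rewrite (le_trans Ja ax) (lt_le_trans xc)//.
  by rewrite ge_min lexx orbT.
have [v' H2] := piecewise_has_integral (le_trans a0 (ltW ac)) cb.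
rewrite (has_integral_unique Hv (has_integral_cat H1 H2)).
apply: ltr_wpDr; last by rewrite mulr_gt0// subr_gt0.
by apply: has_integral_ge0 H2 _ => x _; exact: ltW.
Qed.

End PiecewiseRates.

Section CountAndOccupation.
Context (R : realType) (n : nat) (e : rel 'I_n) (T0 alpha0 : R).
Hypothesis T0_gt0 : 0 < T0.
Context (s0 : {ffun 'I_n -> bool}).
Context (c : bool -> 'I_n -> nat -> R) (a : 'I_n -> nat -> R).
Local Notation script := (seq (option 'I_n)).
Local Notation L := (update_time T0).
Local Notation T := (update_period T0).
Local Notation sched := (sched e s0).
Local Notation now := (now e T0 alpha0 s0 c a).
Local Notation occupation := (occupation e T0 alpha0 s0 c a).
Local Notation active := (active e T0 alpha0 s0 c a).

Fixpoint count_ends (g : {ffun 'I_n -> bool}) (i : 'I_n) (J : nat) (w : script) : nat :=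
  if w is v :: w' then
    ([&& v == Some i, sched w' == g & window w' == J] + count_ends g i J w')%N
  else 0%N.

Lemma occupation_ge0 w J g : active w -> 0 <= occupation w J g.
Proof.
elim: w => [//|v w IH] avw; have aw := active_tail T0_gt0 avw.
rewrite occupation_cons addr_ge0 ?IH//; case: ifP => // _.
exact/ltW/delay_gt0_active.
Qed.

Lemma occupation_future w J g : (window w < J)%N -> occupation w J g = 0.
Proof.
elim: w => [//|v w IH] wJ.
have wJ' : (window w < J)%N by apply: leq_ltn_trans wJ; rewrite /window/= leq_addl.
by rewrite occupation_cons IH// gtn_eqF//= addr0.
Qed.

Lemma sum_occupation w J : active w -> \sum_g occupation w J g =
  if (window w < J)%N then 0 else if J == window w then now w - L J else T J.
Proof.
elim: w => [|v w IH] avw.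
  rewrite big1//= /window/=; case: J => [|J]//=.
  by rewrite update_time0 subrr.
have aw := active_tail T0_gt0 avw; have {}IH := IH aw.
have -> : \sum_g occupation (v :: w) J g =
    \sum_g occupation w J g + (if J == window w then delay e T0 alpha0 s0 c a w v else 0).
  rewrite (eq_bigr _ (fun g _ => occupation_cons _ _ _ _ _ _ _ _ _ _)) big_split/=.
  congr (_ + _); case: eqVneq => /= JE; last by rewrite big1.
  by rewrite -big_mkcond/= big_pred1_eq.
rewrite IH now_cons; case: v avw => [i|] avw; rewrite ?window_some ?window_none.
  have [wJ|wJ|wJ] := ltngtP (window w) J; rewrite ?addr0//.
  by rewrite addrAC.
have [wJ|wJ|<-] := ltngtP (window w) J.
- rewrite addr0; have [//||<-] := ltngtP (window w).+1 J.
    by rewrite ltnS leqNgt wJ.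
  by rewrite delay_none subrKC subrr.
- have -> : ((window w).+1 < J)%N = false by lia.
  have -> : (J == (window w).+1) = false by lia.
  exact: addr0.
- have -> : ((window w).+1 < window w)%N = false by lia.
  have -> : (window w == (window w).+1) = false by lia.
  rewrite delay_none update_timeS; lra.
Qed.

Lemma mart_frozen g i J rho v w : window w != J ->
  mart e T0 alpha0 s0 c a g i J rho (v :: w) = mart e T0 alpha0 s0 c a g i J rho w.
Proof. by move=> wJ; rewrite /= /gate (negbTE wJ) andbF addr0. Qed.

Lemma count_ends_future g i J w : (window w < J)%N -> count_ends g i J w = 0%N.
Proof.
elim: w => [//|v w IH] wJ /=.
have wJ' : (window w < J)%N by apply: leq_ltn_trans wJ; rewrite /window/= leq_addl.
by rewrite IH// (ltn_eqF wJ') !andbF.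
Qed.

(* Flow conservation: up to the boundary of the window, each configuration is
   entered as often as it is left. *)
Lemma count_ends_balance g J w :
  `|\sum_g' \sum_(i | toggle e g' i == g) (count_ends g' i J w)%:R -
    \sum_i (count_ends g i J w)%:R| <= 1 :> R.
Proof.
pose B w : R := \sum_g' \sum_(i | toggle e g' i == g) (count_ends g' i J w)%:R -
    \sum_i (count_ends g i J w)%:R.
rewrite -/(B w).
have stepB v w' : B (v :: w') = B w' + (if (v != None) && (window w' == J) then
   (sched (v :: w') == g)%:R - (sched w' == g)%:R else 0).
  rewrite /B /=; case: v => [i|] /=; last first.
    by rewrite addr0.
  have -> : \sum_i0 ([&& Some i == Some i0, sched w' == g & window w' == J] + count_ends g i0 J w')%:R
      = (if window w' == J then (sched w' == g)%:R else 0) + \sum_i0 (count_ends g i0 J w')%:R :> R.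
    rewrite (eq_bigr _ (fun j _ => natrD _ _ _)) big_split /=; congr (_ + _).
    rewrite (bigD1 i)//= eqxx big1 ?addr0 => [|j ji]; last by rewrite (inj_eq Some_inj) eq_sym (negbTE ji).
    by case: (window w' == J); rewrite ?andbT ?andbF.
  have -> : \sum_g' \sum_(i0 | toggle e g' i0 == g)
      ([&& Some i == Some i0, sched w' == g' & window w' == J] + count_ends g' i0 J w')%:R
      = (if window w' == J then (toggle e (sched w') i == g)%:R else 0) +
       \sum_g' \sum_(i0 | toggle e g' i0 == g) (count_ends g' i0 J w')%:R :> R.
    under eq_bigr do rewrite (eq_bigr _ (fun j _ => natrD _ _ _)) big_split /=.
    rewrite big_split /=; congr (_ + _).
    rewrite (bigD1 (sched w'))//= [X in _ + X]big1 ?addr0 => [|g' gg']; last first.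
      by rewrite big1// => j _; rewrite [sched w' == g']eq_sym (negbTE gg') andbF.
    rewrite big_mkcond (bigD1 i)//= big1 ?addr0 => [|j ji]; last first.
      by rewrite (inj_eq Some_inj) [i == j]eq_sym (negbTE ji) /=; case: ifP.
    rewrite !eqxx /=; case: (toggle e (sched w') i == g); case: (window w' == J) => //.
  case: (window w' == J) => /=; rewrite ?add0r ?addr0//; lra.
(* Up to window [J] the imbalance is the indicator of [g] now minus a boolean that remembers whether
   window [J] was entered in [g]; afterwards it is frozen. Only the first form is inductive inside
   the window. *)
suff [h1 h2] : ((window w <= J)%N -> exists b : bool, B w = (sched w == g)%:R - b%:R) /\
    (exists b1 b2 : bool, B w = b1%:R - b2%:R).
  by have [[] [[] ->]] := h2; rewrite ?subrr ?subr0 ?sub0r ?normr0 ?normr1 ?normrN1.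
elim: w => [|v w [IH1 IH2]].
  have B0 : B [::] = 0 by rewrite /B /= [X in _ - X]big1// big1 ?subrr// => g' _; rewrite big1.
  by rewrite B0; split; [exists (s0 == g); rewrite subrr|exists false, false; rewrite subrr].
rewrite stepB; have [wJ|wJ] := eqVneq (window w) J; last first.
  rewrite andbF addr0; split => //; case: v => [i|]; last first.
    rewrite window_none => wJ'; have [b bE] := IH1 (ltnW wJ'); exists b => //.
  rewrite window_some => wJ'.
  have wJ2 : (window w < J)%N by rewrite ltn_neqAle wJ.
  have -> : B w = 0.
    rewrite /B [X in _ - X]big1 ?subr0 => [|j _]; last by rewrite count_ends_future.
    by rewrite big1// => g' _; rewrite big1// => j _; rewrite count_ends_future.
  by exists (sched (Some i :: w) == g); rewrite subrr.
have [b bE] : exists b : bool, B w = (sched w == g)%:R - b%:R by apply: IH1; rewrite wJ.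
case: v => [i|] /=; last first.
  rewrite addr0; split; first by rewrite /window/= -/(window w) wJ ltnn.
  exact: IH2.
have -> : B w + ((toggle e (sched w) i == g)%:R - (sched w == g)%:R) =
  (toggle e (sched w) i == g)%:R - b%:R by rewrite bE; lra.
by split; [exists b|exists (toggle e (sched w) i == g), b].
Qed.

End CountAndOccupation.

(** * Matching a sample path with scripts *)

(* The scripts whose simulation from the clocks reproduces a given sample path. *)
Section PathMatching.
Context (R : realType) (n : nat) (e : rel 'I_n) (T0 alpha0 : R).
Hypothesis T0_gt0 : 0 < T0.
Context (c : bool -> 'I_n -> nat -> R) (aa : 'I_n -> R -> R) (s : 'I_n -> R -> bool)
  (r : 'I_n -> R -> R) (tau : 'I_n -> nat -> R).
Local Notation script := (seq (option 'I_n)).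
Local Notation L := (update_time T0).
Local Notation T := (update_period T0).

Hypothesis alg : algorithm1_path T0 alpha0 aa s r.
Hypothesis s_indep : forall t, 0 <= t -> independent_set e [ffun i => s i t].
Hypothesis tau0 : forall i, tau i 0%N = 0.
Hypothesis tau_lt : forall i k, tau i k < tau i k.+1.
Hypothesis tau_unbounded : forall i t, exists k, t < tau i k.
Hypothesis tau_const : forall i k t, tau i k <= t < tau i k.+1 -> s i t = s i (tau i k).
Hypothesis tau_busy : forall i k, s i (tau i k) = true ->
  tau i k.+1 - tau i k = c true i k /\ s i (tau i k.+1) = false.
Hypothesis tau_wait : forall i k, s i (tau i k) = false ->
  \int[lebesgue_measure]_(u in `[tau i k, tau i k.+1]) expR (r i u) = c false i k /\
  (s i (tau i k.+1) = true <->
   \forall u \near (tau i k.+1)^'-, forall j, e i j -> s j u = false).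

Definition arrival_rate i j := (aa i (L j.+1) - aa i (L j)) / T j.
Definition start : {ffun 'I_n -> bool} := [ffun i => s i 0].

Local Notation a := arrival_rate.
Local Notation sched := (sched e start).
Local Notation current := (current e start c).
Local Notation now := (now e T0 alpha0 start c a).
Local Notation used := (used e T0 alpha0 start c a).
Local Notation par := (par e T0 alpha0 start c a).
Local Notation speed := (speed e T0 alpha0 start c a).
Local Notation delay := (delay e T0 alpha0 start c a).
Local Notation wins := (wins e T0 alpha0 start c a).
Local Notation occupation := (occupation e T0 alpha0 start c a).
Local Notation active := (active e T0 alpha0 start c a).
Local Notation mart := (mart e T0 alpha0 start c a).

Definition rate (g : {ffun 'I_n -> bool}) i J : R :=
  if g i then 1 else expR (r i (L J)).

(** [m_tau] places the current time in the current period of every node, and [m_served] identifies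
    simulated occupation times with integrals of the true schedule. In [m_mart] the cap has
    disappeared: once [rho] dominates the true rate, the martingale is the count of ends minus the
    rate times the occupation time. *)
Record matched (w : script) : Prop := Matched {
  m_active : active w;
  m_tau : forall i, tau i (ends w i) <= now w < tau i (ends w i).+1;
  m_sched : forall i, s i (tau i (ends w i)) = sched w i;
  m_used : forall i, if sched w i then used w i = now w - tau i (ends w i)
    else has_integral (fun u => expR (r i u)) (tau i (ends w i)) (now w) (used w i);
  m_par : forall i, par w i = r i (L (window w));
  m_served : forall J i, (J <= window w)%N ->
    has_integral (fun t => (s i t)%:R) (L J) (if J == window w then now w else L J.+1)
      (\sum_(g : {ffun 'I_n -> bool}) (g i)%:R * occupation w J g);
  m_mart : forall g i J rho, rate g i J <= rho ->
    mart g i J rho w = (count_ends e start g i J w)%:R - rate g i J * occupation w J g;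
  m_indep : forall J g, occupation w J g != 0 -> independent_set e g }.

Let r_window i j t : L j <= t < L j.+1 -> r i t = r i (L j).
Proof. by case: (alg i) => _ h _; exact: h. Qed.

Let hazard_gt0 i t : 0 < expR (r i t). Proof. exact: expR_gt0. Qed.

Let hazard_step i j t : L j <= t < L j.+1 -> expR (r i t) = expR (r i (L j)).
Proof. by move=> h; rewrite (r_window _ h). Qed.

Let tau_ge0 i k : 0 <= tau i k.
Proof.
elim: k => [|k IH]; first by rewrite tau0.
exact: le_trans IH (ltW (tau_lt i k)).
Qed.

Let tau_le i : {homo tau i : k l / (k <= l)%N >-> k <= l}.
Proof. by apply: homo_leq => [//|? ? ?|k]; [exact: le_trans|exact: ltW]. Qed.

(** Read off the path, not from the law: periods have positive length and hazards are positive. *)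
Lemma clock_gt0 i k : 0 < c (s i (tau i k)) i k.
Proof.
case sk : (s i (tau i k)).
  by have [<- _] := tau_busy sk; rewrite subr_gt0.
have [<- _] := tau_wait sk.
have [v Hv] := piecewise_has_integral T0_gt0 (@hazard_step i) (tau_ge0 i k) (ltW (tau_lt i k)).
rewrite (_ : \int[_]_(u in _) _ = v); last by case: Hv.
exact: (piecewise_integral_gt0 T0_gt0 (@hazard_gt0 i) (@hazard_step i) (tau_ge0 i k) (tau_lt i k) Hv).
Qed.

Lemma matched_nil : matched [::].
Proof.
split => //.
- apply/and3P; split => //.
    by rewrite /before now_nil /window/= update_timeS update_time0 add0r update_period_gt0.
  apply/forallP => i; rewrite used_nil currentE /ends/= /start ffunE -(tau0 i).
  by have := clock_gt0 i 0; rewrite tau0.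
- by move=> i; rewrite /ends/= tau0 now_nil lexx -(tau0 i) tau_lt.
- by move=> i; rewrite /ends/= tau0 /= ffunE.
- move=> i; rewrite /ends/= tau0 now_nil used_nil subrr; case: ifP => // _.
  exact: has_integral_point.
- by move=> i; rewrite /window/= update_time0 par_nil; have [->] := alg i.
- move=> J i; rewrite leqn0 => /eqP ->; rewrite eqxx now_nil update_time0 big1 => [|g _].
    exact: has_integral_point.
  by rewrite mulr0.
- by move=> g i J rho _ /=; rewrite occupation_nil mulr0 subrr.
- by move=> J g; rewrite occupation_nil eqxx.
Qed.

Section Step.
Variables (w : script) (v : option 'I_n).
Hypothesis mw : matched w.
Hypothesis wv : wins w v.

Let aw : active w := m_active mw.
Let nextL : R := L (window w).+1.

Let now_ge : L (window w) <= now w. Proof. exact: active_now. Qed.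
Let now_ltL : now w < nextL. Proof. by case/and3P: aw. Qed.
Let now_ge0 : 0 <= now w. Proof. exact: le_trans (update_time_ge0 T0_gt0 _) now_ge. Qed.
Let d_gt0 : 0 < delay w v. Proof. exact: delay_gt0_active. Qed.
Let now_lt : now w < now (v :: w). Proof. by rewrite now_cons ltrDl. Qed.

Let wins_lt u : u != v -> delay w v < delay w u.
Proof. by move=> uv; have /forallP/(_ u) := wv; rewrite uv. Qed.

Let wins_le u : delay w v <= delay w u.
Proof. by case: (eqVneq u v) => [->|/wins_lt/ltW]. Qed.

Let now_leL : now (v :: w) <= nextL.
Proof. by rewrite now_cons -lerBrDl; exact: (wins_le None). Qed.

Let speed_rate i : speed w i = if sched w i then 1 else expR (r i (L (window w))).
Proof. by rewrite speedE m_par. Qed.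

Let hazard_piece i b : now w <= b -> b <= nextL -> ~~ sched w i ->
  has_integral (fun u => expR (r i u)) (now w) b (speed w i * (b - now w)).
Proof.
move=> nb bL si; rewrite speed_rate (negbTE si); apply: has_integral_cst => // x /andP[h1 h2].
by apply: hazard_step; rewrite (le_trans now_ge h1) (lt_le_trans h2 bL).
Qed.

(** The simulated delay extrapolates the present speed, which is legitimate only until the next
    update. If the true period ends by then, the extrapolation is exact; if it ends later, all that
    is needed is that the update comes first. *)
Let period_end i :
  (tau i (ends w i).+1 <= nextL -> tau i (ends w i).+1 = now w + delay w (Some i)) /\
  (nextL < tau i (ends w i).+1 -> delay w None < delay w (Some i)).
Proof.
set t1 := tau i (ends w i).+1; have /andP[t0n nt1] := m_tau mw i; have su := m_used mw i.
have sm := m_sched mw i; have sp0 := speed_gt0 e T0 alpha0 start c a w i.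
have curE : current w i = c (s i (tau i (ends w i))) i (ends w i) by rewrite currentE sm.
rewrite delay_some; case si : (sched w i) su => su.
  have spE : speed w i = 1 by rewrite speed_rate si.
  have [h _] := tau_busy (etrans sm si); rewrite -/t1 in h.
  rewrite curE sm si -h su spE divr1 delay_none -/nextL; split; lra.
have cE : c false i (ends w i) = \int[lebesgue_measure]_(u in `[tau i (ends w i), t1]) expR (r i u).
  by have [->] := tau_wait (etrans sm si).
(* The level of the clock is cut at [b] into what is consumed by now, what is consumed at constant
   speed until [b], and a rest [z] that vanishes exactly at the end of the period. *)
have key b : now w <= b -> b <= nextL -> b <= t1 -> exists z,
    [/\ current w i = used w i + speed w i * (b - now w) + z, (b = t1 -> z = 0) & (b < t1 -> 0 < z)].
  move=> nb bL bt1.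
  have H1 := has_integral_cat su (hazard_piece nb bL (negbT si)).
  have b0 : 0 <= b by exact: le_trans nb.
  have [z Hz] := piecewise_has_integral T0_gt0 (@hazard_step i) b0 bt1.
  exists z; split.
  - by rewrite curE sm si cE; case: (has_integral_cat H1 Hz).
  - by move=> bt; move: Hz; rewrite bt => Hz; exact: has_integral_unique Hz (has_integral_point _ _).
  - move=> bt; exact: (piecewise_integral_gt0 T0_gt0 (@hazard_gt0 i) (@hazard_step i) b0 bt Hz).
split => h.
  have [z [-> /(_ erefl) -> _]] := key t1 (ltW nt1) h (lexx _).
  by rewrite addr0 addrAC subrr add0r mulrC mulKf ?gt_eqF// subrKC.
have [z [-> _ /(_ h) z0]] := key nextL (ltW now_ltL) (lexx _) (ltW h).
rewrite delay_none -/nextL ltr_pdivlMr//; lra.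
Qed.

Let other_end i : v != Some i -> now (v :: w) < tau i (ends w i).+1.
Proof.
move=> vi; have [h1 _] := period_end i.
have [/h1 ->|tL] := leP (tau i (ends w i).+1) nextL; last exact: le_lt_trans now_leL tL.
by rewrite now_cons ltrD2l; apply: wins_lt; rewrite eq_sym.
Qed.

Let winner_end i : v = Some i -> tau i (ends w i).+1 = now (v :: w).
Proof.
move=> vi; have [h1 h2] := period_end i.
have [/h1 ->|/h2] := leP (tau i (ends w i).+1) nextL; first by rewrite now_cons vi.
by rewrite ltNge -vi wins_le.
Qed.

Let s_between i x : now w <= x < now (v :: w) -> s i x = sched w i.
Proof.
move=> /andP[h1 h2]; rewrite -(m_sched mw) ; apply: tau_const.
have /andP[h3 _] := m_tau mw i; rewrite (le_trans h3 h1) /=.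
have [vi|/other_end] := eqVneq v (Some i); first by rewrite (winner_end vi).
exact: lt_trans.
Qed.

(** Every node keeps its simulated state throughout the interval that precedes the event, so the
    left-neighborhood condition on the neighbors reduces to the boolean test of [may_toggle]. *)
Let winner_state i : v = Some i -> s i (now (v :: w)) = sched (v :: w) i.
Proof.
move=> vi; rewrite -(winner_end vi) [in RHS]vi /= /toggle /may_toggle.
have sm := m_sched mw i.
case si : (sched w i); rewrite si in sm.
  by have [_ ->] := tau_busy sm; rewrite /= ffunE eqxx.
have [_ nearE] := tau_wait sm.
rewrite (winner_end vi) in nearE *.
have nearL : \forall u \near (now (v :: w))^'-, now w <= u < now (v :: w).
  near=> u; apply/andP; split; [apply: ltW|]; near: u; [exact: nbhs_left_gt|exact: nbhs_left_lt].
case: ifP => /= [/forallP h|/forallPn[j]].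
  rewrite ffunE eqxx /=; apply/nearE; apply: filterS nearL => u hu j eij.
  by rewrite (s_between _ hu); have := h j; rewrite eij => /negbTE.
rewrite negb_imply negbK si => /andP[eij sj].
apply/negbTE/negP => /nearE h.
have [u [hu hn]] := filter_ex (filterI nearL h).
by have := hn j eij; rewrite (s_between _ hu) sj.
Unshelve. all: by end_near.
Qed.

Let wins_fresh : fresh e start c w v.
Proof.
rewrite /fresh; case vi : v => [i|//]; rewrite -vi currentE ends_cons vi eqxx -vi.
rewrite -(winner_state vi) -(winner_end vi) add1n.
exact: clock_gt0.
Qed.

Let delayE : now (v :: w) - now w = delay w v.
Proof. by rewrite now_cons addrAC subrr add0r. Qed.

Let sum_occupation_cons J i :
  \sum_(g : {ffun 'I_n -> bool}) (g i)%:R * occupation (v :: w) J g =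
  \sum_(g : {ffun 'I_n -> bool}) (g i)%:R * occupation w J g +
  (if J == window w then (sched w i)%:R * delay w v else 0).
Proof.
rewrite (eq_bigr _ (fun g _ => congr1 _ (occupation_cons _ _ _ _ _ _ _ _ _ _))).
rewrite (eq_bigr _ (fun g _ => mulrDr _ _ _)) big_split /=; congr (_ + _).
case: eqVneq => JE /=; last by rewrite big1// => g _; rewrite mulr0.
rewrite (bigD1 (sched w))//= eqxx big1 ?addr0// => g /negbTE ->.
by rewrite mulr0.
Qed.

Let served_window i : has_integral (fun t => (s i t)%:R) (L (window w)) (now (v :: w))
  (\sum_(g : {ffun 'I_n -> bool}) (g i)%:R * occupation (v :: w) (window w) g).
Proof.
rewrite sum_occupation_cons eqxx -delayE.
have := m_served mw i (leqnn _); rewrite eqxx => H1; apply: has_integral_cat H1 _.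
by apply: has_integral_cst; [exact: ltW|move=> x hx; rewrite s_between].
Qed.

Lemma matched_step : matched (v :: w).
Proof.
have avw : active (v :: w) by rewrite active_cons// aw wv.
have same i : v != Some i -> ends (v :: w) i = ends w i by move=> vi; rewrite ends_cons (negbTE vi).
have tau_vw i : tau i (ends (v :: w) i) <= now (v :: w) < tau i (ends (v :: w) i).+1.
  have [vi|vi] := eqVneq v (Some i).
    by rewrite ends_cons vi eqxx add1n -vi -(winner_end vi) lexx tau_lt.
  rewrite same// other_end// andbT; have /andP[h _] := m_tau mw i.
  exact: le_trans h (ltW now_lt).
have sched_vw i : s i (tau i (ends (v :: w) i)) = sched (v :: w) i.
  have [vi|vi] := eqVneq v (Some i).
    by rewrite ends_cons vi eqxx add1n -vi (winner_end vi) winner_state.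
  by rewrite same// sched_cons_other// m_sched.
split => //.
- move=> i; rewrite used_cons; have [vi|vi] := eqVneq v (Some i).
    rewrite ends_cons vi eqxx add1n -vi (winner_end vi) subrr; case: ifP => // _.
    exact: has_integral_point.
  rewrite same// sched_cons_other//; have := m_used mw i.
  case: ifPn => si h; first by rewrite h speed_rate si mul1r now_cons addrAC.
  apply: has_integral_cat h _.
  by have := hazard_piece (ltW now_lt) now_leL si; rewrite delayE.
- move=> i; case vE : v => [j|]; first by rewrite par_some window_some m_par.
  rewrite par_none window_none m_par//; have [_ _ ->] := alg i.
  have := served_window i; rewrite vE now_cons delay_none subrKC => -[_ _ _ <-].
  by [].
- move=> J i; have [JE _|JnE] := eqVneq J (window w).
    have := served_window i; rewrite JE; case vE : v => [j|].
      by rewrite window_some eqxx.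
    by rewrite window_none ltn_eqF// now_cons delay_none subrKC.
  have [Jw _|wJ Jvw] := ltnP J (window w).
    rewrite sum_occupation_cons (negbTE JnE) addr0.
    have := m_served mw i (ltnW Jw); rewrite (negbTE JnE).
    rewrite ifF//; apply/ltn_eqF; apply: (leq_trans Jw).
    by rewrite /window/= leq_addl.
  have vE : v = None.
    by case: v Jvw => // j; rewrite window_some => h; rewrite eqn_leq h wJ in JnE.
  have JE : J = (window w).+1.
    by move: Jvw wJ (elimN eqP JnE); rewrite vE window_none; lia.
  rewrite sum_occupation_cons (negbTE JnE) addr0 vE window_none JE eqxx.
  rewrite now_cons delay_none subrKC big1 => [|g _]; first exact: has_integral_point.
  by rewrite occupation_future ?mulr0.
- move=> g i J rho rr.
  rewrite /= (m_mart mw rr) /gate occupation_cons natrD.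
  have [gE|gE] := eqVneq g (sched w); last first.
    by rewrite /= !andbF !addr0 add0r.
  have [JE|JE] := eqVneq (window w) J; last first.
    by rewrite /= !andbF !addr0 add0r.
  have spE : speed w i = rate g i J by rewrite speed_rate JE gE.
  by rewrite /= spE rr andbT mulrDr; lra.
- move=> J g; rewrite occupation_cons.
  case: ifP => [/andP[_ /eqP ->] _|_]; last by rewrite addr0; exact: m_indep.
  have -> : sched w = [ffun i => s i (now w)].
    by apply/ffunP => i; rewrite ffunE s_between// lexx.
  exact: s_indep.
Qed.

End Step.

Hypothesis no_ties : forall w u v, u != v -> delay w u != delay w v.

Lemma exists_matched_path : exists W : nat -> script,
  (forall m, size (W m) = m) /\ (forall m, matched (W m)) /\
  (forall m, exists v, W m.+1 = v :: W m).
Proof.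
have step (w : {w | matched w}) : {w' : {w | matched w} | exists v, sval w' = v :: sval w}.
  apply: cid; case: w => w mw /=.
  have [v wv] := wins_exists (@no_ties w).
  by exists (exist _ (v :: w) (matched_step mw wv)); exists v.
pose W := fix W m := if m is m'.+1 then sval (step (W m')) else exist _ [::] matched_nil.
have WS m : exists v, sval (W m.+1) = v :: sval (W m) by rewrite /=; case: (step _).
exists (fun m => sval (W m)); split; [|split => //].
  by elim => //= m IH; have [v ->] := WS m; rewrite /= IH.
by move=> m; case: (W m).
Qed.

Lemma size_script (w : script) : size w = (window w + \sum_i ends w i)%N.
Proof.
elim: w => [|v w IH]; first by rewrite /window /ends/= big1.
rewrite [size _]/= IH; case: v => [i|].
  rewrite window_some (eq_bigr _ (fun j _ => ends_cons _ _ _)) big_split /=.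
  have -> : (\sum_(j < n) (Some i == Some j) = 1)%N.
    rewrite (bigD1 i)//= eqxx big1// => j ji.
    by rewrite (inj_eq Some_inj) eq_sym (negbTE ji).
  by rewrite addnCA.
by rewrite window_none addSn (eq_bigr _ (fun j _ => ends_cons _ _ _)).
Qed.

(** The length of a script is its number of updates plus its numbers of period ends. Before the end
    of window [J] each node ends a bounded number of periods, because its epochs are unbounded in
    time. *)
Lemma matched_unbounded J : exists m, forall w, matched w -> (m <= size w)%N -> (J < window w)%N.
Proof.
have /choice[k hk] := fun i => tau_unbounded i (L J.+1).
exists (J.+1 + \sum_i k i)%N => w mw msz.
rewrite ltnNge; apply/negP => wJ.
have nL : now w < L J.+1.
  have /and3P[_ h _] := m_active mw; apply: lt_le_trans h _.
  by apply: update_time_le.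
move: msz; rewrite size_script leqNgt => /negP; apply.
apply: (@leq_ltn_trans (window w + \sum_i k i)); last by rewrite ltn_add2r ltnS.
rewrite leq_add2l; apply: leq_sum => i _; rewrite leqNgt; apply/negP => ki.
have /andP[h _] := m_tau mw i.
have := lt_trans (le_lt_trans (le_trans (@tau_le i _ _ (ltnW ki)) h) nL) (hk i).
by rewrite ltxx.
Qed.

End PathMatching.

(** * From summable expectations to an almost sure bound *)

Section FatouBound.
Context d (Omega : measurableType d) (R : realType) (P : probability Omega R).

(* Fatou's lemma for the sums over [J < m]. *)
Lemma ae_bounded_of_summable (f : nat -> nat -> Omega -> R) (c : nat -> R) (C : R) :
  (forall m J, measurable_fun setT (f m J)) -> (forall m J w, 0 <= f m J w) ->
  (forall m J, (\int[P]_w (f m J w)%:E <= (c J)%:E)%E) ->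
  (forall N, \sum_(J < N) c J <= C) ->
  {ae P, forall w, exists B, forall N (y : nat -> R),
    (forall J, (J < N)%N -> exists m0, forall m, (m0 <= m)%N -> y J <= f m J w) ->
    \sum_(J < N) y J <= B}.
Proof.
move=> mf f0 fc cC.
(* The same [m] is the script length and the truncation of the sum, so that a single lower limit
   serves both. *)
pose h m w : \bar R := (\sum_(J < m) f m J w)%:E.
have mh m : measurable_fun setT (h m).
  by apply/measurable_EFinP; apply: measurable_sum => J.
have h0 m w : (0 <= h m w)%E by rewrite lee_fin sumr_ge0.
have Eh m : (\int[P]_w h m w <= C%:E)%E.
  apply: (@le_trans _ _ (\sum_(J < m) (c J)%:E)%E); last by rewrite sumEFin lee_fin.
  under eq_integral do rewrite /h -sumEFin.
  rewrite ge0_integral_sum//; last 2 first.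
  - by move=> J; apply/measurable_EFinP.
  - by move=> J w _; rewrite lee_fin.
  exact: lee_sum.
pose g w := limn_einf (h ^~ w).
have mg : measurable_fun setT g.
  apply: (emeasurable_fun_cvg (fun n w => einfs (h ^~ w) n)).
    by move=> n; exact: measurable_fun_einfs.
  by move=> w _; rewrite /g limn_einf_lim; exact: is_cvg_einfs.
have g_ge w (x : R) m0 : (forall m, (m0 <= m)%N -> (x%:E <= h m w)%E) -> (x%:E <= g w)%E.
  move=> xh; rewrite /g limn_einf_lim; apply: lime_ge; first exact: is_cvg_einfs.
  near=> m; apply: le_ereal_inf_tmp => _ [k /= mk <-]; apply: xh.
  by apply: leq_trans mk; near: m; exact: nbhs_infty_ge.
have g0 w : (0 <= g w)%E by apply: (g_ge w 0 0%N) => m _.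
have Eg : (\int[P]_w g w <= C%:E)%E.
  apply: le_trans (fatou P measurableT mh _) _ => //.
  rewrite limn_einf_lim; apply: lime_le; first exact: is_cvg_einfs.
  by near=> m; apply: (le_trans _ (Eh m)); apply: ereal_inf_lbound; exists m => /=.
have ig : P.-integrable setT g.
  apply/integrableP; split => //.
  under eq_integral do rewrite gee0_abs//.
  exact: le_lt_trans Eg (ltry _).
apply: filterS (integrable_ae measurableT ig) => w /(_ I) gfin.
exists (fine (g w)) => N y hy; rewrite -lee_fin fineK//.
have /choice[m0 hm0] : forall J : 'I_N, exists m0, forall m, (m0 <= m)%N -> y J <= f m J w.
  by move=> J; exact: hy.
apply: (g_ge _ _ (maxn N (\max_J m0 J))) => m; rewrite geq_max => /andP[Nm mm].
rewrite lee_fin.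
apply: (@le_trans _ _ (\sum_(J < N) f m J w)).
  by apply: ler_sum => J _; apply: hm0; apply: leq_trans mm; exact: leq_bigmax.
rewrite -(subnKC Nm) big_split_ord /= lerDl.
by rewrite sumr_ge0.
Unshelve. all: by end_near.
Qed.

End FatouBound.

(** * The Gibbs measure *)

Section Gibbs.
Context (R : realType) (n : nat) (e : rel 'I_n).
Hypothesis e_sym : symmetric e.
Hypothesis e_irr : irreflexive e.
Local Notation config := {ffun 'I_n -> bool}.
Implicit Types (g h : config) (i j : 'I_n) (r : 'I_n -> R).

Definition indep g := [forall i, forall j, e i j ==> ~~ (g i && g j)].

Lemma indepP g : reflect (independent_set e g) (indep g).
Proof.
apply: (iffP forallP) => [h i j eij|h i].
  by have /forallP/(_ j) := h i; rewrite eij; case: (g i); case: (g j).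
apply/forallP => j; apply/implyP => eij; have := h i j eij.
by case: (g i); case: (g j).
Qed.

Lemma indep_edge g i j : indep g -> e i j -> g i -> g j = false.
Proof. by move=> /forallP/(_ i)/forallP/(_ j) + eij gi; rewrite eij gi /= => /negbTE. Qed.

Definition empty_config : config := [ffun=> false].

Lemma indep_empty : indep empty_config.
Proof. by apply/forallP => i; apply/forallP => j; rewrite !ffunE implybT. Qed.

Lemma indep_toggle g i : indep g -> indep (toggle e g i).
Proof.
move=> ig; rewrite /toggle; case: ifP => // mt.
apply/forallP => j; apply/forallP => k; apply/implyP => ejk; rewrite !ffunE.
case: (eqVneq j i) ejk => [->|ji]; case: (eqVneq k i) => [->|ki] ejk.
- by rewrite e_irr in ejk.
- move: mt; rewrite /may_toggle; case gi : (g i) => //= /forallP/(_ k); rewrite ejk /=.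
  by move=> /negbTE ->.
- move: mt; rewrite /may_toggle; case gi : (g i) => //=; first by rewrite andbF.
  by move=> /forallP/(_ j); rewrite e_sym ejk /= => /negbTE ->.
- by have /forallP/(_ j)/forallP/(_ k) := ig; rewrite ejk.
Qed.

Lemma toggleK g i : indep g -> toggle e (toggle e g i) i = g.
Proof.
move=> ig; case mt : (may_toggle e g i); last by rewrite /toggle !mt.
have E : toggle e g i = [ffun j => if j == i then ~~ g i else g j] by rewrite /toggle mt.
have mt' : may_toggle e (toggle e g i) i.
  rewrite /may_toggle E ffunE eqxx; case gi : (g i) => //=.
  apply/forallP => j; apply/implyP => eij; rewrite ffunE.
  case: eqP => [ji|_]; first by rewrite ji e_irr in eij.
  by rewrite (indep_edge ig eij gi).
rewrite {1}/toggle mt'; apply/ffunP => j; rewrite !ffunE E !ffunE eqxx negbK.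
by case: eqP => [->|].
Qed.

Definition energy r g : R := \sum_i (g i)%:R * r i.
Definition weight r g : R := if indep g then expR (energy r g) else 0.
Definition partition r : R := \sum_g weight r g.
Definition gibbs r g : R := weight r g / partition r.
Definition num_configs : R := \sum_(g : config) 1.
Definition mean_service r i : R := \sum_(g : config) (g i)%:R * gibbs r g.
Definition toggle_rate r g i : R := if g i then 1 else expR (r i).

Lemma weight_ge0 r g : 0 <= weight r g.
Proof. by rewrite /weight; case: ifP => // _; exact: expR_ge0. Qed.

Lemma weight_le_partition r g : weight r g <= partition r.
Proof. by rewrite /partition (bigD1 g)//= lerDl sumr_ge0// => h _; exact: weight_ge0. Qed.

Lemma partition_ge1 r : 1 <= partition r.
Proof.
apply: le_trans (weight_le_partition r empty_config).
rewrite /weight indep_empty /energy big1 ?expR0// => i _.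
by rewrite ffunE mul0r.
Qed.

Lemma partition_gt0 r : 0 < partition r.
Proof. exact: lt_le_trans (partition_ge1 r). Qed.

Lemma gibbs_ge0 r g : 0 <= gibbs r g.
Proof. by rewrite divr_ge0 ?weight_ge0// ltW// partition_gt0. Qed.

Lemma gibbs_gt0 r g : indep g -> 0 < gibbs r g.
Proof. by move=> ig; rewrite divr_gt0 ?partition_gt0// /weight ig expR_gt0. Qed.

Lemma gibbs_nindep r g : ~~ indep g -> gibbs r g = 0.
Proof. by move=> ig; rewrite /gibbs /weight (negbTE ig) mul0r. Qed.

Lemma sum_gibbs r : \sum_g gibbs r g = 1.
Proof. by rewrite /gibbs -mulr_suml divff// gt_eqF// partition_gt0. Qed.

Lemma sum_gibbs_indep r : \sum_(g | indep g) gibbs r g = 1.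
Proof.
rewrite -(sum_gibbs r) big_mkcond; apply: eq_bigr => g _.
by case: ifPn => // /gibbs_nindep ->.
Qed.

(** Detailed balance: the factor exp(r i) sits in the weight when i transmits and in the rate when
    it waits. For a blocked toggle both sides coincide. *)
Lemma weight_toggle r g i : indep g ->
  weight r (toggle e g i) * toggle_rate r (toggle e g i) i = weight r g * toggle_rate r g i.
Proof.
move=> ig; rewrite /weight indep_toggle// ig.
case mt : (may_toggle e g i); last by rewrite /toggle mt.
have E : toggle e g i = [ffun j => if j == i then ~~ g i else g j] by rewrite /toggle mt.
have enE h : energy r h = (h i)%:R * r i + \sum_(j | j != i) (h j)%:R * r j.
  by rewrite /energy (bigD1 i).
have -> : energy r (toggle e g i) = (~~ g i)%:R * r i + \sum_(j | j != i) (g j)%:R * r j.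
  rewrite enE E ffunE eqxx; congr (_ + _); apply: eq_bigr => j /negbTE ji.
  by rewrite ffunE ji.
rewrite enE /toggle_rate E ffunE eqxx.
case: (g i) => /=; rewrite !mul0r ?add0r ?mul1r ?mulr1 expRD.
  by rewrite mulrC.
by rewrite mulrC.
Qed.

Lemma gibbs_toggle r g i : indep g ->
  gibbs r (toggle e g i) * toggle_rate r (toggle e g i) i = gibbs r g * toggle_rate r g i.
Proof. by move=> ig; rewrite /gibbs mulrAC weight_toggle// mulrAC. Qed.

Lemma sum_toggle (F : config -> R) i :
  \sum_(g | indep g) F (toggle e g i) = \sum_(g | indep g) F g.
Proof.
rewrite [RHS](reindex_onto (fun g => toggle e g i) (fun g => toggle e g i)) /=; last first.
  by move=> g; exact: toggleK.
apply: eq_bigl => g; apply/idP/andP => [ig|[ig /eqP <-]]; last exact: indep_toggle.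
by rewrite indep_toggle// toggleK.
Qed.

Section Dirichlet.
Variables (r : 'I_n -> R) (p : config -> R) (D pmin cmin eta : R).
Hypothesis p_ge0 : forall g, 0 <= p g.
Hypothesis p_indep : forall g, p g != 0 -> indep g.
Hypothesis p_sum : \sum_g p g = 1.
Hypothesis balance : forall g,
  `|\sum_h \sum_(i | toggle e h i == g) toggle_rate r h i * p h -
    \sum_i toggle_rate r g i * p g| <= D.
Hypothesis pmin_gt0 : 0 < pmin.
Hypothesis cmin_gt0 : 0 < cmin.
Hypothesis gibbs_pmin : forall g, indep g -> pmin <= gibbs r g.
Hypothesis gibbs_cmin : forall g i, indep g -> cmin <= gibbs r g * toggle_rate r g i.
Hypothesis eta_ge0 : 0 <= eta.
Hypothesis etaE : 2 * D <= eta ^+ 2 * (pmin * cmin).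

Let u g := p g / gibbs r g.
Let c g i := gibbs r g * toggle_rate r g i.

Let pE g : indep g -> p g = gibbs r g * u g.
Proof. by move=> ig; rewrite /u mulrC divfK// gt_eqF// gibbs_gt0. Qed.

Let u_ge0 g : 0 <= u g. Proof. by rewrite divr_ge0 ?gibbs_ge0. Qed.

Let p_sum_indep : \sum_(g | indep g) p g = 1.
Proof.
rewrite -p_sum [LHS]big_mkcond; apply: eq_bigr => g _.
by case: ifPn => // ig; apply/esym/eqP; apply: contraNT ig; exact: p_indep.
Qed.

Let D_ge0 : 0 <= D. Proof. exact: le_trans (balance empty_config). Qed.

Let sum_u : \sum_(g | indep g) u g <= pmin^-1.
Proof.
rewrite -[leRHS]mul1r -p_sum_indep mulr_suml; apply: ler_sum => g ig.
by rewrite ler_wpM2l// lef_pV2 ?posrE ?gibbs_gt0// gibbs_pmin.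
Qed.

(** The Dirichlet form of the density [u] of [p] with respect to the Gibbs measure, with
    conductances [c]; each edge is counted from both ends. *)
Let form := \sum_(g | indep g) \sum_i c g i * (u (toggle e g i) - u g) ^+ 2.

(** The balance defects are tested against [u] itself. By detailed balance and reindexing along the
    involution [toggle], the resulting sum has a second expression, and the two add up to minus the
    form. *)
Let form_balance : \sum_(g | indep g) u g * (\sum_h \sum_(i | toggle e h i == g)
    toggle_rate r h i * p h - \sum_i toggle_rate r g i * p g) = - form / 2.
Proof.
pose S := \sum_(g | indep g) \sum_i c g i * u g * (u (toggle e g i) - u g).
have -> : \sum_(g | indep g) u g * (\sum_h \sum_(i | toggle e h i == g)
    toggle_rate r h i * p h - \sum_i toggle_rate r g i * p g) = S.
  under eq_bigr do rewrite mulrBr.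
  rewrite sumrB /S.
  under [RHS]eq_bigr do under eq_bigr do rewrite mulrBr.
  under [RHS]eq_bigr do rewrite sumrB.
  rewrite [RHS]sumrB; congr (_ - _).
    under eq_bigr do rewrite mulr_sumr.
    rewrite exchange_big /= [RHS]big_mkcond; apply: eq_bigr => h _.
    case: ifPn => ih; last first.
      rewrite big1// => g _; rewrite big1 ?mulr0// => i _.
      suff -> : p h = 0 by rewrite mulr0.
      by apply/eqP; apply: contraNT ih; exact: p_indep.
    under eq_bigr do rewrite mulr_sumr big_mkcond.
    rewrite exchange_big /=; apply: eq_bigr => i _.
    rewrite (bigD1 (toggle e h i)) ?indep_toggle//= eqxx big1 ?addr0; last first.
      by move=> g /andP[_ gt]; rewrite eq_sym (negbTE gt).
    by rewrite pE// /c; ring.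
  apply: eq_bigr => g ig; rewrite mulr_sumr; apply: eq_bigr => i _.
  by rewrite pE// /c; ring.
have S2 : S = \sum_(g | indep g) \sum_i c g i * u (toggle e g i) * (u g - u (toggle e g i)).
  rewrite /S exchange_big [RHS]exchange_big /=; apply: eq_bigr => i _.
  rewrite -(sum_toggle (fun g => c g i * u g * (u (toggle e g i) - u g)) i).
  apply: eq_bigr => g ig.
  by rewrite toggleK// {1}/c gibbs_toggle.
have SS : S + S = - form.
  rewrite {2}S2 /S -big_split /form -sumrN; apply: eq_bigr => g _ /=.
  rewrite -big_split -sumrN; apply: eq_bigr => i _ /=; ring.
by rewrite -SS; lra.
Qed.

Let form_le : form <= 2 * D / pmin.
Proof.
have : (- form) / 2 >= - (D / pmin); last by lra.
rewrite -form_balance.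
apply: (@le_trans _ _ (\sum_(g | indep g) - (u g * D))).
  rewrite sumrN lerN2 -mulr_suml mulrC ler_wpM2l//.
apply: ler_sum => g ig; rewrite -mulrN ler_wpM2l//.
by have := balance g; rewrite ler_norml => /andP[].
Qed.

(** A single term of the form is at least [cmin] times the squared jump of [u], and the whole form
    is at most 2 D / pmin; this is where the condition on [eta] comes from. *)
Let step_le g i : indep g -> `|u (toggle e g i) - u g| <= eta.
Proof.
move=> ig; rewrite -(@ler_pXn2r _ 2)// ?nnegrE//.
rewrite real_normK ?num_real//.
have c0 h j : indep h -> 0 <= c h j * (u (toggle e h j) - u h) ^+ 2.
  by move=> ih; rewrite mulr_ge0 ?sqr_ge0// (le_trans (ltW cmin_gt0))// gibbs_cmin.
have h1 : cmin * (u (toggle e g i) - u g) ^+ 2 <= form.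
  apply: (@le_trans _ _ (c g i * (u (toggle e g i) - u g) ^+ 2)).
    by rewrite ler_wpM2r ?sqr_ge0// gibbs_cmin.
  rewrite /form (bigD1 g)//= (bigD1 i)//= -addrA lerDl addr_ge0//.
    by rewrite sumr_ge0// => j _; exact: c0.
  by rewrite sumr_ge0// => h /andP[ih _]; rewrite sumr_ge0// => j _; exact: c0.
rewrite -(ler_pM2l cmin_gt0) (le_trans h1)// (le_trans form_le)//.
rewrite ler_pdivrMr// (le_trans etaE)//.
by rewrite le_eqVlt; apply/orP; left; apply/eqP; ring.
Qed.

(** Transmitting nodes are switched off one at a time. This is never blocked, stays within
    independent sets and takes at most n steps. *)
Let chain_le g : indep g -> `|u g - u empty_config| <= n%:R * eta.
Proof.
move=> ig; apply: (@le_trans _ _ ((\sum_i (g i : nat))%N%:R * eta)); last first.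
  rewrite ler_wpM2r// ler_nat -[leqRHS]card_ord -sum1_card; apply: leq_sum => i _.
  by case: (g i).
have [k kE] : exists k, (\sum_i (g i : nat) = k)%N by eexists.
rewrite kE; elim: k g ig kE => [|k IH] g ig kE.
  suff -> : g = empty_config by rewrite subrr normr0 mul0r.
  apply/ffunP => i; rewrite ffunE; apply/negbTE/negP => gi.
  by move: kE; rewrite (bigD1 i)//= gi.
have [i gi] : exists i, g i.
  apply/existsP; apply: contraT => /existsPn h.
  by move: kE; rewrite big1// => i _; rewrite (negbTE (h i)).
have tE : toggle e g i = [ffun j => if j == i then false else g j].
  by rewrite /toggle /may_toggle gi.
have kE' : (\sum_j (toggle e g i j : nat) = k)%N.
  move: kE; rewrite (bigD1 i)//= gi add1n => -[<-].
  rewrite (bigD1 i)//= tE ffunE eqxx add0n; apply: eq_bigr => j /negbTE ji.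
  by rewrite ffunE ji.
have := IH _ (indep_toggle i ig) kE'; have := step_le i ig.
rewrite -natr1 mulrDl mul1r => h1 h2.
have -> : u g - u empty_config = (u g - u (toggle e g i)) + (u (toggle e g i) - u empty_config) by ring.
by rewrite (le_trans (ler_normD _ _))// addrC lerD// distrC.
Qed.

(** The Gibbs average of [u] is the total mass 1 of [p], and all values of [u] are close to the one
    at the empty configuration. *)
Let u_near_one g : indep g -> `|u g - 1| <= 2 * n%:R * eta.
Proof.
move=> ig; have h : `|1 - u empty_config| <= n%:R * eta.
  have -> : 1 - u empty_config = \sum_(g' | indep g') gibbs r g' * (u g' - u empty_config).
    rewrite (eq_bigr (fun g' => p g' - gibbs r g' * u empty_config)).
      by rewrite sumrB p_sum_indep -mulr_suml sum_gibbs_indep mul1r.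
    by move=> g' ig'; rewrite mulrBr -pE.
  apply: (@le_trans _ _ (\sum_(g' | indep g') gibbs r g' * (n%:R * eta))); last first.
    by rewrite -mulr_suml sum_gibbs_indep mul1r.
  rewrite (le_trans (ler_norm_sum _ _ _))//; apply: ler_sum => g' ig'.
  by rewrite normrM ger0_norm ?gibbs_ge0// ler_wpM2l ?gibbs_ge0// chain_le.
have := chain_le ig => h'.
have -> : u g - 1 = (u g - u empty_config) - (1 - u empty_config) by ring.
by rewrite (le_trans (ler_normB _ _))// -mulrA mulr_natl mulr2n lerD.
Qed.

Lemma dirichlet_service i :
  `|\sum_(g : config) (g i)%:R * p g - mean_service r i| <= 2 * n%:R * eta.
Proof.
rewrite /mean_service -sumrB (le_trans (ler_norm_sum _ _ _))//.
apply: (@le_trans _ _ (\sum_g gibbs r g * (2 * n%:R * eta))); last first.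
  by rewrite -mulr_suml sum_gibbs mul1r.
apply: ler_sum => g _; rewrite -mulrBr normrM.
case: (boolP (indep g)) => ig; last first.
  rewrite gibbs_nindep// mul0r subr0.
  suff -> : p g = 0 by rewrite normr0 mulr0.
  by apply/eqP; apply: contraNT ig; exact: p_indep.
rewrite pE// -[X in _ - X]mulr1 -mulrBr normrM (ger0_norm (gibbs_ge0 _ _)).
apply: (@le_trans _ _ (1 * (gibbs r g * `|u g - 1|))).
  apply: ler_wpM2r; first by rewrite mulr_ge0 ?gibbs_ge0.
  by case: (g i); rewrite ?normr1 ?normr0 ?ler01.
by rewrite mul1r ler_wpM2l ?gibbs_ge0// u_near_one.
Qed.

End Dirichlet.

Section Bounds.
Variables (r : 'I_n -> R) (b : R).
Hypothesis rb : forall i, `|r i| <= b.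
Hypothesis b_ge0 : 0 <= b.

Let energy_bound g : `|energy r g| <= n%:R * b.
Proof.
rewrite (le_trans (ler_norm_sum _ _ _))//.
apply: (@le_trans _ _ (\sum_(i < n) b)); last by rewrite sumr_const card_ord mulr_natl.
apply: ler_sum => i _; rewrite normrM; case: (g i); rewrite ?normr1 ?normr0 ?mul1r ?mul0r//.
Qed.

Lemma partition_le : partition r <= num_configs * expR (n%:R * b).
Proof.
rewrite /partition (le_trans (ler_sum _ (_ : forall g, true -> weight r g <= expR (n%:R * b))))//.
  move=> g _; rewrite /weight; case: ifP => _; last exact: expR_ge0.
  by rewrite ler_expR; have := energy_bound g; rewrite ler_norml => /andP[].
by rewrite /num_configs mulr_suml; apply: ler_sum => g _; rewrite mul1r.
Qed.

Let pmin : R := expR (- (2 * n%:R * b)) / num_configs.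

Let N_gt0 : 0 < num_configs.
Proof. by rewrite /num_configs (bigD1 empty_config)//= ltr_pwDl// sumr_ge0. Qed.

Let gibbs_pmin g : indep g -> pmin <= gibbs r g.
Proof.
move=> ig; rewrite /gibbs /weight ig ler_pdivlMr ?partition_gt0//.
apply: (@le_trans _ _ (pmin * (num_configs * expR (n%:R * b)))).
  by rewrite ler_wpM2l ?partition_le// divr_ge0 ?expR_ge0// ltW.
rewrite mulrA /pmin divfK ?gt_eqF// -expRD ler_expR.
have := energy_bound g; rewrite ler_norml => /andP[h _].
by apply: le_trans h; lra.
Qed.

(** A Gibbs weight is at least exp(- 2 n b) / N and a rate at least exp(- b), which gives [pmin] and
    [cmin]. The exponent 2 n + 1 in [eta] is rounded up: the required inequality then holds with a
    factor exp(b) to spare. *)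
Lemma service_error (p : config -> R) (D : R) i :
  (forall g, 0 <= p g) -> (forall g, p g != 0 -> indep g) -> \sum_g p g = 1 ->
  (forall g, `|\sum_h \sum_(i | toggle e h i == g) toggle_rate r h i * p h -
    \sum_i toggle_rate r g i * p g| <= D) ->
  `|\sum_(g : config) (g i)%:R * p g - mean_service r i| <=
     2 * n%:R * (Num.sqrt (2 * D) * num_configs * expR ((2 * n%:R + 1) * b)).
Proof.
move=> p0 pI p1 bal; have D0 : 0 <= D by exact: le_trans (bal empty_config).
have pmin0 : 0 < pmin by rewrite divr_gt0 ?expR_gt0.
apply: (@dirichlet_service r p D pmin (pmin * expR (- b))) => //.
- by rewrite mulr_gt0 ?expR_gt0.
- move=> g j ig; apply: ler_pM; rewrite ?expR_ge0 ?gibbs_pmin//; first exact: ltW.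
  rewrite /toggle_rate; case: ifP => _; first by rewrite -[leRHS]expR0 ler_expR oppr_le0.
  by rewrite ler_expR; have := rb j; rewrite ler_norml => /andP[].
- by rewrite !mulr_ge0 ?sqrtr_ge0 ?expR_ge0// ltW.
rewrite /pmin !exprMn sqr_sqrtr ?mulr_ge0//.
set N := num_configs.
have -> : 2 * D * N ^+ 2 * expR ((2 * n%:R + 1) * b) ^+ 2 *
    (expR (- (2 * n%:R * b)) / N * (expR (- (2 * n%:R * b)) / N * expR (- b))) =
   2 * D * (expR ((2 * n%:R + 1) * b) ^+ 2 * expR (- (2 * n%:R * b)) * expR (- (2 * n%:R * b)) * expR (- b)).
  by field; rewrite gt_eqF.
rewrite -[leLHS]mulr1; apply: ler_wpM2l; first exact: mulr_ge0.
apply: (@le_trans _ _ (expR 0)); first by rewrite expR0.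
by rewrite expr2 -!expRD ler_expR [leRHS](_ : _ = b)//; ring.
Qed.

End Bounds.

End Gibbs.

(** * Dual ascent *)

Section SlowVariation.
Context (R : realType).
Local Notation h j := ((j.+1)%:R^-1 : R).

Lemma sum_inv_square_le N : \sum_(j < N) h j ^+ 2 <= 2 :> R.
Proof.
have H M : \sum_(j < M.+1) h j ^+ 2 <= 2 - (M.+1%:R)^-1 :> R.
  elim: M => [|M IH]; first by rewrite big_ord1 invr1 expr1n; lra.
  rewrite big_ord_recr /=; apply: le_trans (lerD IH (lexx _)) _.
  have a0 : (0 : R) < M.+1%:R by rewrite ltr0n.
  have E : M.+2%:R = M.+1%:R + 1 :> R by rewrite natr1.
  rewrite E; move: a0; move: (M.+1%:R : R) => x x0.
  rewrite -subr_ge0 (_ : _ - _ = (x * (x + 1) ^+ 2)^-1).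
    by rewrite invr_ge0 mulr_ge0 ?exprn_ge0// ?addr_ge0// ltW.
  by field; apply/andP; split; lra.
case: N => [|N]; first by rewrite big_ord0.
by apply: le_trans (H N) _; rewrite gerBl invr_ge0.
Qed.

Lemma harmonic_unbounded (C : R) : exists N, C < \sum_(j < N) h j.
Proof.
apply: contrapT => /forallNP H.
apply: (@dvg_harmonic R); apply: nondecreasing_is_cvgn.
  by apply: nondecreasing_series => k _ _; rewrite /harmonic/=.
exists C => _ [N _ <-]; rewrite /series /= big_mkord leNgt; apply/negP; exact: H.
Qed.

(** The increments of G are O(1/j), which is not summable, but those of G^2 carry an extra factor G
    and are dominated by the summable terms [a j]. Hence G^2 plus the partial sums of [a] is
    nondecreasing and bounded, G^2 converges, and a positive limit would contradict the divergence
    of the harmonic series. *)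
Lemma slow_variation_cvg0 (G : nat -> R) (M C C' : R) :
  (forall j, 0 <= G j <= M) -> (forall j, `|G j.+1 - G j| <= C * h j) ->
  (forall N, \sum_(j < N) h j * G j <= C') -> G @ \oo --> 0.
Proof.
move=> GM GC GS.
have h0 j : 0 < h j by rewrite invr_gt0.
have C0 : 0 <= C by have := le_trans (normr_ge0 _) (GC 0%N); rewrite invr1 mulr1.
pose a j : R := C * h j * (2 * G j + C * h j).
have a0 j : 0 <= a j.
  have /andP[g0 _] := GM j; have := ltW (h0 j) => hh.
  by rewrite !mulr_ge0// addr_ge0// mulr_ge0.
pose S N : R := \sum_(j < N) a j.
have SS N : S N.+1 = S N + a N by rewrite /S big_ord_recr.
pose B : R := 2 * C * C' + C ^+ 2 * 2.
have SB N : S N <= B.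
  rewrite /S (eq_bigr (fun j : 'I_N => 2 * C * (h j * G j) + C ^+ 2 * h j ^+ 2)); last first.
    by move=> j _; rewrite /a; ring.
  rewrite big_split /= -!mulr_sumr lerD// ler_wpM2l ?mulr_ge0// ?exprn_ge0//; first exact: GS.
  exact: sum_inv_square_le.
have cS : cvgn S.
  apply: nondecreasing_is_cvgn.
    by apply/nondecreasing_seqP => N; rewrite SS lerDl.
  by exists B => _ [N _ <-].
have M0 : 0 <= M by have /andP[x y] := GM 0%N; exact: le_trans y.
pose W N := G N ^+ 2 + S N.
have cW : cvgn W.
  apply: nondecreasing_is_cvgn.
    apply/nondecreasing_seqP => N; rewrite /W SS.
    have := GC N; rewrite ler_norml => /andP[g1 g2].
    have /andP[g3 _] := GM N; have /andP[g4 _] := GM N.+1.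
    suff : `|G N.+1 ^+ 2 - G N ^+ 2| <= a N by rewrite ler_norml => /andP[x y]; lra.
    rewrite subr_sqr normrM /a ler_pM//.
    by rewrite ger0_norm ?addr_ge0//; move: g1 g2; move: (C / _) => z; lra.
  exists (M ^+ 2 + B) => _ [N _ <-]; rewrite /W lerD// lerXn2r ?nnegrE//.
    by case/andP: (GM N).
    by case/andP: (GM N).
have cG2 : cvgn (fun N => G N ^+ 2).
  have -> : (fun N => G N ^+ 2) = W - S by apply/funext => N; rewrite /W /= !fctE; lra.
  exact: is_cvgB.
have [l Gl] : exists l : R, (fun N => G N ^+ 2) @ \oo --> l by exists (limn (fun N => G N ^+ 2)).
have l0 : 0 <= l.
  rewrite -(cvg_lim (@Rhausdorff R) Gl); apply: limr_ge => //.
  by near=> N; exact: sqr_ge0.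
have [l00|lpos] := eqVneq l 0; last first.
  have {lpos}l1 : 0 < l by rewrite lt_def lpos.
  have /cvgrPdist_lt /(_ (l / 2)) := Gl.
  have l2 : 0 < l / 2 by lra.
  move=> /(_ l2) [N0 _ HN0].
  pose c := Num.sqrt (l / 2).
  have c0 : 0 < c by rewrite sqrtr_gt0.
  have Gc j : (N0 <= j)%N -> c <= G j.
    move=> Nj; have /andP[g0 _] := GM j.
    rewrite -(@ler_pXn2r _ 2)// ?nnegrE ?sqrtr_ge0// sqr_sqrtr; last exact: ltW.
    have := HN0 j Nj; rewrite /= ltr_norml => /andP[x y]; lra.
  have [N HN] := harmonic_unbounded ((C' + N0%:R * c) / c).
  have := GS N => GSN; exfalso; move: HN; apply/negP; rewrite -leNgt ler_pdivlMr//.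
  rewrite -lerBlDr; apply: le_trans GSN.
  rewrite mulr_suml lerBlDr -(big_mkord xpredT (fun j => h j * c)) -(big_mkord xpredT (fun j => h j * G j)).
  apply: (@le_trans _ _ (\sum_(0 <= j < N) (h j * G j + (j < N0)%:R * c))).
    apply: ler_sum => j _; have /andP[g0 _] := GM j; case: ltnP => jN.
      rewrite mul1r ler_wpDl// ?mulr_ge0// ?(ltW (h0 _))//.
      by rewrite ler_piMl ?(ltW c0)// invf_le1// ler1n.
    by rewrite mul0r addr0 ler_wpM2l ?(ltW (h0 _))// Gc.
  rewrite big_split /= lerD2l -mulr_suml ler_wpM2r ?(ltW c0)//.
  rewrite -natr_sum ler_nat big_mkord.
  have [NN|NN] := leqP N N0.
    by apply: leq_trans NN; rewrite -[leqRHS]card_ord -sum1_card leq_sum// => j _; case: (_ < _)%N.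
  rewrite -(subnKC (ltnW NN)) big_split_ord /= [X in (_ + X)%N]big1 ?addn0.
    by rewrite -[leqRHS]card_ord -sum1_card leq_sum// => j _; case: (_ < _)%N.
  by move=> j _; rewrite ltnNge leq_addr.
rewrite {}l00 in Gl; apply/cvgrPdist_lt => eps eps0.
have /cvgrPdist_lt /(_ (eps ^+ 2)) := Gl.
move=> /(_ (exprn_gt0 2 eps0)); apply: filterS => N.
rewrite !sub0r !normrN normrX => H.
by rewrite -(@ltr_pXn2r _ 2)// ?nnegrE// ltW.
Unshelve. all: by end_near.
Qed.

End SlowVariation.

Section DualAscent.
Context (R : realType) (n : nat) (e : rel 'I_n).
Local Notation config := {ffun 'I_n -> bool}.
Implicit Types (g : config) (i : 'I_n) (r d : 'I_n -> R).

(** From exp(-x) >= 1 - x by inversion; negative x of any size are allowed. *)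
Lemma expR_le_quadratic (x : R) : x <= 2^-1 -> expR x <= 1 + x + 2 * x ^+ 2.
Proof.
move=> x2; have h1 : 1 - x <= expR (- x) by rewrite expR_ge1Dx.
have h2 : 0 < 1 - x by lra.
apply: (@le_trans _ _ (1 - x)^-1).
  by rewrite -[x in leLHS]opprK expRN lef_pV2 ?posrE ?expR_gt0.
rewrite -[leLHS]mul1r ler_pdivrMr// -subr_ge0.
have -> : (1 + x + 2 * x ^+ 2) * (1 - x) - 1 = x ^+ 2 * (1 - 2 * x) by ring.
by rewrite mulr_ge0 ?sqr_ge0//; lra.
Qed.

Definition shift r d : 'I_n -> R := fun i => r i + d i.
Definition size1 d : R := \sum_i `|d i|.

Lemma energy_shift r d g : energy (shift r d) g = energy r g + energy d g.
Proof. by rewrite /energy -big_split /=; apply: eq_bigr => i _; rewrite mulrDr. Qed.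

Lemma energy_le_size1 d g : `|energy d g| <= size1 d.
Proof.
rewrite (le_trans (ler_norm_sum _ _ _))//; apply: ler_sum => i _; rewrite normrM.
by case: (g i); rewrite ?normr1 ?normr0 ?mul1r ?mul0r.
Qed.

(** The ratio Z(r + d) / Z(r), written as an exponential moment. All comparisons between the Gibbs
    measures at r and r + d go through it, in place of derivatives in several variables. *)
Definition tilt r d : R := \sum_(g : config) gibbs e r g * expR (energy d g).

Lemma partition_shift r d : partition e (shift r d) = partition e r * tilt r d.
Proof.
rewrite /tilt mulr_sumr; apply: eq_bigr => g _.
rewrite mulrA /gibbs mulrCA divff ?mulr1 ?gt_eqF ?partition_gt0//.
by rewrite /weight; case: ifP => _; rewrite ?mul0r// energy_shift expRD.
Qed.

Lemma gibbs_shift r d g : gibbs e (shift r d) g = gibbs e r g * (expR (energy d g) / tilt r d).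
Proof.
rewrite /gibbs partition_shift /weight energy_shift expRD invfM.
by case: ifP => _; ring.
Qed.

Lemma tilt_le r d : tilt r d <= expR (size1 d).
Proof.
rewrite /tilt; apply: (@le_trans _ _ (\sum_g gibbs e r g * expR (size1 d))).
  apply: ler_sum => g _; apply: ler_wpM2l; first exact: gibbs_ge0.
  by rewrite ler_expR; have := energy_le_size1 d g; rewrite ler_norml => /andP[].
by rewrite -mulr_suml sum_gibbs mul1r.
Qed.

Lemma tilt_ge r d : expR (- size1 d) <= tilt r d.
Proof.
rewrite /tilt; apply: (@le_trans _ _ (\sum_g gibbs e r g * expR (- size1 d))).
  by rewrite -mulr_suml sum_gibbs mul1r.
apply: ler_sum => g _; apply: ler_wpM2l; first exact: gibbs_ge0.
by rewrite ler_expR; have := energy_le_size1 d g; rewrite ler_norml => /andP[].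
Qed.

Lemma tilt_gt0 r d : 0 < tilt r d.
Proof. exact: lt_le_trans (expR_gt0 _) (tilt_ge r d). Qed.

Lemma ln_tilt_le r d : ln (tilt r d) <= size1 d.
Proof. by rewrite -(expRK (size1 d)) ler_ln ?posrE ?tilt_gt0 ?expR_gt0// tilt_le. Qed.

Lemma sum_gibbs_energy r d :
  \sum_g gibbs e r g * energy d g = \sum_i mean_service e r i * d i.
Proof.
under eq_bigr do rewrite /energy mulr_sumr.
rewrite exchange_big /=; apply: eq_bigr => i _; rewrite /mean_service mulr_suml.
by apply: eq_bigr => g _; ring.
Qed.

(** The second-order upper bound of ln Z around r: the linear term is the gradient, that is the mean
    service. It follows from ln t <= t - 1 and the quadratic bound on the exponential. *)
Lemma ln_tilt_le_quadratic r d : size1 d <= 2^-1 ->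
  ln (tilt r d) <= \sum_i mean_service e r i * d i + 2 * size1 d ^+ 2.
Proof.
move=> d2; apply: (@le_trans _ _ (tilt r d - 1)).
  rewrite -(expRK (tilt r d - 1)) ler_ln ?posrE ?tilt_gt0 ?expR_gt0//.
  by have := expR_ge1Dx (tilt r d - 1); rewrite subrKC.
rewrite lerBlDr /tilt.
apply: (@le_trans _ _ (\sum_g gibbs e r g * (1 + energy d g + 2 * size1 d ^+ 2))).
  apply: ler_sum => g _; apply: ler_wpM2l; first exact: gibbs_ge0.
  have ed := energy_le_size1 d g.
  apply: (le_trans (expR_le_quadratic _)).
    by move: ed; rewrite ler_norml => /andP[_ h]; exact: le_trans h d2.
  rewrite lerD2l ler_wpM2l// -real_normK ?num_real// lerXn2r ?nnegrE//.
  exact: le_trans ed.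
under eq_bigr do rewrite !mulrDr mulr1.
rewrite !big_split /= sum_gibbs sum_gibbs_energy -mulr_suml sum_gibbs; lra.
Qed.

Lemma mean_service_ge0 r i : 0 <= mean_service e r i.
Proof. by rewrite sumr_ge0// => g _; rewrite mulr_ge0// gibbs_ge0. Qed.

Lemma mean_service_le1 r i : mean_service e r i <= 1.
Proof.
rewrite -[leRHS](sum_gibbs e r); apply: ler_sum => g _.
by case: (g i); rewrite ?mul1r ?mul0r// gibbs_ge0.
Qed.

(** The density of the shifted Gibbs measure with respect to the original one lies between exp(- 2
    |d|) and exp(2 |d|), with |d| the size of the shift, hence within 4 |d| of 1. *)
Lemma mean_service_lipschitz r d i : size1 d <= 4^-1 ->
  `|mean_service e (shift r d) i - mean_service e r i| <= 4 * size1 d.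
Proof.
move=> d4; have d0 : 0 <= size1 d by rewrite sumr_ge0.
rewrite /mean_service -sumrB (le_trans (ler_norm_sum _ _ _))//.
apply: (@le_trans _ _ (\sum_g gibbs e r g * (4 * size1 d))); last first.
  by rewrite -mulr_suml sum_gibbs mul1r.
apply: ler_sum => g _; rewrite -mulrBr normrM.
have -> : gibbs e (shift r d) g - gibbs e r g =
   gibbs e r g * (expR (energy d g) / tilt r d - 1) by rewrite gibbs_shift; ring.
rewrite normrM (ger0_norm (gibbs_ge0 e r g)).
apply: (@le_trans _ _ (gibbs e r g * `|expR (energy d g) / tilt r d - 1|)).
  have h := mulr_ge0 (gibbs_ge0 e r g) (normr_ge0 (expR (energy d g) / tilt r d - 1)).
  by case: (g i); rewrite ?normr1 ?normr0 ?mul1r ?mul0r.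
apply: ler_wpM2l; first exact: gibbs_ge0.
have := energy_le_size1 d g; rewrite ler_norml => /andP[e1 e2].
have t0 := tilt_gt0 r d; have t1 := tilt_le r d; have t2 := tilt_ge r d.
rewrite ler_norml lerBlDr lerBrDr; apply/andP; split.
  rewrite ler_pdivlMr//; apply: (@le_trans _ _ (expR (- (2 * size1 d)) * expR (size1 d))); last first.
    rewrite -expRD; apply: le_trans (_ : expR (- size1 d) <= _); last by rewrite ler_expR.
    by rewrite ler_expR; lra.
  have h := expR_ge1Dx (- (2 * size1 d)).
  by rewrite ler_pM ?(ltW t0)//; lra.
rewrite ler_pdivrMr//; apply: (@le_trans _ _ (expR (2 * size1 d) * expR (- size1 d))).
  by rewrite -expRD ler_expR; lra.
have h : expR (2 * size1 d) <= 1 + 2 * size1 d + 2 * (2 * size1 d) ^+ 2.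
  by apply: expR_le_quadratic; lra.
have h' : expR (2 * size1 d) <= 4 * size1 d + 1.
  apply: le_trans h _; rewrite -subr_ge0.
  have -> : 4 * size1 d + 1 - (1 + 2 * size1 d + 2 * (2 * size1 d) ^+ 2) =
    2 * size1 d * (1 - 4 * size1 d) by ring.
  by rewrite mulr_ge0//; lra.
by rewrite ler_pM ?expR_ge0.
Qed.

Section Objective.
Context (lam : 'I_n -> R).
Hypothesis lam_capacity : capacity_region e lam.

Definition objective r : R := \sum_i lam i * r i - ln (partition e r).

Lemma capacity_bounds i : 0 <= lam i <= 1.
Proof.
have [lam0 [gam [p [p0 _ p1 pE]] lg]] := lam_capacity.
rewrite lam0 /=; apply: le_trans (ltW (lg i)) _; rewrite pE.
apply: (@le_trans _ _ (\sum_g p g)); last by rewrite p1.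
by apply: ler_sum => g _; case: (g i); rewrite ?mulr1 ?mulr0.
Qed.

(** Replacing r by its positive part and [lam] by a convex combination of independent sets only
    increases the linear term. On an independent set g, the energy of the positive part is the
    energy of r on the subset of g where r is positive, again independent, so its exponential is one
    of the terms of Z(r). *)
Lemma objective_le0 r : objective r <= 0.
Proof.
have [lam0 [gam [p [p0 pI p1 pE]] lg]] := lam_capacity.
rewrite subr_le0.
pose rp i := Num.max (r i) 0.
have rp0 i : 0 <= rp i by rewrite le_max lexx orbT.
apply: (@le_trans _ _ (\sum_i gam i * rp i)).
  apply: ler_sum => i _; apply: (@le_trans _ _ (lam i * rp i)).
    by apply: ler_wpM2l => //; rewrite le_max lexx.
  by apply: ler_wpM2r => //; exact: ltW.
have -> : \sum_i gam i * rp i = \sum_(g : config) p g * energy rp g.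
  under eq_bigr do rewrite pE mulr_suml.
  rewrite exchange_big /=; apply: eq_bigr => g _; rewrite /energy mulr_sumr.
  by apply: eq_bigr => i _; rewrite mulrA.
apply: (@le_trans _ _ (\sum_g p g * ln (partition e r))); last by rewrite -mulr_suml p1 mul1r.
apply: ler_sum => g _; have [->|pg] := eqVneq (p g) 0; first by rewrite !mul0r.
apply: ler_wpM2l => //.
have ig : indep e g by apply/indepP; exact: pI.
pose g' : config := [ffun i => g i && (0 < r i)].
have ig' : indep e g'.
  apply/forallP => i; apply/forallP => j; apply/implyP => eij; rewrite !ffunE.
  have /forallP/(_ i)/forallP/(_ j) := ig; rewrite eij /=.
  by apply: contra => /andP[/andP[-> _] /andP[-> _]].
have -> : energy rp g = energy r g'.
  apply: eq_bigr => i _; rewrite ffunE /rp.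
  by case: (g i); rewrite /= ?mul0r//; case: ltP => ri; rewrite ?mulr0 ?mul0r.
rewrite -(expRK (energy r g')) ler_ln ?posrE ?expR_gt0 ?partition_gt0//.
by have := weight_le_partition e r g'; rewrite /weight ig'.
Qed.

Section Iteration.
Local Notation h j := ((j.+1)%:R^-1 : R).
Context (rr x : nat -> 'I_n -> R) (B C : R).
Hypothesis B_ge0 : 0 <= B.
Hypothesis rrE : forall j i, rr j.+1 i = rr j i + h j * x j i.
Hypothesis xB : forall j i, `|x j i| <= B.
Hypothesis errC : forall N, \sum_(j < N) h j *
  (\sum_i (x j i - (lam i - mean_service e (rr j) i)) ^+ 2) <= C.

Let h_gt0 j : 0 < h j. Proof. by rewrite invr_gt0. Qed.

Let gap j i := lam i - mean_service e (rr j) i.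

Let gap_le1 j i : `|gap j i| <= 1.
Proof.
have /andP[a b] := capacity_bounds i.
have c := mean_service_ge0 (rr j) i; have d := mean_service_le1 (rr j) i.
by rewrite ler_norml /gap; apply/andP; split; lra.
Qed.

Let step j i := h j * x j i.

Let step_size j : size1 (step j) <= n%:R * B * h j.
Proof.
apply: (@le_trans _ _ (\sum_(i < n) B * h j)).
  apply: ler_sum => i _; rewrite normrM (ger0_norm (ltW (h_gt0 j))) mulrC.
  by apply: ler_wpM2r; [exact: ltW|exact: xB].
by rewrite sumr_const card_ord mulr_natl mulrnAl.
Qed.

Let rr_shift j : rr j.+1 = shift (rr j) (step j).
Proof. by apply/funext => i; rewrite rrE. Qed.

(** Small steps use the second-order bound. For y > 1/2 the three linear terms, each at most y in
    absolute value, are absorbed by 6 y^2 >= 3 y, whence the constant 6; the finitely many large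
    early steps need no separate treatment. *)
Let ascent j : objective (rr j) + (h j * (\sum_i gap j i * x j i) - 6 * (n%:R * B * h j) ^+ 2)
  <= objective (rr j.+1).
Proof.
have hj := h_gt0 j.
have -> : objective (rr j.+1) = objective (rr j) + \sum_i lam i * step j i - ln (tilt (rr j) (step j)).
  rewrite /objective rr_shift partition_shift lnM ?posrE ?partition_gt0 ?tilt_gt0//.
  rewrite /shift; under eq_bigr do rewrite mulrDr.
  by rewrite big_split /=; ring.
have sz := step_size j; set y := n%:R * B * h j in sz *.
have sz0 : 0 <= size1 (step j) by rewrite sumr_ge0.
have y2 : size1 (step j) ^+ 2 <= y ^+ 2 by rewrite lerXn2r ?nnegrE ?(le_trans sz0).
have y20 := sqr_ge0 y.
have [ysmall|ybig] := leP y 2^-1.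
  have := @ln_tilt_le_quadratic (rr j) (step j) (le_trans sz ysmall).
  have -> : h j * (\sum_i gap j i * x j i) =
      \sum_i lam i * step j i - \sum_i mean_service e (rr j) i * step j i.
    by rewrite -sumrB mulr_sumr; apply: eq_bigr => i _; rewrite /gap /step; ring.
  move: y2 y20; move: (_ ^+ 2) (_ ^+ 2) => u v; lra.
have h1 := ln_tilt_le (rr j) (step j).
have h2 : - y <= \sum_i lam i * step j i.
  apply: (@le_trans _ _ (- size1 (step j))); first by rewrite lerN2.
  rewrite /size1 -sumrN; apply: ler_sum => i _; have /andP[l0 l1] := capacity_bounds i.
  have := ler_piMl (normr_ge0 (step j i)) l1 => l2.
  have := ler_norm (- (lam i * step j i)); rewrite normrN normrM (ger0_norm l0); lra.
have h3 : h j * (\sum_i gap j i * x j i) <= y.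
  rewrite mulr_sumr; apply: le_trans sz; apply: ler_sum => i _.
  have -> : h j * (gap j i * x j i) = gap j i * step j i by rewrite /step; ring.
  apply: le_trans (ler_norm _) _; rewrite normrM.
  by rewrite ler_piMl// gap_le1.
have h4 : 3 * y <= 6 * y ^+ 2.
  have -> : 6 * y ^+ 2 = 3 * (2 * y) * y by ring.
  by apply: ler_wpM2r; lra.
move: h1 h2 h3 h4 sz; clearbody y.
move: (ln _) (\sum_i _ * step j i) (h j * _) (y ^+ 2) => u1 u2 u3 u4; lra.
Qed.

Let gap_sum N : \sum_(j < N) h j * (\sum_i gap j i ^+ 2) <=
  2 * (- objective (rr 0%N) + 12 * (n%:R * B) ^+ 2) + C.
Proof.
have key : \sum_(j < N) (h j * (\sum_i gap j i * x j i) - 6 * (n%:R * B * h j) ^+ 2) <=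
    objective (rr N) - objective (rr 0%N).
  elim: N => [|N IH]; first by rewrite big_ord0 subrr.
  have aux (a1 b1 c1 d1 e1 : R) : a1 <= b1 - c1 -> b1 + d1 <= e1 -> a1 + d1 <= e1 - c1 by lra.
  by rewrite big_ord_recr /=; exact: (aux _ _ _ _ _ IH (ascent N)).
have sq : \sum_(j < N) 6 * (n%:R * B * h j) ^+ 2 <= 12 * (n%:R * B) ^+ 2.
  rewrite (eq_bigr (fun j : 'I_N => 6 * (n%:R * B) ^+ 2 * h j ^+ 2)); last by move=> j _; ring.
  rewrite -mulr_sumr; have := @sum_inv_square_le R N.
  have -> : 12 * (n%:R * B) ^+ 2 = 6 * (n%:R * B) ^+ 2 * 2 by ring.
  by move=> H; apply: ler_wpM2l => //; rewrite mulr_ge0 ?sqr_ge0.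
(* Termwise, 2 gap x + (x - gap)^2 - gap^2 = x^2 >= 0, so the error enters only through its
   square. *)
have cross : \sum_(j < N) h j * (\sum_i gap j i ^+ 2) <=
   \sum_(j < N) (2 * (h j * (\sum_i gap j i * x j i)) + h j * (\sum_i (x j i - gap j i) ^+ 2)).
  apply: ler_sum => j _; rewrite mulrCA -mulrDr; apply: ler_wpM2l; first exact: ltW.
  rewrite mulr_sumr -big_split /=; apply: ler_sum => i _.
  by rewrite -subr_ge0 (_ : _ - _ = x j i ^+ 2) ?sqr_ge0//; ring.
have obj := objective_le0 (rr N).
have := errC N; rewrite -/gap => errN.
apply: le_trans cross _; rewrite big_split /= -mulr_sumr.
move: key; rewrite sumrB => key; lra.
Qed.

Let gap_slow j : `|\sum_i gap j.+1 i ^+ 2 - \sum_i gap j i ^+ 2| <= 8 * n%:R ^+ 2 * B * h j.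
Proof.
have hj := h_gt0 j.
rewrite -sumrB (le_trans (ler_norm_sum _ _ _))//.
set y := n%:R * B * h j.
have y0 : 0 <= y by rewrite !mulr_ge0// ltW.
have -> : 8 * n%:R ^+ 2 * B * h j = \sum_(i < n) 8 * y.
  by rewrite sumr_const card_ord -mulr_natl /y; ring.
apply: ler_sum => i _; have g1 := gap_le1 j i; have g2 := gap_le1 j.+1 i.
have [ysmall|ybig] := leP y 4^-1.
  rewrite subr_sqr normrM.
  have -> : 8 * y = (4 * y) * 2 by ring.
  apply: ler_pM => //.
    have sz := step_size j.
    have := @mean_service_lipschitz (rr j) (step j) i (le_trans sz ysmall).
    rewrite -rr_shift => H.
    have -> : gap j.+1 i - gap j i = - (mean_service e (rr j.+1) i - mean_service e (rr j) i).
      by rewrite /gap; ring.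
    by rewrite normrN (le_trans H)// ler_wpM2l.
  by rewrite (le_trans (ler_normD _ _))//; lra.
apply: (@le_trans _ _ (1 + 1)); last by lra.
by rewrite (le_trans (ler_normB _ _))// lerD// normrX exprn_ile1.
Qed.

Lemma mean_service_cvg i : (fun j => mean_service e (rr j) i) @ \oo --> lam i.
Proof.
have G0 : (fun j => \sum_i gap j i ^+ 2) @ \oo --> 0.
  apply: (@slow_variation_cvg0 _ _ n%:R (8 * n%:R ^+ 2 * B)
    (2 * (- objective (rr 0%N) + 12 * (n%:R * B) ^+ 2) + C)) => [j|j|N]; last 2 first.
  - exact: gap_slow.
  - exact: gap_sum.
  rewrite sumr_ge0//=; last by move=> k _; exact: sqr_ge0.
  apply: (@le_trans _ _ (\sum_(k < n) 1)); last by rewrite sumr_const card_ord.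
  by apply: ler_sum => k _; rewrite -real_normK ?num_real// exprn_ile1// gap_le1.
apply/cvgrPdist_lt => eps eps0; have /cvgrPdist_lt/(_ _ (exprn_gt0 2 eps0)) := G0.
apply: filterS => j; rewrite sub0r normrN => H.
rewrite -(@ltr_pXn2r _ 2)// ?nnegrE ?(ltW eps0)// (le_lt_trans _ H)// -normrX.
rewrite ger0_norm ?sqr_ge0// ger0_norm; last by rewrite sumr_ge0// => k _; exact: sqr_ge0.
by rewrite [leRHS](bigD1 i)//= lerDl sumr_ge0// => k _; exact: sqr_ge0.
Qed.

End Iteration.

End Objective.

End DualAscent.

(** * Service over one window *)

Section Growth.
Context (R : realType) (T0 : R).
Hypothesis T0_gt0 : 0 < T0.

Lemma expR_ge_power (x : R) m : 0 <= x -> (x / m.+1%:R) ^+ m.+1 <= expR x.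
Proof.
move=> x0; have m0 : (0 : R) < m.+1%:R by rewrite ltr0n.
have -> : expR x = expR (x / m.+1%:R) ^+ m.+1.
  by rewrite -expRM_natl mulrC divfK// gt_eqF.
rewrite lerXn2r ?nnegrE ?expR_ge0 ?divr_ge0//.
by apply: le_trans (expR_ge1Dx _); rewrite lerDr.
Qed.

Lemma update_period_superpolynomial q : exists2 c : R, 0 < c &
  forall J, c * J.+1%:R ^+ q <= update_period T0 J.
Proof.
(* An even exponent removes the square root: exp(sqrt x) >= x^(q+1) / m^m. The power of 2 absorbs J
   + 2 <= 2 (J + 1), and the minimum with [T0] covers window 0, whose length is arbitrary. *)
pose m := (2 * q.+1)%N.
have m1 : m = m.-1.+1 by [].
pose c1 : R := (2 ^+ q.+1 * (m%:R) ^+ m)^-1.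
have m0 : (0 : R) < m%:R by rewrite ltr0n.
have c10 : 0 < c1 by rewrite invr_gt0 mulr_gt0// exprn_gt0.
exists (Num.min T0 c1); first by rewrite lt_min T0_gt0.
case=> [|J]; first by rewrite expr1n mulr1 ge_min lexx.
have J1 : (1 : R) <= J.+2%:R by rewrite ler1n.
apply: (@le_trans _ _ (c1 * J.+2%:R ^+ q.+1)).
  apply: ler_pM; rewrite ?exprn_ge0//; last by rewrite ler_weXn2l.
    by rewrite le_min !ltW.
  by rewrite ge_min lexx orbT.
rewrite /=; apply: le_trans (_ : (Num.sqrt J.+1%:R / m%:R) ^+ m <= _); last first.
  by rewrite m1; apply: expR_ge_power; exact: sqrtr_ge0.
rewrite expr_div_n {2}/m exprM sqr_sqrtr// /c1 invfM mulrAC ler_pM2r ?invr_gt0 ?exprn_gt0//.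
rewrite -exprVn -exprMn lerXn2r ?nnegrE ?mulr_ge0//.
rewrite mulrC ler_pdivrMr// -natrM ler_nat; lia.
Qed.

Lemma ln_increment_ge J : (3 * J.+1%:R)^-1 <= ln J.+3%:R - ln J.+2%:R :> R.
Proof.
have a0 : (0 : R) < J.+2%:R by rewrite ltr0n.
have b0 : (0 : R) < J.+3%:R by rewrite ltr0n.
rewrite -ln_div ?posrE//.
have -> : (J.+3%:R / J.+2%:R : R) = (1 - J.+3%:R^-1)^-1.
  have E : J.+3%:R = J.+2%:R + 1 :> R by rewrite natr1.
  rewrite E in b0 *; move: a0 b0; move: (J.+2%:R : R) => x x0 x1.
  by field; lra.
have c1 : (J.+3%:R^-1 : R) <= 2^-1 by rewrite lef_pV2 ?posrE// ler_nat.
rewrite lnV ?posrE; last by move: c1; move: (J.+3%:R^-1) => z z1; lra.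
have : ln (1 - J.+3%:R^-1) <= - J.+3%:R^-1 :> R by apply: le_ln1Dx; move: c1; move: (J.+3%:R^-1) => z z1; lra.
have : (3 * J.+1%:R)^-1 <= J.+3%:R^-1 :> R.
  by rewrite lef_pV2 ?posrE// ?mulr_gt0// -natrM ler_nat; lia.
by move=> h1 h2; rewrite (le_trans h1)// lerNr.
Qed.

Section ParameterGrowth.
Context (n : nat) (alpha0 kappa : R) (r d : 'I_n -> nat -> R) (k : nat).
Hypothesis alpha0_ge0 : 0 <= alpha0.
Hypothesis r0 : forall i, r i 0%N = 0.
Hypothesis rS : forall i j, r i j.+1 = r i j + step_size alpha0 j * d i j.
Hypothesis dB : forall i j, `|d i j| <= kappa.
Hypothesis kk : 3 * kappa <= k%:R.

(** The first term pays for the update with step [alpha0]. The coefficient of the logarithm is a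
    natural number, so that the exponential of the bound is a constant times an integer power. *)
Definition parameter_bound (J : nat) : R := kappa * alpha0 + k%:R * ln J.+1%:R.

Lemma expR_parameter_bound J :
  expR (parameter_bound J) = expR (kappa * alpha0) * J.+1%:R ^+ k.
Proof. by rewrite /parameter_bound expRD expRM_natl lnK// posrE ltr0n. Qed.

Hypothesis kappa_ge0 : 0 <= kappa.

Lemma parameter_bound_ge0 J : 0 <= parameter_bound J.
Proof. by rewrite addr_ge0 ?mulr_ge0// ln_ge0// ler1n. Qed.

Lemma parameter_growth i J : `|r i J| <= parameter_bound J.
Proof.
elim: J => [|J IH]; first by rewrite r0 normr0 parameter_bound_ge0.
rewrite rS; case: J IH => [|J] IH.
  rewrite r0 add0r normrM /= (ger0_norm alpha0_ge0) mulrC.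
  apply: (@le_trans _ _ (kappa * alpha0)); first by rewrite ler_wpM2r.
  by rewrite lerDl mulr_ge0// ln_ge0// ler1n.
apply: le_trans (ler_normD _ _) _.
have h1 : `|step_size alpha0 J.+1 * d i J.+1| <= J.+1%:R^-1 * kappa.
  by rewrite normrM /= ger0_norm ?invr_ge0// ler_wpM2l ?invr_ge0.
have h2 := ln_increment_ge J.
have h3 : J.+1%:R^-1 * kappa <= k%:R * (ln J.+3%:R - ln J.+2%:R).
  apply: (@le_trans _ _ ((3 * kappa) * (3 * J.+1%:R)^-1)).
    rewrite le_eqVlt; apply/orP; left; apply/eqP; rewrite invfM; have : (J.+1%:R : R) != 0 by rewrite pnatr_eq0.
    by move: (J.+1%:R : R) => x x0; field.
  by apply: ler_pM => //; rewrite ?mulr_ge0 ?invr_ge0 ?mulr_ge0.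
apply: le_trans (lerD IH h1) _.
move: h3; rewrite /parameter_bound mulrBr.
move: (J.+1%:R^-1 * kappa) (k%:R * ln J.+3%:R) (k%:R * ln J.+2%:R) => x y z; lra.
Qed.

End ParameterGrowth.

End Growth.

Section WindowError.
Context (R : realType) (n : nat) (e : rel 'I_n) (T0 alpha0 : R).
Hypothesis e_sym : symmetric e.
Hypothesis e_irr : irreflexive e.
Hypothesis T0_gt0 : 0 < T0.
Context (c : bool -> 'I_n -> nat -> R) (aa : 'I_n -> R -> R) (s : 'I_n -> R -> bool)
  (r : 'I_n -> R -> R) (tau : 'I_n -> nat -> R).
Local Notation script := (seq (option 'I_n)).
Local Notation L := (update_time T0).
Local Notation T := (update_period T0).
Local Notation matched := (matched e T0 alpha0 c aa s r tau).
Local Notation mart := (mart e T0 alpha0 (start s) c (arrival_rate T0 aa)).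
Local Notation N := (num_configs R n).

(** Occupation times divided by T(J) form a probability [p]. Rate times occupation is count minus
    martingale, so the balance defect of [p] is at most 1 from the counts plus 2 N n m from the
    martingales, over T(J). The cap exp(b) dominates all true rates. *)
Lemma window_error (w : script) J b m i : matched w -> (J < window w)%N -> 0 <= b -> 0 <= m ->
  (forall j, `|r j (L J)| <= b) -> (forall g j, `|mart g j J (expR b) w| <= m) ->
  `|(T J)^-1 * \int[lebesgue_measure]_(t in `[L J, L J.+1]) (s i t)%:R -
    mean_service e (fun j => r j (L J)) i| <=
  2 * n%:R * (Num.sqrt (2 * ((1 + 2 * N * n%:R * m) / T J)) * N * expR ((2 * n%:R + 1) * b)).
Proof.
move=> mw Jw b0 m0 rb mb.
have aw := m_active mw.
have T1 : 0 < T J := update_period_gt0 T0_gt0 J.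
pose p g := (T J)^-1 * occupation e T0 alpha0 (start s) c (arrival_rate T0 aa) w J g.
pose rJ j := r j (L J).
have rate_le g j : rate T0 r g j J <= expR b.
  rewrite /rate; case: ifP => _; first by rewrite -expR0 ler_expR.
  by rewrite ler_expR; have := rb j; rewrite ler_norml => /andP[].
have -> : (T J)^-1 * \int[lebesgue_measure]_(t in `[L J, L J.+1]) (s i t)%:R =
    \sum_(g : {ffun 'I_n -> bool}) (g i)%:R * p g.
  have := m_served mw i (ltnW Jw); rewrite (ltn_eqF Jw) => -[_ _ _ ->].
  by rewrite mulr_sumr; apply: eq_bigr => g _; rewrite /p mulrCA.
apply: (service_error e_sym e_irr rb b0).
- move=> g; rewrite /p; apply: mulr_ge0; first by rewrite invr_ge0 ltW.
  exact: occupation_ge0.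
- move=> g; rewrite /p mulf_eq0 negb_or => /andP[_ og].
  by apply/indepP; exact: (m_indep mw og).
- rewrite -mulr_sumr sum_occupation// ltnNge (ltnW Jw) /= (ltn_eqF Jw).
  by rewrite mulVf// gt_eqF.
move=> g; set cnt := fun g' j => (count_ends e (start s) g' j J w)%:R : R.
have pE g' j : toggle_rate rJ g' j * p g' = (T J)^-1 * (cnt g' j - mart g' j J (expR b) w).
  rewrite (m_mart mw (rate_le g' j)) /p /cnt opprB addrCA subrr addr0.
  by rewrite mulrCA.
have -> : \sum_h \sum_(j | toggle e h j == g) toggle_rate rJ h j * p h -
    \sum_j toggle_rate rJ g j * p g =
    (T J)^-1 * ((\sum_h \sum_(j | toggle e h j == g) cnt h j - \sum_j cnt g j) -
      (\sum_h \sum_(j | toggle e h j == g) mart h j J (expR b) w -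
       \sum_j mart g j J (expR b) w)).
  under eq_bigr do under eq_bigr do rewrite pE.
  under eq_bigr do rewrite -mulr_sumr sumrB.
  under [X in _ - X]eq_bigr do rewrite pE.
  rewrite -!mulr_sumr !sumrB -mulrBr; congr (_ * _); ring.
rewrite normrM gtr0_norm ?invr_gt0// mulrC ler_pM2r ?invr_gt0//.
apply: le_trans (ler_normB _ _) _; apply: lerD; first exact: count_ends_balance.
apply: le_trans (ler_normB _ _) _.
have sm g' : \sum_j `|mart g' j J (expR b) w| <= n%:R * m.
  apply: (@le_trans _ _ (\sum_(j < n) m)); first exact: ler_sum.
  by rewrite sumr_const card_ord mulr_natl.
have h1 : `|\sum_h \sum_(j | toggle e h j == g) mart h j J (expR b) w| <= N * (n%:R * m).
  rewrite /num_configs mulr_suml; apply: le_trans (ler_norm_sum _ _ _) _.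
  apply: ler_sum => h _; rewrite mul1r; apply: le_trans (sm h).
  apply: le_trans (ler_norm_sum _ _ _) _.
  by rewrite [leRHS](bigID (fun j => toggle e h j == g))/= lerDl sumr_ge0.
have N1 : 1 <= N by rewrite /num_configs (bigD1 (empty_config n))//= lerDl sumr_ge0.
have h2 : `|\sum_j mart g j J (expR b) w| <= N * (n%:R * m).
  apply: le_trans (ler_norm_sum _ _ _) _; apply: le_trans (sm g) _.
  by rewrite ler_peMl// mulr_ge0.
apply: le_trans (lerD h1 h2) _; rewrite le_eqVlt; apply/orP; left; apply/eqP; ring.
Qed.

End WindowError.

(** * Almost sure size of the martingales *)

Section MartingaleDecay.
Context d (Omega : measurableType d) (R : realType) (P : probability Omega R).
Context (n : nat) (e : rel 'I_n) (T0 alpha0 : R).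
Hypothesis T0_gt0 : 0 < T0.
Context (X : bool -> 'I_n -> nat -> {RV P >-> R}) (G : set (set Omega)).
Hypothesis G_measurable : G `<=` measurable.
Hypothesis G_setT : G setT.
Hypothesis G_setI : setI_closed G.
Hypothesis clocks : csma_clocks X G.
Context (a : Omega -> 'I_n -> nat -> R).
Hypothesis a_env : forall i j (B : set R), measurable B -> G ((fun w => a w i j) @^-1` B).
Context (s0 : {ffun 'I_n -> bool}) (S0 : set Omega).
Hypothesis S0_env : G S0.
Context (rho : nat -> R) (c : R) (k q : nat).
Hypothesis rho_ge0 : forall J, 0 <= rho J.
Hypothesis rho_le : forall J, rho J <= c * J.+1%:R ^+ k.

Local Notation script := (seq (option 'I_n)).
Local Notation T := (update_period T0).
Local Notation clk w := (fun b i k => X b i k w).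
Local Notation active_at s w := (active e T0 alpha0 s0 (clk s) (a s) w).
Local Notation mart_at s w g i J := (mart e T0 alpha0 s0 (clk s) (a s) g i J (rho J) w).

Let c_ge0 : 0 <= c.
Proof. by have := le_trans (rho_ge0 0) (rho_le 0); rewrite expr1n mulr1. Qed.

(** The squared martingales, weighted by [wt], have summable expectations. Along the path the
    martingale of window [J] is frozen once the window is over, and its square is one term of the
    sum over scripts; each weighted square is thus bounded by the almost surely finite total. *)
Lemma mart_decay_ae g i : {ae P, forall s, S0 s -> exists2 B, 0 <= B &
  forall W : nat -> script, (forall m, size (W m) = m) -> (forall m, active_at s (W m)) ->
  (forall m, exists v, W m.+1 = v :: W m) ->
  (forall J, exists m0, forall m, (m0 <= m)%N -> (J < window (W m))%N) ->
  forall J, exists m0, forall m, (m0 <= m)%N ->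
    `|mart_at s (W m) g i J| <= B * (T J / J.+1%:R ^+ q)}.
Proof.
have T1 J : 0 < T J := update_period_gt0 T0_gt0 J.
pose wt J : R := (J.+1%:R ^+ q / T J) ^+ 2.
have wt0 J : 0 < wt J by rewrite exprn_gt0// divr_gt0// exprn_gt0// ltr0n.
pose f m J s := wt J * \sum_(w <- words n m) (`[< S0 s >] && active_at s w)%:R * mart_at s w g i J ^+ 2.
have f0 m J s : 0 <= f m J s.
  by rewrite mulr_ge0 ?(ltW (wt0 J))// sumr_ge0// => w _; rewrite mulr_ge0// sqr_ge0.
have mS m J : measurable_fun setT
    (fun s => \sum_(w <- words n m) (`[< S0 s >] && active_at s w)%:R * mart_at s w g i J ^+ 2).
  apply: measurable_sum => w; apply/measurable_EFinP.
  have /measurable_int h := @integrable_chi_mart _ _ _ P n e T0 alpha0 T0_gt0 X G G_measurable a a_env s0 S0 S0_env g i J (rho J) (rho_ge0 J) w; exact: h.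
(* The exponent splits into 2 q for the weight, k for the rate cap and 2 for summability. *)
have [c' c'0 Tc] := update_period_superpolynomial T0_gt0 (2 * q + k + 2).
have : {ae P, forall s, exists B, forall N (y : nat -> R),
    (forall J, (J < N)%N -> exists m0, forall m, (m0 <= m)%N -> y J <= f m J s) ->
    \sum_(J < N) y J <= B}.
apply: (@ae_bounded_of_summable _ _ _ P f (fun J => (c / c') * (J.+1%:R^-1) ^+ 2) ((c / c') * 2)) => [m J|//|m J|N].
- by apply: measurable_funM => //; exact: mS.
- under eq_integral do rewrite EFinM.
  rewrite ge0_integralZl_EFin//; last 3 first.
  + by move=> s _; rewrite lee_fin sumr_ge0// => w _; rewrite mulr_ge0// sqr_ge0.
  + by apply/measurable_EFinP.
  + exact: ltW.
  apply: le_trans (_ : (wt J)%:E * (rho J * T J)%:E <= _)%E.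
    rewrite lee_pmul2l//; last by rewrite lte_fin.
    exact: (expected_mart_square_le e alpha0 T0_gt0 G_measurable G_setT G_setI clocks a_env s0 S0_env g i J (rho_ge0 J) m).
  rewrite -EFinM lee_fin.
  have J1 : (0 : R) < J.+1%:R by rewrite ltr0n.
  have -> : wt J * (rho J * T J) = rho J * (J.+1%:R ^+ q) ^+ 2 / T J.
    by rewrite /wt; field; rewrite gt_eqF.
  rewrite ler_pdivrMr//.
  have -> : c / c' * J.+1%:R^-1 ^+ 2 * T J = (c * J.+1%:R^-1 ^+ 2) * (T J / c').
    by field; rewrite !gt_eqF.
  apply: (@le_trans _ _ ((c * J.+1%:R^-1 ^+ 2) * J.+1%:R ^+ (2 * q + k + 2))); last first.
    apply: ler_wpM2l; first by rewrite mulr_ge0// exprn_ge0// invr_ge0 ltW.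
    by rewrite ler_pdivlMr// mulrC.
  have -> : c * J.+1%:R^-1 ^+ 2 * J.+1%:R ^+ (2 * q + k + 2) = c * J.+1%:R ^+ k * (J.+1%:R ^+ q) ^+ 2.
    by rewrite (exprD _ (2 * q + k)) (exprD _ (2 * q)%N) [(2 * q)%N]mulnC exprM; field; rewrite gt_eqF.
  by rewrite ler_wpM2r// sqr_ge0.
- rewrite -mulr_sumr ler_wpM2l ?divr_ge0 ?(ltW c'0)//; exact: sum_inv_square_le.
apply: filterS => s [B hB] S0s; exists (Num.sqrt B); first exact: sqrtr_ge0.
move=> W szW actW stepW winW.
have /choice[m0 hm0] := winW.
have frozen J m : (m0 J <= m)%N -> mart_at s (W m) g i J = mart_at s (W (m0 J)) g i J.
  elim: m => [|m IH]; first by rewrite leqn0 => /eqP ->.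
  rewrite leq_eqVlt => /orP[/eqP <-//|]; rewrite ltnS => hm; rewrite -IH//.
  by have [v ->] := stepW m; rewrite mart_frozen// gtn_eqF// hm0.
pose y J := wt J * mart_at s (W (m0 J)) g i J ^+ 2.
have y0 J : 0 <= y J by rewrite mulr_ge0 ?sqr_ge0// ltW.
have yB J : y J <= B.
  apply: le_trans (hB J.+1 y _); last first.
    move=> J' _; exists (m0 J') => m mm; rewrite /y /f ler_pM2l// -(frozen J' m)//.
    rewrite (big_rem (W m)) /=; last by rewrite -{2}(szW m) mem_words.
    rewrite actW andbT; case: asboolP => // _; rewrite mul1r lerDl sumr_ge0// => w _.
    by rewrite mulr_ge0// sqr_ge0.
  by rewrite big_ord_recr/= lerDr sumr_ge0.
move=> J; exists (m0 J) => m mm; rewrite frozen//.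
have /ler_wsqrtr := yB J; rewrite /y /wt -exprMn sqrtr_sqr normrM gtr0_norm; last first.
  by rewrite divr_gt0// exprn_gt0// ltr0n.
rewrite -ler_pdivlMl; last by rewrite divr_gt0// exprn_gt0// ltr0n.
by rewrite invf_div mulrC.
Qed.

End MartingaleDecay.

Section ServiceErrorDecay.
Context (R : realType) (n : nat) (e : rel 'I_n) (T0 alpha0 kappa : R).
Hypothesis e_sym : symmetric e.
Hypothesis e_irr : irreflexive e.
Hypothesis T0_gt0 : 0 < T0.
Hypothesis alpha0_ge0 : 0 <= alpha0.
Hypothesis kappa_ge0 : 0 <= kappa.
Context (c : bool -> 'I_n -> nat -> R) (aa : 'I_n -> R -> R) (s : 'I_n -> R -> bool)
  (r : 'I_n -> R -> R) (tau : 'I_n -> nat -> R) (k : nat).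
Local Notation L := (update_time T0).
Local Notation T := (update_period T0).
Local Notation b := (parameter_bound alpha0 kappa k).
Local Notation q := ((2 * n + 1) * k + 1)%N.
Hypothesis r_bound : forall i J, `|r i (L J)| <= b J.

(** The balance defect is of order (J + 1)^(- 2 q) and enters under a square root, while the factor
    exp((2 n + 1) b) costs (J + 1)^((2 n + 1) k). The choice of q leaves exactly one power of J +
    1. *)
Lemma service_error_decay (B : R) : 0 <= B ->
  (forall J, exists2 w, matched e T0 alpha0 c aa s r tau w & (J < window w)%N /\
     forall g j, `|mart e T0 alpha0 (start s) c (arrival_rate T0 aa) g j J (expR (b J)) w|
       <= B * (T J / J.+1%:R ^+ (2 * q))) ->
  exists2 C, 0 <= C & forall J i,
    `|(T J)^-1 * \int[lebesgue_measure]_(t in `[L J, L J.+1]) (s i t)%:R -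
      mean_service e (fun j => r j (L J)) i| <= C / J.+1%:R.
Proof.
move=> B0 path; set N := num_configs R n.
have N0 : 0 <= N by rewrite /N /num_configs sumr_ge0.
have [c' c'0 Tc] := update_period_superpolynomial T0_gt0 (2 * q).
pose C1 : R := c'^-1 + 2 * N * n%:R * B.
have C10 : 0 <= C1.
  by rewrite addr_ge0 ?invr_ge0 ?(ltW c'0)// !mulr_ge0.
pose C2 := expR (kappa * alpha0) ^+ (2 * n + 1).
exists (2 * n%:R * (Num.sqrt (2 * C1) * N * C2)).
  by rewrite !mulr_ge0 ?sqrtr_ge0// exprn_ge0// expR_ge0.
move=> J i; have [w mw [Jw mB]] := path J.
have T1 : 0 < T J := update_period_gt0 T0_gt0 J.
have J1 : (0 : R) < J.+1%:R by rewrite ltr0n.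
have m0 : 0 <= B * (T J / J.+1%:R ^+ (2 * q)).
  by rewrite mulr_ge0// divr_ge0 ?exprn_ge0// ltW.
have bJ : 0 <= b J := parameter_bound_ge0 k alpha0_ge0 kappa_ge0 J.
have := window_error e_sym e_irr T0_gt0 i mw Jw bJ m0 (fun j => r_bound j J) mB.
move=> h; apply: le_trans h _.
rewrite -!mulrA ler_wpM2l// ler_wpM2l//.
have -> : expR ((2 * n%:R + 1) * b J) = C2 * J.+1%:R ^+ ((2 * n + 1) * k).
  have -> : (2 * n%:R + 1 : R) = (2 * n + 1)%:R by rewrite natrD natrM.
  by rewrite expRM_natl expR_parameter_bound exprMn -exprM [(k * _)%N]mulnC.
have D : 2 * ((1 + 2 * N * n%:R * (B * (T J / J.+1%:R ^+ (2 * q)))) / T J) <=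
    2 * C1 * (J.+1%:R^-1 ^+ q) ^+ 2.
  rewrite -[leRHS]mulrA ler_wpM2l// [leLHS]mulrDl mul1r /C1 [leRHS]mulrDl.
  have -> : (J.+1%:R^-1 ^+ q) ^+ 2 = (J.+1%:R ^+ (2 * q))^-1 :> R.
    by rewrite -exprM mulnC exprVn.
  apply: lerD.
    by rewrite -invfM lef_pV2 ?posrE ?mulr_gt0 ?exprn_gt0.
  rewrite le_eqVlt; apply/orP; left; apply/eqP; field.
  by rewrite expf_neq0 ?gt_eqF.
have q0 : 0 <= (J.+1%:R^-1 : R) ^+ q by rewrite exprn_ge0// invr_ge0 ltW.
apply: le_trans (_ : Num.sqrt (2 * C1) * J.+1%:R^-1 ^+ q * (N * (C2 * J.+1%:R ^+ ((2 * n + 1) * k))) <= _).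
  apply: ler_wpM2r.
    by rewrite !mulr_ge0// ?exprn_ge0// ?expR_ge0// ltW.
  rewrite -[X in _ <= _ * X](ger0_norm q0) -sqrtr_sqr -sqrtrM ?mulr_ge0//; apply: ler_wsqrtr.
  by apply: le_trans D; rewrite -!mulrA.
rewrite le_eqVlt; apply/orP; left; apply/eqP.
rewrite exprD expr1 exprVn; field.
by rewrite expf_neq0 ?gt_eqF.
Qed.

End ServiceErrorDecay.

Section WindowService.
Context (R : realType) (n : nat) (T0 : R) (s : 'I_n -> R -> bool).
Hypothesis T0_gt0 : 0 < T0.
Local Notation L := (update_time T0).
Local Notation T := (update_period T0).

Definition window_service (i : 'I_n) (J : nat) : R :=
  (T J)^-1 * \int[lebesgue_measure]_(t in `[L J, L J.+1]) (s i t)%:R.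

Lemma window_service_bounds (e : rel 'I_n) alpha0 c aa r tau w J i :
  matched e T0 alpha0 c aa s r tau w -> (J < window w)%N ->
  has_integral (fun t => (s i t)%:R) (L J) (L J.+1) (T J * window_service i J) /\
  0 <= window_service i J <= 1.
Proof.
move=> mw Jw; have T1 : 0 < T J := update_period_gt0 T0_gt0 J.
have := m_served mw i (ltnW Jw); rewrite (ltn_eqF Jw) => h.
have E : T J * window_service i J =
    \sum_(g : {ffun 'I_n -> bool}) (g i)%:R * occupation e T0 alpha0 (start s) c (arrival_rate T0 aa) w J g.
  by rewrite mulrA mulfV ?mul1r ?gt_eqF//; case: h.
rewrite E; split => //.
have aw := m_active mw.
have o0 g : 0 <= occupation e T0 alpha0 (start s) c (arrival_rate T0 aa) w J g by exact: occupation_ge0.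
rewrite -(ler_pM2l T1) -[X in _ && X](ler_pM2l T1) E mulr0 mulr1 sumr_ge0 /=; last first.
  by move=> g _; rewrite mulr_ge0.
have <- : \sum_g occupation e T0 alpha0 (start s) c (arrival_rate T0 aa) w J g = T J.
  by rewrite sum_occupation// ltnNge (ltnW Jw) /= (ltn_eqF Jw).
by apply: ler_sum => g _; case: (g i); rewrite ?mul1r ?mul0r.
Qed.

End WindowService.

Section Environment.
Context d (Omega : measurableType d) (R : realType) (P : probability Omega R).
Context (n : nat) (A : 'I_n -> R -> {RV P >-> R}) (s0 : 'I_n -> {RV P >-> bool}).

Local Notation generators := (\bigcup_(it in [set it : 'I_n * R | 0 <= it.2])
  g_sigma_algebra_preimage (A it.1 it.2 : Omega -> R)
  `|` \bigcup_i g_sigma_algebra_preimage (s0 i : Omega -> bool)).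

Lemma environment_measurable : environment A s0 `<=` measurable.
Proof.
apply: smallest_sub; first exact: sigma_algebra_measurable.
by move=> E [[it _]|[i _]]; apply: g_sigma_algebra_preimage_measurable.
Qed.

Lemma environment_setT : environment A s0 setT.
Proof. exact: (@measurableT _ (g_sigma_algebraType generators)). Qed.

Lemma environment_setI : setI_closed (environment A s0).
Proof. by move=> E F hE hF; exact: (@measurableI _ (g_sigma_algebraType generators)). Qed.

Lemma environment_arrival i t : 0 <= t ->
  measurable_fun [set: g_sigma_algebraType generators] (A i t : Omega -> R).
Proof.
move=> t0 _ B mB; rewrite setTI; apply: sub_gen_smallest; left; exists (i, t) => //.
by apply/g_sigma_algebra_preimageE; exists B.
Qed.

Lemma environment_window_rate T0 i j (B : set R) : 0 < T0 -> measurable B ->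
  environment A s0 ((fun w => arrival_rate T0 (fun i t => A i t w) i j) @^-1` B).
Proof.
move=> T0_gt0 mB; rewrite -[X in environment _ _ X]setTI.
have : measurable_fun [set: g_sigma_algebraType generators]
    (fun w => arrival_rate T0 (fun i t => A i t w) i j).
  apply: measurable_funM => //; apply: measurable_funB;
    by apply: environment_arrival; exact: update_time_ge0.
by move=> h; exact: (h measurableT B mB).
Qed.

Lemma environment_start (g : {ffun 'I_n -> bool}) :
  environment A s0 [set w | forall i, s0 i w = g i].
Proof.
have h : measurable_fun [set: g_sigma_algebraType generators]
    (fun w : Omega => [forall i, s0 i w == g i]).
  apply: measurable_forall => i; apply: (measurable_fun_bool true); rewrite setTI.
  apply: sub_gen_smallest; right; exists i => //.
  by apply/g_sigma_algebra_preimageE; exists [set g i] => //; apply/seteqP; split => w /= /eqP.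
have := h measurableT [set true] I; rewrite setTI.
congr (<<s _ >> _); apply/seteqP; split => w /=.
  by move/forallP => H i; exact/eqP.
by move=> H; apply/forallP => i; apply/eqP.
Qed.

End Environment.

Section NetworkService.
Context (R : realType) d (Omega : measurableType d) (P : probability Omega R).
Context (n : nat) (e : rel 'I_n).
Hypothesis e_sym : symmetric e.
Hypothesis e_irr : irreflexive e.
Context (K T0 alpha0 : R).
Hypothesis T0_gt0 : 0 < T0.
Hypothesis alpha0_gt0 : 0 < alpha0.
Context (A : 'I_n -> R -> {RV P >-> R}) (X : bool -> 'I_n -> nat -> {RV P >-> R})
  (sigma : 'I_n -> R -> {RV P >-> bool}) (r Q : 'I_n -> R -> {RV P >-> R}).
Hypothesis network : csma_network e K T0 alpha0 A X sigma r Q.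

Local Notation L := (update_time T0).
Local Notation T := (update_period T0).
Local Notation s w := (fun i t => sigma i t w).

Lemma network_arrival_rate_ae :
  {ae P, forall w, forall i J, 0 <= arrival_rate T0 (fun i t => A i t w) i J <= K}.
Proof.
apply: filterS (arrival_lipschitz (network_arrivals network)) => w h i J.
have [_ /(_ (L J) (L J.+1) (update_time_ge0 T0_gt0 J) (update_time_ltS T0_gt0 J))] := h i.
have T1 := update_period_gt0 T0_gt0 J.
rewrite update_timeS addrAC subrr add0r => /andP[h1 h2].
by rewrite /arrival_rate update_timeS divr_ge0 ?(ltW T1)//= ler_pdivrMr.
Qed.

Lemma network_service_ae : {ae P, forall w,
  (forall i J, has_integral (fun t => (sigma i t w)%:R) (L J) (L J.+1) (T J * window_service T0 (s w) i J)
     /\ 0 <= window_service T0 (s w) i J <= 1) /\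
  exists2 C, 0 <= C & forall J i,
    `|window_service T0 (s w) i J - mean_service e (fun j => r j (L J) w) i| <= C / J.+1%:R}.
Proof.
pose G := environment A (fun i => sigma i 0).
pose a w := arrival_rate T0 (fun i t => A i t w).
(* Bounds the difference of the empirical arrival rate, at most K, and the empirical service, at
   most 1. *)
pose kappa : R := `|K| + 1.
have kappa0 : 0 <= kappa by rewrite addr_ge0.
have [k kk] : exists k : nat, 3 * kappa <= k%:R.
  exists (Num.truncn (3 * kappa)).+1; apply: ltW.
  by have /andP[] := truncn_itv (mulr_ge0 (ler0n _ 3) kappa0).
pose b := parameter_bound alpha0 kappa k.
pose q := ((2 * n + 1) * k + 1)%N.
have a_env i j (B : set R) : measurable B -> G ((fun w => a w i j) @^-1` B).
  by move=> mB; exact: environment_window_rate.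
have Gm : G `<=` measurable by exact: environment_measurable.
have GT : G setT by exact: environment_setT.
have GI : setI_closed G by exact: environment_setI.
have clocks := network_clocks network.
have ties : {ae P, forall w, forall s0, forall (l : seq (option 'I_n)) (u v : option 'I_n), u != v ->
    delay e T0 alpha0 s0 (fun b i k => X b i k w) (a w) l u !=
    delay e T0 alpha0 s0 (fun b i k => X b i k w) (a w) l v}.
  by apply: ae_forall_count => s0; exact: (no_ties_ae e T0 alpha0 Gm GT GI clocks a_env s0).
have b0 J : 0 <= b J := parameter_bound_ge0 k (ltW alpha0_gt0) kappa0 J.
have rho_le J : expR (b J) <= expR (kappa * alpha0) * J.+1%:R ^+ k.
  by rewrite expR_parameter_bound.
have marts := ae_forall_count (fun sgi : {ffun 'I_n -> bool} * {ffun 'I_n -> bool} * 'I_n =>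
  @mart_decay_ae _ _ _ P n e T0 alpha0 T0_gt0 X G Gm GT GI clocks a a_env sgi.1.1
    _ (@environment_start _ _ _ _ _ A (fun i => sigma i 0) sgi.1.1) (fun J => expR (b J))
    (expR (kappa * alpha0)) k (2 * q) (fun J => expR_ge0 (b J))
    rho_le sgi.1.2 sgi.2).
have paths : {ae P, forall w,
    [/\ forall i J, 0 <= arrival_rate T0 (fun i t => A i t w) i J <= K,
        csma_path e (fun b i k => X b i k w) (fun i t => r i t w) (s w) &
        algorithm1_path T0 alpha0 (fun i t => A i t w) (s w) (fun i t => r i t w)]}.
  by apply: filterS3 network_arrival_rate_ae (network_csma network) (network_algorithm network).
apply: filterS3 ties marts paths => w {}ties {}marts [arr [s_indep csma] alg].
have /choice[tau htau] := csma.
have tau0 i : tau i 0%N = 0 by case: (htau i) => -[].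
have tau_lt i j : tau i j < tau i j.+1 by case: (htau i) => -[_ ].
have tau_unb i t : exists j, t < tau i j by case: (htau i).
have tau_const i j t : tau i j <= t < tau i j.+1 -> sigma i t w = sigma i (tau i j) w.
  by case: (htau i) => _ _ h _ _; exact: h.
have tau_busy i j : sigma i (tau i j) w = true -> tau i j.+1 - tau i j = X true i j w /\
  sigma i (tau i j.+1) w = false by case: (htau i) => _ _ _ h _; exact: h.
have tau_wait i j : sigma i (tau i j) w = false ->
   \int[lebesgue_measure]_(u in `[tau i j, tau i j.+1]) expR (r i u w) = X false i j w /\
   (sigma i (tau i j.+1) w = true <->
    \forall u \near (tau i j.+1)^'-, forall j, e i j -> sigma j u w = false).
  by case: (htau i) => _ _ _ _ h; exact: h.
have [W [szW [mW stepW]]] := @exists_matched_path R n e T0 alpha0 T0_gt0 _ _ _ _ tau alg s_indep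
  tau0 tau_lt tau_const tau_busy tau_wait (ties (start (s w))).
have winW J : exists m0, forall m, (m0 <= m)%N -> (J < window (W m))%N.
  have [m0 h] := @matched_unbounded R n e T0 alpha0 T0_gt0 (fun b i k => X b i k w)
    (fun i t => A i t w) (s w) (fun i t => r i t w) tau tau_lt tau_unb J.
  by exists m0 => m mm; apply: h; rewrite ?szW.
have bounds i J : has_integral (fun t => (sigma i t w)%:R) (L J) (L J.+1)
    (T J * window_service T0 (s w) i J) /\ 0 <= window_service T0 (s w) i J <= 1.
  have [m0 /(_ _ (leqnn _)) h] := winW J.
  exact: (window_service_bounds T0_gt0 i (mW m0) h).
split=> //.
have r_bound i J : `|r i (L J) w| <= b J.
  apply: (@parameter_growth R T0 T0_gt0 n alpha0 kappa (fun i J => r i (L J) w)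
    (fun i J => a w i J - window_service T0 (s w) i J)) => //.
  - exact: ltW.
  - by move=> j; rewrite update_time0; case: (alg j).
  - by move=> j m; case: (alg j) => _ _ ->.
  - move=> j m; have := arr j m; have [_] := bounds j m; rewrite -/(a w j m).
    have := ler_norm K; rewrite /kappa ler_norml.
    move: (a w j m) (window_service _ _ _ _) => x y h /andP[? ?] /andP[? ?].
    by apply/andP; split; lra.
have actW m : active e T0 alpha0 (start (s w)) (fun b i k => X b i k w) (a w) (W m) := m_active (mW m).
have /choice[B hB] : forall gi : {ffun 'I_n -> bool} * 'I_n, exists B, 0 <= B /\
   forall J, exists m0, forall m, (m0 <= m)%N ->
    `|mart e T0 alpha0 (start (s w)) (fun b i k => X b i k w) (a w) gi.1 gi.2 J (expR (b J)) (W m)|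
       <= B * (T J / J.+1%:R ^+ (2 * q)).
  move=> gi; have [|B B0 h] := marts (start (s w), gi.1, gi.2).
    by move=> i; rewrite ffunE.
  by exists B; split => //; exact: (h W szW actW stepW winW).
apply: (@service_error_decay R n e T0 alpha0 kappa e_sym e_irr T0_gt0 (ltW alpha0_gt0) kappa0
  _ _ (s w) (fun i t => r i t w) tau k r_bound (\sum_gi B gi)).
  by apply: sumr_ge0 => gi _; case: (hB gi).
move=> J; have /choice[m0 hm0] := fun gi => (hB gi).2 J.
have [m1 hm1] := winW J.
(* A single script length beyond the thresholds of all configurations and nodes. *)
pose m := (m1 + \sum_gi m0 gi)%N.
exists (W m) => //; split; first by apply: hm1; exact: leq_addr.
move=> g j; apply: le_trans (hm0 (g, j) m _) _.
  by rewrite /m (bigD1 (g, j))//= addnCA leq_addr.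
rewrite ler_wpM2r ?divr_ge0 ?exprn_ge0//; first by rewrite ltW// update_period_gt0.
by rewrite (bigD1 (g, j))//= lerDl sumr_ge0// => gi _; case: (hB gi).
Qed.

End NetworkService.

(** * Window averages and arrivals *)

Section WindowGrowth.
Context (R : realType) (T0 : R).
Hypothesis T0_gt0 : 0 < T0.
Local Notation L := (update_time T0).
Local Notation T := (update_period T0).

Lemma update_period_le k j : (k <= j)%N -> T k <= (1 + T0) * T j.
Proof.
have T0' := ltW T0_gt0.
case: k => [|k] kj; last first.
  case: j kj => // j; rewrite ltnS => kj.
  apply: (@le_trans _ _ (T j.+1)); last by rewrite ler_peMl ?expR_ge0// lerDl.
  by rewrite /= ler_expR ler_wsqrtr// ler_nat.
case: j kj => [|j] _; first by rewrite ler_peMl// lerDl.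
apply: (@le_trans _ _ (1 + T0)); first by rewrite /= lerDr.
rewrite ler_peMr ?addr_ge0//= -expR0 ler_expR; exact: sqrtr_ge0.
Qed.

Lemma update_time_le_period j : L j.+1 <= (1 + T0) * j.+1%:R * T j.
Proof.
rewrite mulrAC /update_time.
apply: (@le_trans _ _ (\sum_(k < j.+1) (1 + T0) * T j)).
  by apply: ler_sum => k _; apply: update_period_le; rewrite -ltnS.
by rewrite sumr_const card_ord mulr_natr.
Qed.

Lemma update_period_ratio j : T j.+1 <= (1 + T0^-1) * expR 1 * T j.
Proof.
have e1 : 1 <= expR 1 :> R by rewrite -expR0 ler_expR.
case: j => [|j].
  rewrite /= sqrtr1 mulrDl mul1r mulrDl mulrAC mulVf ?mul1r ?gt_eqF// lerDr.
  by rewrite mulr_ge0 ?expR_ge0// ltW.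
rewrite -mulrA -expRD; apply: (@le_trans _ _ (expR (1 + Num.sqrt j.+1%:R))).
  rewrite ler_expR; apply: (@le_trans _ _ (Num.sqrt ((1 + Num.sqrt j.+1%:R) ^+ 2))).
    apply: ler_wsqrtr; rewrite sqrrD expr1n mul1r sqr_sqrtr// -[j.+2%:R]natr1.
    by have := sqrtr_ge0 (j.+1%:R : R); move: (j.+1%:R : R) (Num.sqrt _) => x y; lra.
  by rewrite sqrtr_sqr ger0_norm// addr_ge0// sqrtr_ge0.
by rewrite ler_peMl ?expR_ge0// lerDl invr_ge0 ltW.
Qed.

(** Square roots of indices that differ by at most m + 1 differ by at most 1 once sqrt(j) >= m + 1.
    Each of the m + 1 windows before j is therefore at least T(j) / e long. *)
Lemma update_period_small m j : (m.+1 ^ 2 + m.+2 <= j)%N -> m.+1%:R * T j <= expR 1 * L j.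
Proof.
move=> mj; set p := (j - m.+1)%N.
have pj : j = (p + m.+1)%N by rewrite /p subnK//; lia.
have p0 : (0 < p)%N by lia.
have j0 : (0 < j)%N by lia.
have h (k : 'I_m.+1) : T j <= expR 1 * T (p + k).
  have -> : T (p + k) = expR (Num.sqrt (p + k)%:R) by case: (p) p0.
  have -> : T j = expR (Num.sqrt j%:R) by case: (j) j0.
  rewrite -expRD ler_expR -lerBlDl.
  apply: le_trans (ler_norm _) _; rewrite -sqrtr_sqr; apply: ler_wsqrtr.
  rewrite sqrrB sqr_sqrtr// expr1n.
  apply: (@le_trans _ _ (p%:R)); last by rewrite ler_nat leq_addr.
  have sm : m.+1%:R <= Num.sqrt j%:R :> R.
    have -> : m.+1%:R = Num.sqrt (m.+1%:R ^+ 2) :> R by rewrite sqrtr_sqr ger0_norm.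
    by apply: ler_wsqrtr; rewrite -natrX ler_nat; lia.
  have m1 : 1 <= m.+1%:R :> R by rewrite ler1n.
  rewrite !mulr1 {1}pj natrD.
  move: sm m1; move: (m.+1%:R : R) (p%:R : R) (Num.sqrt _) => x y z; lra.
have -> : L j = L p + \sum_(k < m.+1) T (p + k).
  by rewrite {1}pj /update_time big_split_ord.
rewrite mulrDr [X in _ + X]mulr_sumr; apply: (@le_trans _ _ (\sum_(k < m.+1) T j)).
  by rewrite sumr_const card_ord mulr_natl.
apply: (@le_trans _ _ (\sum_(k < m.+1) expR 1 * T (p + k))); first exact: ler_sum.
by rewrite lerDr mulr_ge0 ?expR_ge0// update_time_ge0.
Qed.

(** For G(t) = F(t) - l t, each third of [eps] pays for one contribution: the early windows, a
    constant; the later full windows, each nearly balanced; and the unfinished window, controlled by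
    the Lipschitz bound because its length is negligible against L(j). *)
Lemma window_average_cvg (F : R -> R) (B l : R) : 0 <= B -> F 0 = 0 ->
  (forall u t, 0 <= u -> u <= t -> `|F t - F u| <= B * (t - u)) ->
  (fun j => (F (L j.+1) - F (L j)) / T j) @ \oo --> l ->
  F t / t @[t --> +oo] --> l.
Proof.
move=> B0 F0 lip avg.
pose G t := F t - l * t; pose B1 := B + `|l|.
have B10 : 0 <= B1 by rewrite addr_ge0.
have lipG u t : 0 <= u -> u <= t -> `|G t - G u| <= B1 * (t - u).
  move=> u0 ut; have -> : G t - G u = (F t - F u) - l * (t - u) by rewrite /G; ring.
  apply: le_trans (ler_normB _ _) _; rewrite mulrDl lerD ?lip//.
  by rewrite normrM (ger0_norm (_ : 0 <= t - u)) ?subr_ge0.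
have L0 := update_time_ge0 T0_gt0; have T1 := update_period_gt0 T0_gt0.
suff main eps : 0 < eps -> exists M, forall t, M < t -> `|G t| <= eps * t.
  apply/cvgrPdist_le => eps eps0; have [M hM] := main _ eps0.
  exists (Num.max M 0); split; first by rewrite num_real.
  move=> t; rewrite gt_max => /andP[Mt t0].
  have -> : l - F t / t = - (G t / t) by rewrite /G; field; rewrite gt_eqF.
  by rewrite normrN normrM normfV (gtr0_norm t0) ler_pdivrMr// hM.
move=> eps0; pose d := eps / 3; have d0 : 0 < d by rewrite divr_gt0.
have [J hJ] : exists J, forall j, (J <= j)%N -> `|G (L j.+1) - G (L j)| <= d * T j.
  have /cvgrPdist_le/(_ d d0)[J _ hJ] := avg; exists J => j Jj.
  have := hJ j Jj; rewrite /= distrC.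
  have -> : (F (L j.+1) - F (L j)) / T j - l = (G (L j.+1) - G (L j)) / T j.
    by rewrite /G update_timeS; field; rewrite gt_eqF.
  by rewrite normrM normfV (gtr0_norm (T1 j)) ler_pdivrMr.
have GL j : (J <= j)%N -> `|G (L j)| <= `|G (L J)| + d * L j.
  elim: j => [|j IH]; first by rewrite leqn0 => /eqP ->; rewrite lerDl mulr_ge0// ltW.
  rewrite leq_eqVlt => /orP[/eqP <-|]; first by rewrite lerDl mulr_ge0// ltW.
  rewrite ltnS => Jj; have -> : G (L j.+1) = G (L j) + (G (L j.+1) - G (L j)) by ring.
  apply: le_trans (ler_normD _ _) _; rewrite [in leRHS]update_timeS mulrDr addrA.
  by apply: lerD; [exact: IH|exact: hJ].
have [m hm] : exists m : nat, B1 * expR 1 <= d * m.+1%:R.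
  exists (Num.truncn (B1 * expR 1 / d)); rewrite -ler_pdivrMl// mulrC.
  by apply: ltW; have /andP[] := truncn_itv (divr_ge0 (mulr_ge0 B10 (expR_ge0 1)) (ltW d0)).
pose J' := (J + (m.+1 ^ 2 + m.+2))%N.
exists (Num.max (L J') (`|G (L J)| / d)) => t; rewrite gt_max => /andP[Lt Ct].
have [j /andP[jt tj]] := update_time_window T0_gt0 (ltW (le_lt_trans (L0 J') Lt)).
have J'j : (J' <= j)%N.
  by rewrite leqNgt; apply/negP => /(update_time_le T0_gt0) h; have := le_lt_trans h Lt; rewrite ltNge (ltW tj).
have Jj : (J <= j)%N by apply: leq_trans J'j; exact: leq_addr.
have h1 := update_period_small (leq_trans (leq_addl _ _) J'j).
have h2 : B1 * T j <= d * L j.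
  have mm : (0 : R) < m.+1%:R by rewrite ltr0n.
  rewrite -(ler_pM2l mm); apply: (@le_trans _ _ (B1 * (expR 1 * L j))).
    by rewrite mulrCA ler_wpM2l.
  by rewrite mulrA mulrCA mulrA ler_wpM2r.
have h3 : `|G t - G (L j)| <= B1 * T j.
  apply: le_trans (lipG _ _ (L0 j) jt) _; rewrite ler_wpM2l// lerBlDl -update_timeS.
  exact: ltW.
have -> : G t = G (L j) + (G t - G (L j)) by ring.
apply: le_trans (ler_normD _ _) _.
have h4 := GL j Jj.
have h5 : d * L j <= d * t by rewrite ler_wpM2l// ltW.
have h6 : `|G (L J)| <= d * t by rewrite -ler_pdivrMl// mulrC ltW.
have -> : eps * t = d * t + d * t + d * t by rewrite /d; field.
move: h2 h3 h4 h5 h6; move: (d * L j) (d * t) (B1 * T j) `|_ - _| `|G (L j)| `|_| => *; lra.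
Qed.

End WindowGrowth.

(** * Arrivals: a law of large numbers with a rate *)

Section ArrivalAverage.
Context d (Omega : measurableType d) (R : realType) (P : probability Omega R).
Context (n : nat) (K T0 : R) (A : 'I_n -> R -> {RV P >-> R}) (lam : 'I_n -> R).
Hypothesis T0_gt0 : 0 < T0.
Hypothesis arrivals : arrival_process K A.
Hypothesis lamE : forall i, ('E_P[A i 1%R] = (lam i)%:E)%E.
Context (i : 'I_n).

Local Notation L := (update_time T0).
Local Notation T := (update_period T0).

Let C : R := `|K| + `|lam i|.
Let C0 : 0 <= C. Proof. exact: addr_ge0. Qed.
Let slot (k : nat) : {RV P >-> R} := (A i k.+1%:R \- A i k%:R)%R.

(* The slot arrivals are only almost surely bounded; truncating the centered variable
   changes it on a null set. *)
Definition clip (x : R) : R := if `|x - lam i| <= `|K| + `|lam i| then x - lam i else 0.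

Let mclip : measurable_fun setT clip.
Proof.
apply: measurable_fun_if => //.
- by apply: measurable_fun_ler => //; apply: measurableT_comp => //; apply: measurable_funB.
- by apply: measurable_funTS; apply: measurable_funB.
Qed.

Let clip_bound x : `|clip x| <= C.
Proof. by rewrite /clip; case: ifP => //; rewrite normr0. Qed.

Let slot_lipschitz : {ae P, forall w, A i 0 w = 0 /\
  forall s t : R, 0 <= s -> s <= t -> 0 <= A i t w - A i s w <= K * (t - s)}.
Proof.
apply: filterS (arrival_lipschitz arrivals) => w /(_ i) [A0 h]; split => // s t s0.
rewrite le_eqVlt => /orP[/eqP <-|]; last exact: h.
by rewrite !subrr mulr0 lexx.
Qed.

Let slot_clip : {ae P, forall w, forall k, clip (slot k w) = slot k w - lam i}.
Proof.
apply: filterS slot_lipschitz => w [_ h] k; rewrite /clip /=.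
have := h k%:R k.+1%:R (ler0n _ _); rewrite ler_nat leqnSn -natr1 addrAC subrr add0r mulr1.
move=> /(_ isT) /andP[h1 h2]; rewrite ifT//.
apply: le_trans (ler_normB _ _) _; rewrite lerD2r ger0_norm//.
exact: le_trans h2 (ler_norm _).
Qed.

Let mclip_slot k : measurable_fun setT (fun w => clip (slot k w)).
Proof. exact: (measurableT_comp mclip). Qed.

Let integrable_clip k : P.-integrable setT (EFin \o (fun w => clip (slot k w))).
Proof. exact: (probability_bounded_integrable P (mclip_slot k) (fun w => clip_bound _)). Qed.

Let clip_mean0 : (\int[P]_w (clip (slot 0 w))%:E = 0)%E.
Proof.
have h : ('E_P[A i 1%R] = \int[P]_w ((clip (slot 0 w))%:E + (lam i)%:E))%E.
  rewrite unlock; apply: ae_eq_integral => //.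
  - by apply/measurable_EFinP.
  - by apply: emeasurable_funD => //; apply/measurable_EFinP.
  apply: filterS2 slot_lipschitz slot_clip => w [A0 _] h _.
  by rewrite (h 0%N) /= A0 subr0 -EFinD subrK.
move: h; rewrite integralD//; last 2 first.
- exact: integrable_clip.
- exact: (finite_measure_integrable_cst P (lam i) measurableT).
rewrite integral_cst//= [X in (_ * X)%E]probability_setT mule1 lamE.
have : (\int[P]_w (clip (slot 0 w))%:E \is a fin_num)%E by exact: integrable_fin_num (integrable_clip 0).
by case: (integral _ _ _) => // x _; rewrite -EFinD => -[]; rewrite -{1}[lam i]add0r => /addIr <-.
Qed.

Let clip_mean k : (\int[distribution P (slot k)]_x (clip x)%:E = 0)%E.
Proof.
have bounded j : P.-integrable setT ((EFin \o clip) \o slot j) by exact: integrable_clip.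
rewrite -clip_mean0 -(@integral_distribution _ _ _ _ _ P (slot 0) (EFin \o clip)); last 2 first.
  exact/measurable_EFinP.
  exact: bounded.
apply: eq_measure_integral => B mB _; exact: (arrival_identical arrivals).
Qed.

(** The second slot is integrated alone, the first being frozen; its clipped variable is centered
    because all slots have the law of slot 0. *)
Let clip_product k l : k != l -> (\int[P]_w (clip (slot k w) * clip (slot l w))%:E = 0)%E.
Proof.
move=> kl.
apply: (@resample_integral0 _ _ Omega _ R P (slot l) (slot k) _ _
  (fun z : R * R => clip z.1 * clip z.2) (C * C)).
- exact: measurable_funP.
- move=> E B mE mB.
  have F_meas (ik : 'I_n * nat) : g_sigma_algebra_preimage (slot_arrival A ik.1 ik.2) `<=` measurable.
    apply: g_sigma_algebra_preimage_measurable.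
    by apply: measurable_funB; exact: measurable_funP.
  apply: (@mutually_independent_rest _ _ _ P ('I_n * nat)%type
    (fun ik => g_sigma_algebra_preimage (slot_arrival A ik.1 ik.2)) F_meas _ _
    (arrival_independent arrivals) (i, l)).
  + by move=> ik; exact: g_sigma_algebra_preimage_setT.
  + by move=> ik; exact: g_sigma_algebra_preimage_setI.
  + by apply/g_sigma_algebra_preimageE; exists B.
  + apply: sub_gen_smallest; exists (i, k); first by apply: contraNneq kl => -[->].
    by apply/g_sigma_algebra_preimageE; exists E.
- by apply: measurable_funM; apply: measurableT_comp => //.
- by move=> z; rewrite normrM ler_pM.
move=> y.
transitivity (\int[distribution P (slot l)]_x ((clip y)%:E * (clip x)%:E))%E.
  by apply: eq_integral => x _; rewrite EFinM.
rewrite integralZl//; first by rewrite clip_mean mule0.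
exact: (probability_bounded_integrable (distribution P (slot l)) mclip clip_bound).
Qed.

Let msum N : measurable_fun setT (fun w => \sum_(k < N) clip (slot k w)).
Proof. by apply: measurable_sum => k; exact: mclip_slot. Qed.

Let clip_sum_square N :
  (\int[P]_w ((\sum_(k < N) clip (slot k w)) ^+ 2)%:E <= (C ^+ 2 * N%:R)%:E)%E.
Proof.
pose M N w := \sum_(k < N) clip (slot k w).
have MB m w : `|M m w| <= C * m%:R.
  apply: le_trans (ler_norm_sum _ _ _) _.
  by apply: (@le_trans _ _ (\sum_(k < m) C)); [exact: ler_sum|rewrite sumr_const card_ord mulr_natr].
elim: N => [|N IH].
  by rewrite integral0_eq ?mulr0// => w _; rewrite big_ord0 expr0n.
have cross : (\int[P]_w (\sum_(k < N) (clip (slot k w) * clip (slot N w)))%:E = 0)%E.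
  under eq_integral do rewrite -sumEFin.
  rewrite integral_sum//; last first.
    move=> k; apply: (@probability_bounded_integrable _ _ _ P _ (C * C)).
      by apply: measurable_funM; exact: mclip_slot.
    by move=> w; rewrite normrM ler_pM.
  by rewrite big1// => k _; rewrite clip_product// ltn_eqF.
have iM : P.-integrable setT (EFin \o (fun w => M N w ^+ 2)).
  apply: (@probability_bounded_integrable _ _ _ P _ ((C * N%:R) ^+ 2)).
    by apply: measurable_funX; exact: msum.
  by move=> w; rewrite normrX lerXn2r ?nnegrE ?mulr_ge0.
have iX : P.-integrable setT (EFin \o (fun w => 2 * \sum_(k < N) (clip (slot k w) * clip (slot N w)))).
  apply: (@probability_bounded_integrable _ _ _ P _ (2 * (C * N%:R * C))).
    apply: measurable_funM => //; apply: measurable_sum => k.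
    by apply: measurable_funM; exact: mclip_slot.
  move=> w; rewrite -mulr_suml normrM ger0_norm// ler_wpM2l// normrM.
  exact: ler_pM (MB N w) (clip_bound _).
have iZ : P.-integrable setT (EFin \o (fun w => clip (slot N w) ^+ 2)).
  apply: (@probability_bounded_integrable _ _ _ P _ (C ^+ 2)).
    by apply: measurable_funX; exact: mclip_slot.
  by move=> w; rewrite normrX lerXn2r ?nnegrE.
have -> : (\int[P]_w ((\sum_(k < N.+1) clip (slot k w)) ^+ 2)%:E =
    \int[P]_w ((M N w ^+ 2)%:E + (2 * \sum_(k < N) (clip (slot k w) * clip (slot N w)))%:E +
      (clip (slot N w) ^+ 2)%:E))%E.
  apply: eq_integral => w _; rewrite -!EFinD big_ord_recr/= -mulr_suml; congr (_%:E).
  by rewrite /M; ring.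
rewrite integralD//; last by apply: integrableD.
rewrite integralD//.
have -> : (\int[P]_w (2 * \sum_(k < N) (clip (slot k w) * clip (slot N w)))%:E = 0)%E.
  under eq_integral do rewrite EFinM.
  rewrite integralZl//; first by rewrite cross mule0.
  apply: (@probability_bounded_integrable _ _ _ P _ (C * N%:R * C)).
    by apply: measurable_sum => k; apply: measurable_funM; exact: mclip_slot.
  by move=> w; rewrite -mulr_suml normrM; exact: ler_pM (MB N w) (clip_bound _).
rewrite adde0 -natr1 mulrDr mulr1 EFinD; apply: leeD => //.
apply: (@le_trans _ _ (\int[P]_w (C ^+ 2)%:E)%E).
  apply: ge0_le_integral => //.
  - by move=> w _; rewrite lee_fin sqr_ge0.
  - by apply/measurable_EFinP; exact: measurable_funX.
  move=> w _; rewrite lee_fin -[leLHS]ger0_norm ?sqr_ge0// normrX.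
  by rewrite lerXn2r ?nnegrE.
by rewrite integral_cst//= [X in (_ * X)%E]probability_setT mule1.
Qed.

(** The variance of a sum of N slots is linear in N, and N is at most a multiple of (J + 1) T(J), so
    the sums weighted by (J + 1) / T(J) have summable second moments. Update times are not integers;
    the fraction of a slot left over costs at most [C]. *)
Lemma arrival_sum_ae : {ae P, forall w, exists2 B, 0 <= B &
  forall J, `|A i (L J) w - lam i * L J| <= B * (T J / J.+1%:R)}.
Proof.
have T1 J : 0 < T J := update_period_gt0 T0_gt0 J.
pose N J := Num.truncn (L J).
have NL J : (N J)%:R <= L J < (N J).+1%:R := truncn_itv (update_time_ge0 T0_gt0 J).
pose wt J : R := (J.+1%:R / T J) ^+ 2.
have wt0 J : 0 < wt J by rewrite exprn_gt0// divr_gt0.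
pose f (m J : nat) w := wt J * (\sum_(k < N J) clip (slot k w)) ^+ 2.
have f0 m J w : 0 <= f m J w by rewrite mulr_ge0 ?sqr_ge0// ltW.
(* Two powers for the weight, one for the number of slots, two for summability. *)
have [c c0 Tc] := update_period_superpolynomial T0_gt0 5.
pose D := C ^+ 2 * (1 + T0) / c.
have D0 : 0 <= D by rewrite divr_ge0 ?(ltW c0)// mulr_ge0 ?sqr_ge0// addr_ge0// ltW.
have : {ae P, forall w, exists B, forall M (y : nat -> R),
    (forall J, (J < M)%N -> exists m0, forall m, (m0 <= m)%N -> y J <= f m J w) ->
    \sum_(J < M) y J <= B}.
  apply: (@ae_bounded_of_summable _ _ _ P f (fun J => D * (J.+1%:R^-1) ^+ 2) (D * 2)) => [m J|//|m J|M].
  - by apply: measurable_funM => //; apply: measurable_funX; exact: msum.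
  - under eq_integral do rewrite EFinM.
    rewrite ge0_integralZl_EFin//; last 3 first.
    + by move=> w _; rewrite lee_fin sqr_ge0.
    + by apply/measurable_EFinP; apply: measurable_funX; exact: msum.
    + exact: ltW.
    apply: le_trans (_ : (wt J)%:E * (C ^+ 2 * (N J)%:R)%:E <= _)%E.
      by rewrite lee_pmul2l ?lte_fin//; exact: clip_sum_square.
    rewrite -EFinM lee_fin.
    have J1 : (0 : R) < J.+1%:R by rewrite ltr0n.
    have NT : (N J)%:R <= (1 + T0) * J.+1%:R * T J.
      have /andP[h _] := NL J; apply: le_trans h _.
      apply: le_trans (update_time_le_period T0_gt0 J).
      exact: update_time_le.
    apply: (@le_trans _ _ (wt J * (C ^+ 2 * ((1 + T0) * J.+1%:R * T J)))).
      by apply: ler_wpM2l; [exact: ltW|rewrite ler_wpM2l// sqr_ge0].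
    have -> : wt J * (C ^+ 2 * ((1 + T0) * J.+1%:R * T J)) =
        C ^+ 2 * (1 + T0) * J.+1%:R ^+ 3 / T J.
      by rewrite /wt; field; rewrite gt_eqF.
    rewrite ler_pdivrMr// /D.
    have -> : C ^+ 2 * (1 + T0) / c * J.+1%:R^-1 ^+ 2 * T J =
        C ^+ 2 * (1 + T0) * (J.+1%:R^-1 ^+ 2 * (T J / c)) by field; rewrite !gt_eqF.
    rewrite ler_wpM2l ?mulr_ge0 ?sqr_ge0 ?addr_ge0 ?(ltW T0_gt0)//.
    rewrite exprVn mulrC ler_pdivlMr ?exprn_gt0// -exprD ler_pdivlMr// mulrC.
    exact: Tc.
  - by rewrite -mulr_sumr ler_wpM2l//; exact: sum_inv_square_le.
apply: filterS3 slot_lipschitz slot_clip => w [A0 lip] clipE [B hB].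
have fB J : f 0%N J w <= B.
  apply: le_trans (hB J.+1 (f 0%N ^~ w) _); last by move=> J' _; exists 0%N.
  by rewrite big_ord_recr/= lerDr sumr_ge0.
have AN m : A i m%:R w = lam i * m%:R + \sum_(k < m) clip (slot k w).
  elim: m => [|m IH]; first by rewrite big_ord0 A0 mulr0 addr0.
  rewrite big_ord_recr/= clipE /= IH -[X in lam i * X]natr1; ring.
have [c1 c10 Tc1] := update_period_superpolynomial T0_gt0 1.
exists (Num.sqrt B + C / c1); first by rewrite addr_ge0 ?sqrtr_ge0// divr_ge0 ?(ltW c10).
move=> J; have J1 : (0 : R) < J.+1%:R by rewrite ltr0n.
have /andP[h1 h2] := NL J.
have -> : A i (L J) w - lam i * L J = \sum_(k < N J) clip (slot k w) +
   ((A i (L J) w - A i (N J)%:R w) - lam i * (L J - (N J)%:R)) by rewrite AN; ring.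
rewrite mulrDl; apply: le_trans (ler_normD _ _) _; apply: lerD.
  have := ler_wsqrtr (fB J); rewrite /f /wt -exprMn sqrtr_sqr normrM gtr0_norm ?divr_gt0//.
  by rewrite -ler_pdivlMl ?divr_gt0// invf_div mulrC.
apply: (@le_trans _ _ C); last first.
  have -> : C / c1 * (T J / J.+1%:R) = C * (T J / (c1 * J.+1%:R)) by field; rewrite !gt_eqF.
  by rewrite ler_peMr// ler_pdivlMr ?mulr_gt0// mul1r -[J.+1%:R]expr1.
apply: le_trans (ler_normB _ _) _.
have x1 : 0 <= L J - (N J)%:R <= 1.
  by rewrite subr_ge0 h1 /= lerBlDl natr1 ltW.
case/andP: x1 => x0 x1.
apply: lerD.
  have /andP[y0 y1] := lip _ _ (ler0n _ _) h1.
  rewrite ger0_norm//; apply: le_trans y1 _; apply: le_trans (ler_norm _) _.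
  by rewrite normrM (ger0_norm x0) ler_piMr.
by rewrite normrM (ger0_norm x0) ler_piMr.
Qed.

Lemma arrival_rate_error_ae : {ae P, forall w, exists2 B, 0 <= B &
  forall J, `|arrival_rate T0 (fun i t => A i t w) i J - lam i| <= B / J.+1%:R}.
Proof.
apply: filterS arrival_sum_ae => w [B B0 hB].
pose c := (1 + T0^-1) * expR 1.
exists (B * c + B) => [|J].
  by rewrite addr_ge0// mulr_ge0// mulr_ge0 ?expR_ge0// addr_ge0// invr_ge0 ltW.
have T1 : 0 < T J := update_period_gt0 T0_gt0 J.
have J1 : (0 : R) < J.+1%:R by rewrite ltr0n.
have -> : arrival_rate T0 (fun i t => A i t w) i J - lam i =
    ((A i (L J.+1) w - lam i * L J.+1) - (A i (L J) w - lam i * L J)) / T J.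
  by rewrite /arrival_rate update_timeS; field; rewrite gt_eqF.
rewrite normrM normfV (gtr0_norm T1) ler_pdivrMr//.
apply: le_trans (ler_normB _ _) _.
have -> : (B * c + B) / J.+1%:R * T J = B * (c * T J / J.+1%:R) + B * (T J / J.+1%:R) by ring.
apply: lerD => //; apply: le_trans (hB J.+1) _; rewrite ler_wpM2l//.
apply: ler_pM; rewrite ?invr_ge0//; first by rewrite ltW// update_period_gt0.
  exact: update_period_ratio.
by rewrite lef_pV2 ?posrE// ler_nat.
Qed.

End ArrivalAverage.

(** * Queues *)

Section Queue.
Context (R : realType).

Lemma has_integral_le1 (f : R -> R) a b v : has_integral f a b v ->
  (forall x, f x <= 1) -> v <= b - a.
Proof.
move=> h f1; have [ab _ _ <-] := h.
have [_ _ _ E] := has_integral_cst (f := cst 1) (c := 1) ab (fun x _ => erefl).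
rewrite -[leRHS]mul1r -E; apply: le_Rintegral => //.
  exact: has_integral_integrable h.
exact: has_integral_integrable (has_integral_cst (f := cst 1) (c := 1) ab (fun x _ => erefl)).
Qed.

(** The left end is exempt because the queue is empty there: the departure integrand vanishes at
    that instant even if the node transmits. *)
Lemma integral_eq_oc (f g : R -> R) a b v : has_integral f a b v ->
  (forall x, a < x <= b -> g x = f x) -> \int[lebesgue_measure]_(x in `[a, b]) g x = v.
Proof.
move=> h fg; have [ab _ _ <-] := h.
have fi : lebesgue_measure.-integrable `]a, b] (EFin \o f).
  apply: (integrableS _ _ _ (has_integral_integrable h)) => // x/=.
  by rewrite !in_itv/= => /andP[/ltW-> ->].
rewrite -Rintegral_itv_obnd_cbnd; last first.
  apply: eq_integrable fi => // x; rewrite inE/= in_itv/= => xab.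
  by rewrite /= fg.
rewrite -Rintegral_itv_obnd_cbnd//; apply: eq_Rintegral => x.
by rewrite inE/= in_itv/=; exact: fg.
Qed.

Context (n : nat) (a : 'I_n -> R -> R) (s : 'I_n -> R -> bool) (q : 'I_n -> R -> R).
Context (K : R) (i : 'I_n) (S : R -> R).
Hypothesis queue : queue_path a s q.
Hypothesis a_lip : forall u t, 0 <= u -> u <= t -> 0 <= a i t - a i u <= K * (t - u).
Hypothesis s_integral : forall u t, 0 <= u -> u <= t ->
  has_integral (fun v => (s i v)%:R) u t (S t - S u).

Let F t := a i t - S t.

(* [u] is the last time before [t] at which the queue is empty.  Only the upper bound
   [q t - q u <= K * (t - u)] is needed to see that the supremum is attained. *)
Lemma queue_last_empty t : 0 <= t -> exists2 u, 0 <= u <= t & q i t = F t - F u.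
Proof.
have [q0 q_ge0 qE] := queue.
move=> t0; have [qt|qt] := eqVneq (q i t) 0.
  by exists t; rewrite ?t0 ?lexx// qt subrr.
have K0 : 0 <= K.
  by have := a_lip (lexx 0) ler01; rewrite subr0 mulr1 => /andP[]; exact: le_trans.
pose Z := [set v | 0 <= v <= t /\ q i v = 0].
have Z0 : Z 0 by split; rewrite ?lexx.
have supZ : has_sup Z by split; [exists 0|exists t => v [/andP[]]].
pose u := sup Z.
have Zu v : Z v -> v <= u by move=> Zv; exact: sup_ubound supZ.2 _ Zv.
have u0 : 0 <= u := Zu _ Z0.
have ut : u <= t by apply: sup_le_ub; [exists 0|move=> v [/andP[]]].
have qu : q i u = 0.
  apply/eqP; rewrite eq_le q_ge0// andbT; apply/ler_addgt0Pr => eps eps0; rewrite add0r.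
  have K1 : 0 < K + 1 by rewrite ltr_wpDl.
  have [v Zv uv] := sup_adherent (divr_gt0 eps0 K1) supZ.
  have [/andP[v0 vt] qv] := Zv.
  have := Zu _ Zv; rewrite le_eqVlt => /orP[/eqP <-|vu]; first by rewrite qv ltW.
  rewrite (qE i v u)// qv add0r.
  have sv0 : 0 <= service s q i v u by apply: Rintegral_ge0 => x _; rewrite mulr_ge0.
  have /andP[_ h] := a_lip v0 (ltW vu).
  apply: (@le_trans _ _ (a i u - a i v)); first by rewrite gerDr oppr_le0.
  apply: le_trans h _; apply: (@le_trans _ _ ((K + 1) * (u - v))).
    by rewrite ler_wpM2r ?lerDl// subr_ge0 ltW.
  by rewrite -ler_pdivlMl// mulrC ltW// ltrBlDl -ltrBlDr.
exists u; first by rewrite u0.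
have ut' : u < t by rewrite lt_neqAle ut andbT; apply: contra_neq qt => <-.
rewrite (qE i u t)// qu add0r.
have -> : service s q i u t = S t - S u.
  apply: (integral_eq_oc (s_integral u0 ut)) => x /andP[ux xt].
  rewrite [X in _ * X](_ : _ = 1) ?mulr1//.
  have x0 : 0 <= x := le_trans u0 (ltW ux).
  rewrite lt_def q_ge0// andbT; case: eqVneq => // qx.
  have Zx : Z x by split; rewrite ?x0.
  by have := lt_le_trans ux (Zu x Zx); rewrite ltxx.
by rewrite /F; ring.
Qed.

(** The last empty time u may stay small while t grows, so smallness of F(u) / u cannot always be
    used; for u below the threshold [M1], F(u) is bounded by a constant, negligible against t. *)
Lemma queue_rate_cvg0 : S 0 = 0 ->
  F t / t @[t --> +oo] --> 0 -> q i t / t @[t --> +oo] --> 0.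
Proof.
move=> S0 F0; have [_ q_ge0 _] := queue.
apply/cvgrPdist_le => eps eps0.
have e3 : 0 < eps / 3 by rewrite divr_gt0.
have /cvgrPdist_le/(_ _ e3)[M [_ hM]] := F0.
pose M1 := Num.max M 0.
have FB t : M1 < t -> `|F t| <= eps / 3 * t.
  rewrite gt_max => /andP[Mt t0]; have := hM t Mt.
  by rewrite sub0r normrN normrM normfV (gtr0_norm t0) ler_pdivrMr.
have Flow u : 0 <= u -> u <= M1 -> `|F u| <= `|a i 0| + (`|K| + 1) * M1.
  move=> u0 uM; have /andP[h1 h2] := a_lip (lexx 0) u0.
  have h4 : 0 <= S u - S 0 by apply: has_integral_ge0 (s_integral (lexx 0) u0) _.
  have h5 : S u - S 0 <= u - 0 by apply: has_integral_le1 (s_integral (lexx 0) u0) _ => x; case: (s i x).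
  rewrite S0 !subr0 in h4 h5 h2 *.
  have -> : F u = a i 0 + ((a i u - a i 0) - S u) by rewrite /F; ring.
  apply: le_trans (ler_normD _ _) _; rewrite lerD2l.
  apply: le_trans (ler_normB _ _) _; rewrite mulrDl mul1r; apply: lerD.
    rewrite ger0_norm//; apply: le_trans h2 _; apply: le_trans (ler_norm _) _.
    by rewrite normrM ler_wpM2l// ger0_norm.
  by rewrite ger0_norm// (le_trans h5).
pose C := `|a i 0| + (`|K| + 1) * M1.
have C0 : 0 <= C by rewrite addr_ge0// mulr_ge0 ?addr_ge0// le_max lexx orbT.
exists (Num.max M1 (C / (eps / 3))); split; first by rewrite num_real.
move=> t; rewrite gt_max => /andP[Mt Ct].
have t0 : 0 < t by apply: le_lt_trans Mt; rewrite le_max lexx orbT.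
rewrite sub0r normrN normrM normfV (gtr0_norm t0) ler_pdivrMr//.
have [u /andP[u0 ut] ->] := queue_last_empty (ltW t0).
apply: le_trans (ler_normB _ _) _.
have h1 := FB t Mt.
have h2 : `|F u| <= eps / 3 * t + eps / 3 * t.
  have [uM|Mu] := leP u M1.
    apply: le_trans (Flow u u0 uM) _; rewrite -/C.
    have : C <= eps / 3 * t by rewrite -ler_pdivrMl// mulrC ltW.
    by move=> h; rewrite (le_trans h)// lerDl mulr_ge0// ltW.
  apply: le_trans (FB u Mu) _; rewrite -mulrDr ler_wpM2l ?(ltW e3)//.
  by rewrite (le_trans ut)// lerDl ltW.
have -> : eps * t = eps / 3 * t + (eps / 3 * t + eps / 3 * t) by field.
exact: lerD.
Qed.

End Queue.

(** * Conclusion along one sample path *)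

Section NetworkPath.
Context (R : realType) (n : nat) (e : rel 'I_n) (K T0 alpha0 : R) (lam : 'I_n -> R).
Hypothesis T0_gt0 : 0 < T0.
Hypothesis lam_capacity : capacity_region e lam.
Context (a : 'I_n -> R -> R) (s : 'I_n -> R -> bool) (r q : 'I_n -> R -> R).
Local Notation L := (update_time T0).
Local Notation T := (update_period T0).
Hypothesis a0 : forall i, a i 0 = 0.
Hypothesis a_lip : forall i u t, 0 <= u -> u < t -> 0 <= a i t - a i u <= K * (t - u).
Hypothesis alg : algorithm1_path T0 alpha0 a s r.
Hypothesis queue : queue_path a s q.
Hypothesis s_windows : forall i J,
  has_integral (fun t => (s i t)%:R) (L J) (L J.+1) (T J * window_service T0 s i J) /\
  0 <= window_service T0 s i J <= 1.
Context (B C : R).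
Hypothesis a_error : forall i J, `|arrival_rate T0 a i J - lam i| <= B / J.+1%:R.
Hypothesis s_error : forall J i,
  `|window_service T0 s i J - mean_service e (fun j => r j (L J)) i| <= C / J.+1%:R.

Let inv_cvg0 (D : R) : (fun J => D / J.+1%:R) @ \oo --> (0 : R).
Proof. by rewrite -(mulr0 D); apply: cvgMr; exact: cvg_harmonic. Qed.

Let a_le i u t : 0 <= u -> u <= t -> 0 <= a i t - a i u <= K * (t - u).
Proof.
move=> u0; rewrite le_eqVlt => /orP[/eqP <-|]; last exact: a_lip.
by rewrite !subrr mulr0 lexx.
Qed.

Lemma window_service_cvg i : window_service T0 s i @ \oo --> lam i.
Proof.
(* Window 0 uses the step [alpha0]; the ascent is started at window 1, where the step of index j is
   1 / (j + 1). *)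
pose x j k := arrival_rate T0 a k j.+1 - window_service T0 s k j.+1.
pose D := B + C.
have xB j k : `|x j k| <= `|K| + 1.
  have T1 := update_period_gt0 T0_gt0 j.+1.
  have /andP[h1 h2] := a_le k (update_time_ge0 T0_gt0 j.+1) (ltW (update_time_ltS T0_gt0 j.+1)).
  have h3 : 0 <= arrival_rate T0 a k j.+1 <= `|K|.
    rewrite /arrival_rate divr_ge0 ?(ltW T1)//= ler_pdivrMr//; apply: le_trans h2 _.
    by rewrite update_timeS addrAC subrr add0r ler_wpM2r ?ler_norm// ltW.
  have [_ h4] := s_windows k j.+1; move: h3 h4; rewrite /x ler_norml.
  move: (arrival_rate _ _ _ _) (window_service _ _ _ _) => y z /andP[? ?] /andP[? ?].
  by apply/andP; split; lra.
have xE j k : `|x j k - (lam k - mean_service e (fun l => r l (L j.+1)) k)| <= D / j.+1%:R.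
  have -> : x j k - (lam k - mean_service e (fun l => r l (L j.+1)) k) =
     (arrival_rate T0 a k j.+1 - lam k) - (window_service T0 s k j.+1 -
      mean_service e (fun l => r l (L j.+1)) k) by rewrite /x; ring.
  (* Nonnegativity of the constant is recovered from the bound itself. *)
  have step (E y : R) : `|y| <= E / j.+2%:R -> `|y| <= E / j.+1%:R.
    move=> h; apply: (le_trans h); have E0 : 0 <= E.
      by rewrite -(pmulr_lge0 E (_ : 0 < j.+2%:R^-1)) ?invr_gt0// (le_trans _ h).
    by rewrite ler_wpM2l// lef_pV2 ?posrE// ler_nat.
  apply: le_trans (ler_normB _ _) _; rewrite /D mulrDl.
  by apply: lerD; apply: step; [exact: a_error|exact: s_error].
have ms : (fun j => mean_service e (fun l => r l (L j.+1)) i) @ \oo --> lam i.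
  apply: (mean_service_cvg lam_capacity (rr := fun j k => r k (L j.+1)) (x := x)
    (B := `|K| + 1) (C := n%:R * D ^+ 2 * 2)) => //.
  - by move=> j k; case: (alg k) => _ _ h; exact: (h j.+1).
  - move=> N; apply: (@le_trans _ _ (\sum_(j < N) n%:R * D ^+ 2 * j.+1%:R^-1 ^+ 2)); last first.
      rewrite -mulr_sumr; apply: ler_wpM2l; last exact: sum_inv_square_le.
      by rewrite mulr_ge0 ?sqr_ge0.
    apply: ler_sum => j _; rewrite mulrC -[leRHS]mulr1; apply: ler_pM.
    + by apply: sumr_ge0 => k _; exact: sqr_ge0.
    + by rewrite invr_ge0.
    + apply: (@le_trans _ _ (\sum_(k < n) D ^+ 2 * j.+1%:R^-1 ^+ 2)); last first.
        by rewrite sumr_const card_ord -[leLHS]mulr_natl mulrA.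
      apply: ler_sum => k _; rewrite -exprMn -[leLHS]ger0_norm ?sqr_ge0// normrX.
      by rewrite lerXn2r ?nnegrE// ?(le_trans _ (xE j k))//; exact: xE.
    + by rewrite invf_le1// ler1n.
suff main : (fun j => window_service T0 s i j.+1) @ \oo --> lam i by rewrite -cvg_shiftS; exact: main.
have -> : (fun j => window_service T0 s i j.+1) =
    (fun j => (window_service T0 s i j.+1 - mean_service e (fun l => r l (L j.+1)) i)
      + mean_service e (fun l => r l (L j.+1)) i) by apply/funext => j; rewrite subrK.
rewrite -[X in _ --> X]add0r; apply: cvgD => //; apply/norm_cvg0P.
have h : (fun j => C / j.+2%:R) @ \oo --> (0 : R) by have := inv_cvg0 C; rewrite -cvg_shiftS.
apply: (squeeze_cvgr _ (cvg_cst 0) h).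
by apply: nearW => j; rewrite normr_ge0 s_error.
Qed.

Lemma arrival_rate_cvg i : arrival_rate T0 a i @ \oo --> lam i.
Proof.
have -> : arrival_rate T0 a i = (fun j => (arrival_rate T0 a i j - lam i) + lam i).
  by apply/funext => j; rewrite subrK.
rewrite -[X in _ --> X]add0r; apply: cvgD; last exact: cvg_cst.
apply/norm_cvg0P.
apply: (squeeze_cvgr _ (cvg_cst 0) (inv_cvg0 B)).
by apply: nearW => j; rewrite normr_ge0 a_error.
Qed.

(** Time during which the node holds the channel, including the time when its queue is empty; this
    is what the algorithm measures, whereas departures count only the rest. *)
Let S i t := \int[lebesgue_measure]_(v in `[0, t]) ((s i v)%:R : R).

Let s_upto i J : exists v, has_integral (fun t => (s i t)%:R) 0 (L J) v.
Proof.
elim: J => [|J [v h]]; first by exists 0; rewrite update_time0; exact: has_integral_point.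
by exists (v + T J * window_service T0 s i J); apply: has_integral_cat h _; case: (s_windows i J).
Qed.

Let s_integral i u t : 0 <= u -> u <= t ->
  has_integral (fun v => (s i v)%:R) u t (S i t - S i u).
Proof.
move=> u0 ut; have [J /andP[_ tJ]] := update_time_window T0_gt0 (le_trans u0 ut).
have [v hv] := s_upto i J.+1.
have [v1 h1] := has_integral_sub hv (lexx 0) u0 (le_trans ut (ltW tJ)).
have [v2 h2] := has_integral_sub hv u0 ut (ltW tJ).
have h12 := has_integral_cat h1 h2.
have -> : S i u = v1 by case: h1.
have -> : S i t = v1 + v2 by case: h12.
by rewrite addrAC subrr add0r.
Qed.

Let S0 i : S i 0 = 0.
Proof. by case: (has_integral_point (fun v => (s i v)%:R) 0). Qed.

Let arrivals_cvg i : a i t / t @[t --> +oo] --> lam i.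
Proof.
apply: (@window_average_cvg R T0 T0_gt0 _ `|K|) => //; last exact: arrival_rate_cvg.
move=> u t u0 ut; have /andP[h1 h2] := a_le i u0 ut.
by rewrite ger0_norm// (le_trans h2)// ler_wpM2r ?ler_norm// subr_ge0.
Qed.

Let service_cvg i : S i t / t @[t --> +oo] --> lam i.
Proof.
apply: (@window_average_cvg R T0 T0_gt0 _ 1) => //.
  move=> u t u0 ut; have h := s_integral i u0 ut.
  rewrite ger0_norm ?mul1r; first by apply: has_integral_le1 h _ => x; case: (s i x).
  exact: has_integral_ge0 h _.
suff -> : (fun J => (S i (L J.+1) - S i (L J)) / T J) = window_service T0 s i.
  exact: window_service_cvg.
apply/funext => J; have [h _] := s_windows i J.
have := has_integral_unique h (s_integral i (update_time_ge0 T0_gt0 J) (ltW (update_time_ltS T0_gt0 J))).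
by move=> <-; rewrite mulrAC mulfV ?mul1r// gt_eqF// update_period_gt0.
Qed.

Lemma queue_rate_cvg i : q i t / t @[t --> +oo] --> 0.
Proof.
apply: (queue_rate_cvg0 queue (K := K) (S := S i)) => //.
- exact: a_le.
- exact: s_integral.
have -> : (fun t => (a i t - S i t) / t) = (fun t => a i t / t - S i t / t).
  by apply/funext => t; rewrite mulrBl.
rewrite -[X in _ --> X](subrr (lam i)).
exact: (cvgB (@arrivals_cvg i) (@service_cvg i)).
Qed.

Lemma departure_rate_cvg i : departures s q i t / t @[t --> +oo] --> lam i.
Proof.
have E t : 0 < t -> a i t / t - q i t / t = departures s q i t / t.
  move=> t0; have [q0 _ qE] := queue.
  by rewrite -mulrBl (qE i 0 t)// q0 a0 /departures; congr (_ / _); ring.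
have h : a i t / t - q i t / t @[t --> +oo] --> lam i.
  rewrite -[X in _ --> X]subr0.
  exact: (cvgB (@arrivals_cvg i) (@queue_rate_cvg i)).
apply: cvg_trans h; apply: near_eq_cvg.
by exists 0; split; [exact: num_real|exact: E].
Qed.

End NetworkPath.

Theorem theorem1 (R : realType) (d : measure_display) (Omega : measurableType d)
    (P : probability Omega R) (n : nat) (e : rel 'I_n)
    (e_sym : symmetric e) (e_irr : irreflexive e)
    (K T0 alpha0 : R) (T0_gt0 : 0 < T0) (alpha0_gt0 : 0 < alpha0)
    (A : 'I_n -> R -> {RV P >-> R}) (X : bool -> 'I_n -> nat -> {RV P >-> R})
    (sigma : 'I_n -> R -> {RV P >-> bool}) (r Q : 'I_n -> R -> {RV P >-> R})
    (lam : 'I_n -> R)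
    (network : csma_network e K T0 alpha0 A X sigma r Q)
    (lamE : forall i, ('E_P[A i 1%R] = (lam i)%:E)%E)
    (lam_gt0 : forall i, 0 < lam i)
    (lam_capacity : capacity_region e lam) :
  {ae P, forall w, forall i,
    departures (fun i t => sigma i t w) (fun i t => Q i t w) i t / t
      @[t --> +oo] --> lam i} /\
  {ae P, forall w, forall i, Q i t w / t @[t --> +oo] --> (0 : R)}.
Proof.
suff h : {ae P, forall w, forall i,
    departures (fun i t => sigma i t w) (fun i t => Q i t w) i t / t
      @[t --> +oo] --> lam i /\ Q i t w / t @[t --> +oo] --> (0 : R)}.
  by split; apply: filterS h => w hw i; case: (hw i).
have arrivals := network_arrivals network.
have errors := ae_forall_count (fun i => arrival_rate_error_ae T0_gt0 arrivals lamE i).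
have inputs : {ae P, forall w,
    [/\ forall i, A i 0 w = 0 /\ (forall s t, 0 <= s -> s < t -> 0 <= A i t w - A i s w <= K * (t - s)),
        algorithm1_path T0 alpha0 (fun i t => A i t w) (fun i t => sigma i t w) (fun i t => r i t w) &
        queue_path (fun i t => A i t w) (fun i t => sigma i t w) (fun i t => Q i t w)]}.
  by apply: filterS3 (arrival_lipschitz arrivals) (network_algorithm network) (network_queues network).
have service := network_service_ae e_sym e_irr T0_gt0 alpha0_gt0 network.
apply: filterS3 errors inputs service => w errors [lip alg queue] [windows [C C0 s_error]] i.
have /choice[B hB] : forall i, exists B, 0 <= B /\
    forall J, `|arrival_rate T0 (fun i t => A i t w) i J - lam i| <= B / J.+1%:R.
  by move=> j; have [B B0 h] := errors j; exists B.
have a_error j J : `|arrival_rate T0 (fun i t => A i t w) j J - lam j| <= (\sum_k B k) / J.+1%:R.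
  have [_ h] := hB j; apply: le_trans (h J) _; rewrite ler_wpM2r ?invr_ge0//.
  by rewrite (bigD1 j)//= lerDl sumr_ge0// => k _; case: (hB k).
have a0 j : A j 0 w = 0 by case: (lip j).
have a_lip j s t : 0 <= s -> s < t -> 0 <= A j t w - A j s w <= K * (t - s).
  by case: (lip j) => _; exact.
split.
  exact: (departure_rate_cvg T0_gt0 lam_capacity a0 a_lip alg queue windows a_error s_error).
exact: (queue_rate_cvg T0_gt0 lam_capacity a0 a_lip alg queue windows a_error s_error).
Qed.
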